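(* Let $t_0$ be a seed (classical case) or a quantum seed (quantum case) with $\tilde B(t_0)$ of full rank, let $F\subset I_{\mathrm{uf}}$, and let $\mathfrak f_F t_0$ be the seed obtained from $t_0$ by freezing the vertices in $F$. If $z$ is a localized (quantum) cluster monomial of $\mathcal U(t_0)$, then $\mathfrak f_F^{t_0} z$ is a localized (quantum) cluster monomial of $\mathcal U(\mathfrak f_F t_0)$.
   Context: Base ring: in the classical case $\Bbbk=\mathbb Z$ and $v=1$; in the quantum case $\Bbbk=\mathbb Z[v^{\pm1}]$ with $v$ an indeterminate. $\mathbb N=\{0,1,2,\dots\}$, $[a]_+=\max(a,0)$. Seeds. A seed $t$ consists of a finite set $I=I_{\mathrm{uf}}\sqcup I_{\mathrm f}$ (unfrozen and frozen vertices), positive integers $(d_i)_{i\in I}$, a rational matrix $(b_{ij})_{i,j\in I}$ with $d_i^\vee b_{ij}=-d_j^\vee b_{ji}$ (where $d_i^\vee=\mathrm{lcm}(d_j)_{j\in I}/d_i$) and $b_{ij}\in\mathbb Z$ whenever $i\in I_{\mathrm{uf}}$ or $j\in I_{\mathrm{uf}}$, and indeterminates $(x_i)_{i\in I}$. Put $\tilde B=(b_{ik})_{i\in I,k\in I_{\mathrm{uf}}}$. Let $f_i$ ($i\in I$), $e_k$ ($k\in I_{\mathrm{uf}}$) be the unit vectors of $\mathbb Z^I$, $\mathbb Z^{I_{\mathrm{uf}}}$, and $p^*:\mathbb Z^{I_{\mathrm{uf}}}\to\mathbb Z^I$ the linear map $p^*e_k=\sum_i b_{ik}f_i$ (injective if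 $\tilde B$ has full rank). A quantum seed is a seed with a $\mathbb Z$-valued skew-symmetric bilinear form $\lambda$ on $\mathbb Z^I$ such that $\lambda(f_i,p^*e_k)=\delta_{ik}\mathbf d_k$ for some strictly positive integers $\mathbf d_k$. Laurent polynomials. $\mathcal{LP}(t)=\bigoplus_{m\in\mathbb Z^I}\Bbbk x^m$ with $x_i=x^{f_i}$ and multiplication $x^g*x^h=v^{\lambda(g,h)}x^{g+h}$ (the usual product in the classical case). We write $x(t)^m$ for the element $x^m$ of $\mathcal{LP}(t)$. Mutation at $k\in I_{\mathrm{uf}}$: $t'=\mu_kt$ has the same $I,I_{\mathrm{uf}},d_i$; $b'_{ij}=-b_{ij}$ if $k\in\{i,j\}$, and $b'_{ij}=b_{ij}+[b_{ik}]_+[b_{kj}]_+-[-b_{ik}]_+[-b_{kj}]_+$ otherwise; $x'_i=x_i$ for $i\ne k$ and $x_k'=x^{-f_k+\sum_i[b_{ik}]_+f_i}+x^{-f_k+\sum_i[-b_{ik}]_+f_i}$; in the quantum case $\lambda'(f_i,f_j)=\lambda(g_i,g_j)$ with $g_i=f_i$ for $i\neq k$ and $g_k=-f_k+\sum_i[-b_{ik}]_+f_i$. The (skew-)fields of fractions of $\mathcal{LP}(t')$ and $\mathcal{LP}(t)$ are identified accordingly. $\Delta^+_{t_0}$ is the set of all seeds obtained from $t_0$ by finite sequences of mutations at unfrozen vertices. The upper cluster algebra is $\mathcal U(t_0)=\bigcap_{t\in\Delta_{t_0}^+}\mathcal{LP}(t)$. The localized (quantum) cluster monomials of $\mathcal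 U(t_0)$ are the elements $x(t)^m$ with $t\in\Delta^+_{t_0}$, $m\in\mathbb N^{I_{\mathrm{uf}}}\oplus\mathbb Z^{I_{\mathrm f}}$. Freezing. For $F\subset I_{\mathrm{uf}}$, $\mathfrak f_Ft_0$ is the seed with the same data as $t_0$ (the same $\lambda$ in the quantum case), except that its set of unfrozen vertices is $I_{\mathrm{uf}}\setminus F$ and its set of frozen vertices is $I_{\mathrm f}\sqcup F$. So $\mathcal{LP}(\mathfrak f_Ft_0)=\mathcal{LP}(t_0)$ as algebras. It is known that any localized (quantum) cluster monomial $z$ of $\mathcal U(t_0)$ has a unique expansion in $\mathcal{LP}(t_0)$ of the form $z=\sum_{n\in\mathbb N^{I_{\mathrm{uf}}}}c_n x^{g+p^*n}$ with $g\in\mathbb Z^I$, $c_n\in\Bbbk$ almost all zero, and $c_0=1$. Define $$\mathfrak f_F^{t_0}z=\sum_{n:\ \mathrm{supp}\,n\cap F=\emptyset}c_nx^{g+p^*n},\qquad \mathrm{supp}\,n=\{k\in I_{\mathrm{uf}}: n_k\ne0\}.$$ *)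

(* Defs.v *)
From HB Require Import structures.
From Stdlib Require Import ClassicalEpsilon.
From mathcomp Require Import all_boot all_order all_algebra.
From mathcomp.finmap Require Import finmap.
From mathcomp.multinomials Require Import monalg.

Set Implicit Arguments.
Unset Strict Implicit.
Unset Printing Implicit Defensive.

Import Order.TTheory GRing.Theory Num.Theory.

Local Open Scope ring_scope.

Record bichar (k : comNzRingType) (G : zmodType) := Bichar {
  bichar_fun :> G -> G -> k;
  bichar0l : forall h, bichar_fun 0 h = 1;
  bichar0r : forall g, bichar_fun g 0 = 1;
  bicharDl : forall g1 g2 h,
    bichar_fun (g1 + g2) h = bichar_fun g1 h * bichar_fun g2 h;
  bicharDr : forall g h1 h2,
    bichar_fun g (h1 + h2) = bichar_fun g h1 * bichar_fun g h2 }.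

(* Free k-module on the x^g (written [<< 1 *g g >>]), g in G, with product
   x^g * x^h = w(g, h) x^(g + h). *)
Definition twisted (k : comNzRingType) (G : zmodType) (w : bichar k G) : Type :=
  {malg k[G]}.

Section TwistedRing.
Context (k : comNzRingType) (G : zmodType) (w : bichar k G).
Local Notation A := (twisted w).

HB.instance Definition _ := GRing.Zmodule.on A.

Definition twone : A := << 1 *g 0 >>.

Definition twmul (a b : A) : A :=
  \sum_(g <- msupp a) \sum_(h <- msupp b)
     << a@_g * b@_h * w g h *g (g + h) >>.

Lemma twmulEw (d1 d2 : {fset G}) (a b : A) :
  (msupp a `<=` d1)%fset -> (msupp b `<=` d2)%fset ->
  twmul a b =
  \sum_(g <- d1) \sum_(h <- d2) << a@_g * b@_h * w g h *g (g + h) >>.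
Proof.
move=> s1 s2; rewrite /twmul.
transitivity (\sum_(g <- msupp a) \sum_(h <- d2)
   << a@_g * b@_h * w g h *g (g + h) >> : A).
  apply: eq_bigr => g _; apply/big_fset_incl => // h _ hb.
  by rewrite (mcoeff_outdom hb) mulr0 mul0r monalgU0.
apply/big_fset_incl => // g _ ga; rewrite big1 // => h _.
by rewrite (mcoeff_outdom ga) !mul0r monalgU0.
Qed.

Lemma twmulDl : left_distributive twmul +%R.
Proof.
move=> a b c.
rewrite (twmulEw (msuppD_le a b) (fsubset_refl (msupp c))).
rewrite (twmulEw (fsubsetUl (msupp a) (msupp b)) (fsubset_refl (msupp c))).
rewrite (twmulEw (fsubsetUr (msupp a) (msupp b)) (fsubset_refl (msupp c))).
rewrite -big_split /=; apply: eq_bigr => g _.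
rewrite -big_split /=; apply: eq_bigr => h _.
by rewrite mcoeffD !mulrDl monalgUD.
Qed.

Lemma twmulDr : right_distributive twmul +%R.
Proof.
move=> a b c.
rewrite (twmulEw (fsubset_refl (msupp a)) (msuppD_le b c)).
rewrite (twmulEw (fsubset_refl (msupp a)) (fsubsetUl (msupp b) (msupp c))).
rewrite (twmulEw (fsubset_refl (msupp a)) (fsubsetUr (msupp b) (msupp c))).
rewrite -big_split /=; apply: eq_bigr => g _.
rewrite -big_split /=; apply: eq_bigr => h _.
by rewrite mcoeffD mulrDr !mulrDl monalgUD.
Qed.

Lemma twmulUU (c1 c2 : k) (g h : G) :
  twmul << c1 *g g >> << c2 *g h >> = << c1 * c2 * w g h *g (g + h) >>.
Proof.
by rewrite (twmulEw (@msuppU_le _ _ g c1) (@msuppU_le _ _ h c2))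
           !big_seq_fset1 !mcoeffUU.
Qed.

Lemma twmul0l : left_zero 0 twmul.
Proof. by move=> a; rewrite /twmul msupp0 big_seq_fset0. Qed.

Lemma twmul0r : right_zero 0 twmul.
Proof.
by move=> a; rewrite /twmul msupp0 big1 // => g _; rewrite big_seq_fset0.
Qed.

Lemma twmul_suml (I : Type) (r : seq I) (F : I -> A) (b : A) :
  twmul (\sum_(i <- r) F i) b = \sum_(i <- r) twmul (F i) b.
Proof.
elim: r => [|i r IH]; first by rewrite !big_nil twmul0l.
by rewrite !big_cons twmulDl IH.
Qed.

Lemma twmul_sumr (I : Type) (r : seq I) (F : I -> A) (a : A) :
  twmul a (\sum_(i <- r) F i) = \sum_(i <- r) twmul a (F i).
Proof.
elim: r => [|i r IH]; first by rewrite !big_nil twmul0r.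
by rewrite !big_cons twmulDr IH.
Qed.

Lemma twmulA : associative twmul.
Proof.
have [m Em] : exists m, m = twmul by exists twmul.
have suml := twmul_suml; have sumr := twmul_sumr; have UU := twmulUU.
move: suml sumr UU; rewrite -Em => suml sumr UU a b c.
rewrite (monalgE a) (monalgE b) (monalgE c).
rewrite !suml; apply: eq_bigr => g _.
rewrite !(sumr _ (msupp b)) suml; apply: eq_bigr => h _.
rewrite !sumr; apply: eq_bigr => l _.
rewrite !UU addrA bicharDl bicharDr; congr (<< _ *g _ >>).
rewrite -!mulrA; congr (_ * (_ * _)).
by rewrite [RHS]mulrCA; congr (_ * _); rewrite mulrC -mulrA.
Qed.

Lemma twmul1l : left_id twone twmul.
Proof.
move=> a; rewrite [a in LHS]monalgE [RHS]monalgE twmul_sumr.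
by apply: eq_bigr => g _; rewrite twmulUU bichar0l mulr1 mul1r add0r.
Qed.

Lemma twmul1r : right_id twone twmul.
Proof.
move=> a; rewrite [a in LHS]monalgE [RHS]monalgE twmul_suml.
by apply: eq_bigr => g _; rewrite twmulUU bichar0r !mulr1 addr0.
Qed.

Lemma twone_neq0 : twone != 0.
Proof. by rewrite monalgU_eq0 oner_neq0. Qed.

HB.instance Definition _ := GRing.Zmodule_isNzRing.Build A
  twmulA twmul1l twmul1r twmulDl twmulDr twone_neq0.

End TwistedRing.

Program Definition bichar1 (k : comNzRingType) (G : zmodType) : bichar k G :=
  @Bichar k G (fun _ _ => 1) _ _ _ _.
Next Obligation. by rewrite mulr1. Qed.
Next Obligation. by rewrite mulr1. Qed.

(* Z[v, v^-1], as the group algebra of the additive group int over int. *)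
Definition Zv : Type := twisted (bichar1 int int).
HB.instance Definition _ := GRing.NzRing.on Zv.

Lemma Zv_mulC : commutative (@GRing.mul Zv).
Proof.
move=> a b; set w := bichar1 int int.
change (@twmul _ _ w a b = @twmul _ _ w b a).
rewrite /twmul exchange_big /=.
apply: eq_bigr => g _; apply: eq_bigr => h _.
by rewrite addrC; congr (<< _ *g _ >>); rewrite !mulr1 mulrC.
Qed.
HB.instance Definition _ := GRing.PzRing_hasCommutativeMul.Build Zv Zv_mulC.

Variant setting := Classical | Quantum.

Definition base_ring (q : setting) : comNzRingType :=
  if q is Quantum then Zv else int.

Definition vpow (q : setting) : int -> base_ring q :=
  match q with
  | Classical => fun _ => 1
  | Quantum => fun a => << 1 *g a >>
  end.

Lemma vpow0 q : vpow q 0 = 1. Proof. by case: q. Qed.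

Lemma vpowD q a b : vpow q (a + b) = vpow q a * vpow q b.
Proof.
case: q => /=; first by rewrite mulr1.
by rewrite [RHS](twmulUU (bichar1 int int)) !mulr1.
Qed.

Section BilinearForm.
Context (n : nat) (L : 'M[int]_n).

Definition lform (g h : 'rV[int]_n) : int := (g *m L *m h^T) 0 0.

Lemma lform0l h : lform 0 h = 0.
Proof. by rewrite /lform !mul0mx mxE. Qed.

Lemma lform0r g : lform g 0 = 0.
Proof. by rewrite /lform trmx0 mulmx0 mxE. Qed.

Lemma lformDl g1 g2 h : lform (g1 + g2) h = lform g1 h + lform g2 h.
Proof. by rewrite /lform !mulmxDl mxE. Qed.

Lemma lformDr g h1 h2 : lform g (h1 + h2) = lform g h1 + lform g h2.
Proof. by rewrite /lform linearD mulmxDr mxE. Qed.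

Program Definition lbichar (q : setting) : bichar (base_ring q) 'rV[int]_n :=
  @Bichar (base_ring q) 'rV[int]_n (fun g h => vpow q (lform g h)) _ _ _ _.
Next Obligation. by rewrite lform0l vpow0. Qed.
Next Obligation. by rewrite lform0r vpow0. Qed.
Next Obligation. by rewrite lformDl vpowD. Qed.
Next Obligation. by rewrite lformDr vpowD. Qed.

End BilinearForm.

(* The combinatorial data of a seed whose vertex set I is 'I_n; elements of
   Z^I are row vectors.  [slam] is the Gram matrix of lambda; it is only
   meaningful in the quantum case (classically v = 1, so nothing depends on
   it). *)
Record seed (n : nat) := Seed {
  unfrozen : {set 'I_n};
  sd : 'I_n -> nat;
  sB : 'M[rat]_n;
  slam : 'M[int]_n }.

Section SeedData.
Context (n : nat) (t : seed n).

Definition dvee (i : 'I_n) : nat := ((\big[lcmn/1]_j sd t j) %/ sd t i)%N.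

Definition is_seed : Prop :=
  [/\ forall i, (0 < sd t i)%N,
      forall i j, (dvee i)%:R * sB t i j = - ((dvee j)%:R * sB t j i)
    & forall i j, (i \in unfrozen t) || (j \in unfrozen t) ->
        sB t i j \is a Num.int].

Definition Btilde : 'M[rat]_(n, #|unfrozen t|) :=
  colsub (fun k : 'I_#|unfrozen t| => enum_val k) (sB t).

Definition full_rank : Prop := \rank Btilde = #|unfrozen t|.

(* b_ij as an integer; used only where b_ij is integral. *)
Definition bint (i j : 'I_n) : int := numq (sB t i j).

Definition fvec (i : 'I_n) : 'rV[int]_n := delta_mx 0 i.

(* N^{I_uf} *)
Definition Nuf : choiceType := {ffun {k : 'I_n | k \in unfrozen t} -> nat}.

Definition pstar_e (k : 'I_n) : 'rV[int]_n := \row_i bint i k.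

Definition pstar (u : Nuf) : 'rV[int]_n :=
  \sum_(k : {k : 'I_n | k \in unfrozen t}) pstar_e (val k) *+ u k.

Definition is_quantum_seed : Prop :=
  [/\ is_seed, (slam t)^T = - slam t
    & exists dd : 'I_n -> nat, forall k, k \in unfrozen t ->
        (0 < dd k)%N /\
        forall i, lform (slam t) (fvec i) (pstar_e k) = (dd k)%:Z *+ (i == k)].

Definition is_seed_in (q : setting) : Prop :=
  if q is Quantum then is_quantum_seed else is_seed.

(* The multiplication involves only [slam t], so LP(f_F t) and LP(t) are
   definitionally the same ring. *)
Definition LP (q : setting) : nzRingType := twisted (lbichar (slam t) q).

(* c x^m in LP(t) *)
Definition lmon (q : setting) (c : base_ring q) (m : 'rV[int]_n) : LP q :=
  << c *g m >>.

Definition posvec (k : 'I_n) : 'rV[int]_n := \row_i Num.max (bint i k) 0.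
Definition negvec (k : 'I_n) : 'rV[int]_n := \row_i Num.max (- bint i k) 0.

Definition mut_g (k i : 'I_n) : 'rV[int]_n :=
  if i == k then - fvec k + negvec k else fvec i.

Definition mut_seed (k : 'I_n) : seed n := {|
  unfrozen := unfrozen t;
  sd := sd t;
  sB := \matrix_(i, j)
    if (i == k) || (j == k) then - sB t i j
    else sB t i j + Num.max (sB t i k) 0 * Num.max (sB t k j) 0
         - Num.max (- sB t i k) 0 * Num.max (- sB t k j) 0;
  slam := \matrix_(i, j) lform (slam t) (mut_g k i) (mut_g k j) |}.

Definition freeze_seed (F : {set 'I_n}) : seed n := {|
  unfrozen := unfrozen t :\: F; sd := sd t; sB := sB t; slam := slam t |}.

End SeedData.

(* K, with iota, is a (skew-)field of right fractions of A; for an Ore domain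
   such as LP(t) this determines (K, iota) up to unique isomorphism. *)
Definition is_fraction_skew_field (A : nzRingType) (K : unitRingType)
    (iota : {rmorphism A -> K}) : Prop :=
  [/\ injective iota,
      forall y : K, y != 0 -> y \is a GRing.unit
    & forall y : K, exists a b, b != 0 /\ y = iota a / iota b].

(* A seed together with its cluster variables x_i, as elements of K. *)
Record cseed (n : nat) (K : Type) := CSeed {
  cdata :> seed n;
  cvar : 'I_n -> K }.

Section Cluster.
Context (q : setting) (n : nat) (t0 : seed n) (K : unitRingType).
Context (iota : {rmorphism LP t0 q -> K}).

Definition vK (a : int) : K := iota (lmon t0 (vpow q a) 0).

(* The image of x(t)^m in K: since x^g * x^h = v^lambda(g,h) x^(g+h),
   x^m = v^(- sum_(i<j) m_i m_j lambda_ij) x_1^(m_1) * ... * x_n^(m_n). *)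
Definition xmon (t : cseed n K) (m : 'rV[int]_n) : K :=
  vK (- \sum_(i < n) \sum_(j < n | (i < j)%N) m 0 i * m 0 j * slam t i j)
  * \prod_(i < n) cvar t i ^ m 0 i.

Definition init_cseed : cseed n K :=
  CSeed t0 (fun i => iota (lmon t0 1 (fvec i))).

Definition mut_cseed (k : 'I_n) (t : cseed n K) : cseed n K :=
  CSeed (mut_seed t k) (fun i =>
    if i == k then xmon t (- fvec k + posvec t k) + xmon t (- fvec k + negvec t k)
    else cvar t i).

(* Delta^+_{t0} *)
Inductive mut_reachable : cseed n K -> Prop :=
  | mut_refl : mut_reachable init_cseed
  | mut_step t k : mut_reachable t -> k \in unfrozen t ->
      mut_reachable (mut_cseed k t).

(* The set of localized (quantum) cluster monomials of U(t0), inside K. *)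
Definition localized_cluster_monomial (z : K) : Prop :=
  exists (t : cseed n K) (m : 'rV[int]_n), [/\ mut_reachable t,
    forall i, i \in unfrozen t -> 0 <= m 0 i & z = xmon t m].

(* sum_u c_u x^(g + p^* u), over the (finitely many) u with P u *)
Definition expansion (P : pred (Nuf t0)) (g : 'rV[int]_n)
    (c : {malg (base_ring q)[Nuf t0]}) : LP t0 q :=
  \sum_(u <- msupp c | P u) lmon t0 c@_u (g + pstar u).

Definition has_expansion (z : K)
    (gc : 'rV[int]_n * {malg (base_ring q)[Nuf t0]}) : Prop :=
  z = iota (expansion xpredT gc.1 gc.2) /\ gc.2@_[ffun=> 0%N] = 1.

(* The pair (g, (c_u)_u) attached to z; an arbitrary pair if there is none. *)
Definition expansion_of (z : K) : 'rV[int]_n * {malg (base_ring q)[Nuf t0]} :=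
  epsilon (inhabits (0, 0)) (has_expansion z).

Definition supp_disjoint (F : {set 'I_n}) (u : Nuf t0) : bool :=
  [forall k : {k : 'I_n | k \in unfrozen t0}, (u k != 0%N) ==> (val k \notin F)].

(* f_F^{t0} z *)
Definition freezing (F : {set 'I_n}) (z : K) : LP t0 q :=
  expansion (supp_disjoint F) (expansion_of z).1 (expansion_of z).2.

End Cluster.

Arguments localized_cluster_monomial q [n] t0 [K] iota z.

(* Main.v *)
(** The freezing of a pointed element is its part of lowest weight for an
    integral weight w with w(p^* e_k) = 0 for k unfrozen outside F and
    w(p^* e_k) > 0 for k in F.  So it is enough to see that the lowest-weight
    part of a cluster monomial of t_0 is a cluster monomial of f_F t_0, and that
    cluster monomials are pointed.

    Along a mutation path from t_0 to t one maintains a seed t', reached without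
    mutating in F, and a unimodular matrix M such that the lowest-weight part of
    x(t)^m is x(t')^(mM).  Mutate t at k and put delta = (p^* e_k) M.  If
    w(delta) <> 0, one term of the exchange relation dominates and t' is kept.
    If w(delta) = 0, the Laurent phenomenon for the x_i(t') in mu_k t makes the
    k-th column of the inverse of M nonnegative; since M is nonnegative on the
    relevant columns, that column is a unit vector e_i, and the Laurent
    phenomenon, used in both directions, gives delta = p^* e_i; then t' is
    replaced by mu_i t'.

    When F contains all unfrozen vertices, t' is always t_0: for every positive w
    the lowest-weight part is a single monomial with coefficient 1, independent
    of w by connectedness of the cone of weights.  This is pointedness (that is,
    sign coherence).  The Laurent phenomenon itself comes from the invariance of
    upper bounds under mutation. *)

From HB Require Import structures.
From Stdlib Require Import ClassicalEpsilon FunctionalExtensionality.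
From mathcomp Require Import all_boot all_order all_algebra.
From mathcomp Require Import ring zify.
From mathcomp.finmap Require Import finmap.
From mathcomp.multinomials Require Import monalg.
Require Import Defs.

Set Implicit Arguments.
Unset Strict Implicit.
Unset Printing Implicit Defensive.

Import Order.TTheory GRing.Theory Num.Theory.

Local Open Scope ring_scope.

(** * Exchange matrices *)

(** Divisibility is decided throughout by widths: for a weight W, the spread of the W-weights of a
    nonzero Laurent polynomial is additive under products, so a multiple of a binomial is at least
    as wide as the binomial. This needs no factorization theory and treats v = 1 and v indeterminate
    alike. It yields the coprimality behind the upper bounds, the signs of exponents and the
    equality delta = p^* e_i. Weights exist only up to a positive factor N, because full rank gives
    a rational left inverse of the exchange matrix and not an integral one. The matrix M respects
    two structures, lambda and the bivector B diag(d). The second one writes d_k delta as a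
    combination of the d_i p^* e_i(t') whose coefficients are the entries of the k-th column of the
    inverse of M. Lowest-weight parts are defined only for elements that are Laurent in t_0, and the
    inverse of a cluster variable of t need not be. So exponents are first made nonnegative by
    multiplying with a monomial, and the monomial is divided out afterwards. *)

Section ExchangeMatrix.
Context (n : nat).
Implicit Types (uf : {set 'I_n}) (B L : 'M[int]_n) (g h : 'rV[int]_n) (i j k : 'I_n).

Definition wt (W : 'cV[int]_n) g : int := (g *m W) 0 0.

Lemma wtE W g : wt W g = \sum_i g 0 i * W i 0.
Proof. by rewrite /wt mxE. Qed.

Lemma wtD W g h : wt W (g + h) = wt W g + wt W h.
Proof. by rewrite /wt mulmxDl mxE. Qed.

Lemma wtN W g : wt W (- g) = - wt W g.
Proof. by rewrite /wt mulNmx mxE. Qed.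

Lemma wt0 W : wt W 0 = 0.
Proof. by rewrite /wt mul0mx mxE. Qed.

Lemma wtZ W a g : wt W (a *: g) = a * wt W g.
Proof. by rewrite /wt -scalemxAl mxE. Qed.

Lemma wtM W g (M : 'M[int]_n) : wt W (g *m M) = wt (M *m W) g.
Proof. by rewrite /wt mulmxA. Qed.

Lemma wtNW W g : wt (- W) g = - wt W g.
Proof. by rewrite /wt mulmxN mxE. Qed.

Lemma fvecE i j : (fvec i : 'rV[int]_n) 0 j = (j == i)%:R.
Proof. by rewrite mxE eqxx. Qed.

Lemma rvD g h j : (g + h) 0 j = g 0 j + h 0 j.
Proof. by rewrite mxE. Qed.

Lemma rvN g j : (- g) 0 j = - g 0 j.
Proof. by rewrite mxE. Qed.

Lemma rvZ (a : int) g j : (a *: g) 0 j = a * g 0 j.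
Proof. by rewrite mxE. Qed.

Definition rvE := (rvD, rvN, rvZ, fvecE).

Lemma fvec_mul p i (M : 'M[int]_(n, p)) : fvec i *m M = row i M.
Proof. by rewrite -rowE. Qed.

Lemma wt_fvec W i : wt W (fvec i) = W i 0.
Proof. by rewrite /wt fvec_mul mxE. Qed.

Lemma rowvec_sum g : g = \sum_i g 0 i *: fvec i.
Proof. exact: row_sum_delta. Qed.

Lemma lformNl L g h : lform L (- g) h = - lform L g h.
Proof. by rewrite /lform !mulNmx mxE. Qed.

Lemma lformNr L g h : lform L g (- h) = - lform L g h.
Proof. by rewrite /lform linearN mulmxN mxE. Qed.

Lemma lformZl L a g h : lform L (a *: g) h = a * lform L g h.
Proof. by rewrite /lform -!scalemxAl mxE. Qed.

Lemma lformZr L a g h : lform L g (a *: h) = a * lform L g h.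
Proof. by rewrite /lform linearZ -scalemxAr mxE. Qed.

Lemma lform_skew L g h : L^T = - L -> lform L g h = - lform L h g.
Proof.
move=> sk; rewrite /lform.
transitivity ((g *m L *m h^T)^T 0 0); first by rewrite [RHS]mxE.
by rewrite !trmx_mul trmxK sk mulNmx mulmxN mulmxA mxE.
Qed.

Lemma lformxx L g : L^T = - L -> lform L g g = 0.
Proof. by move=> /(lform_skew g g); lia. Qed.

Lemma lform_mul L (M : 'M[int]_n) g h :
  lform L (g *m M) (h *m M) = lform (M *m L *m M^T) g h.
Proof. by rewrite /lform trmx_mul !mulmxA. Qed.

Lemma lform_fvec L i j : lform L (fvec i) (fvec j) = L i j.
Proof.
rewrite /lform -mulmxA.
rewrite (_ : (fvec j)^T = delta_mx j 0); last by rewrite /fvec trmx_delta.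
by rewrite -rowE -colE !mxE.
Qed.

Lemma lform_wt L g h : lform L g h = wt (L *m h^T) g.
Proof. by rewrite /lform /wt mulmxA. Qed.

Definition pst B k : 'rV[int]_n := \row_i B i k.

Definition sgn (s : bool) (a : int) : int := if s then a else - a.

(* [b_ik]_+ for s = true, [- b_ik]_+ for s = false *)
Definition sg (s : bool) B k : 'rV[int]_n := \row_i Num.max (sgn s (B i k)) 0.

Lemma sgE s B k i : sg s B k 0 i = Num.max (sgn s (B i k)) 0.
Proof. by rewrite mxE. Qed.

Lemma sg_ge0 s B k i : 0 <= sg s B k 0 i.
Proof. by rewrite sgE; lia. Qed.

Lemma sg_kk s B k : B k k = 0 -> sg s B k 0 k = 0.
Proof. by rewrite sgE => ->; case: s. Qed.

Lemma sg_sub B k : sg true B k - sg false B k = pst B k.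
Proof. by apply/rowP => i; rewrite !mxE /sgn; lia. Qed.

(* Exponents of the cluster at [mu_k t] rewritten as leading exponents in the
   cluster at [t]: the k-th row is [- f_k + sg s B k]. *)
Definition Em (s : bool) B k : 'M[int]_n :=
  1%:M + delta_mx k 0 *m (sg s B k - fvec k *+ 2).

Lemma mulEm s B k g : g *m Em s B k = g + g 0 k *: (sg s B k - fvec k *+ 2).
Proof.
rewrite /Em mulmxDr mulmx1 mulmxA; congr (_ + _).
rewrite -colE; apply/rowP => j; by rewrite !mxE big_ord1 !mxE !eqxx.
Qed.

Lemma mulEmE s B k (A : 'M[int]_n) i j :
  (A *m Em s B k) i j = A i j + A i k * (sg s B k 0 j - (j == k)%:R *+ 2).
Proof.
have := mulEm s B k (row i A); rewrite -row_mul => /rowP /(_ j).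
by rewrite !mxE eqxx.
Qed.

Lemma trmulEmE s B k (A : 'M[int]_n) i j :
  ((Em s B k)^T *m A) i j = A i j + A k j * (sg s B k 0 i - (i == k)%:R *+ 2).
Proof.
transitivity ((A^T *m Em s B k) j i); last by rewrite mulEmE !mxE.
by rewrite -[in RHS](trmxK (Em _ _ _)) -trmx_mul [RHS]mxE.
Qed.

Lemma row_Em s B k i :
  row i (Em s B k) = if i == k then - fvec k + sg s B k else fvec i.
Proof.
rewrite -fvec_mul mulEm fvecE eq_sym; case: eqP => [->|_].
  by rewrite scale1r mulr2n; apply/rowP => j; rewrite !mxE; lia.
by rewrite scale0r addr0.
Qed.

Lemma fvec_Em s B k i :
  fvec i *m Em s B k = if i == k then - fvec k + sg s B k else fvec i.
Proof. by rewrite fvec_mul row_Em. Qed.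

Lemma EmK s B k : B k k = 0 -> Em s B k *m Em s B k = 1%:M.
Proof.
move=> kk; apply/row_matrixP => i; rewrite row_mul row_Em row1.
case: eqP => [->|/eqP ik]; rewrite mulEm.
  apply/rowP => j; rewrite !mxE kk /sgn !eqxx /=; case: s; case: (j == k); lia.
by rewrite fvecE eq_sym (negbTE ik) scale0r addr0.
Qed.

Definition muB k B : 'M[int]_n := \matrix_(i, j)
  if (i == k) || (j == k) then - B i j
  else B i j + Num.max (B i k) 0 * Num.max (B k j) 0
       - Num.max (- B i k) 0 * Num.max (- B k j) 0.

Definition muL k B L : 'M[int]_n := Em false B k *m L *m (Em false B k)^T.

(* As d_i^vee = lcm / d_i, the condition d_i^vee b_ij = - d_j^vee b_ji of a seed
   reads b_ij d_j = - b_ji d_i. *)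
Definition dskew (d : 'I_n -> int) B := forall i j, B i j * d j = - (B j i * d i).

(* The bivector B diag(d): its invariance under changes of cluster is what
   transports the vectors p^* e_k from one seed to another. *)
Definition Om (d : 'I_n -> int) B : 'M[int]_n := \matrix_(i, j) (B i j * d j).

Lemma dskew_kk d B k : (forall i, 0 < d i) -> dskew d B -> B k k = 0.
Proof. by move=> d0 /(_ k k); have := d0 k; nia. Qed.

Lemma dskew_max d B i j : (forall i, 0 < d i) -> dskew d B ->
  Num.max (B i j) 0 * d j = Num.max (- B j i) 0 * d i.
Proof. by move=> d0 /(_ i j); have := d0 i; have := d0 j; nia. Qed.

Lemma dskew_maxN d B i j : (forall i, 0 < d i) -> dskew d B ->
  Num.max (- B i j) 0 * d j = Num.max (B j i) 0 * d i.
Proof. by move=> d0 sk; rewrite -(dskew_max j i d0 sk). Qed.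

(** The entry of [Om_mu] at (i, j) with i, j distinct from k: here a = b_ik, b = b_kj, c = b_jk, x =
    b_ij. The hypothesis is skew-symmetrizability on positive parts. *)
Lemma mu_entry s (a b c x dj dk : int) :
  Num.max (sgn s c) 0 * dk = Num.max (sgn (~~ s) b) 0 * dj ->
  (x + Num.max a 0 * Num.max b 0 - Num.max (- a) 0 * Num.max (- b) 0) * dj
  = x * dj + b * dj * Num.max (sgn s a) 0 + a * dk * Num.max (sgn s c) 0.
Proof.
move=> e; rewrite -[a * dk * _]mulrA [dk * _]mulrC e.
have ea : a = Num.max a 0 - Num.max (- a) 0 by lia.
have eb : b = Num.max b 0 - Num.max (- b) 0 by lia.
move: ea eb; rewrite /sgn; case: s {e} => /=.
  move: (Num.max a 0) (Num.max (- a) 0) (Num.max b 0) (Num.max (- b) 0).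
  by move=> p p' r r' -> ->; ring.
move: (Num.max a 0) (Num.max (- a) 0) (Num.max b 0) (Num.max (- b) 0).
by move=> p p' r r' -> ->; ring.
Qed.

(** Mutation is a change of basis for the bivector, with either sign [s]. This freedom lets leading
    exponents follow whichever term of an exchange relation dominates. *)
Lemma Om_mu d B k s : (forall i, 0 < d i) -> dskew d B ->
  Om d (muB k B) = (Em s B k)^T *m Om d B *m Em s B k.
Proof.
move=> d0 sk; apply/matrixP => i j.
rewrite mulEmE !trmulEmE !mxE (dskew_kk k d0 sk) !mul0r addr0.
have kk := dskew_kk k d0 sk.
have [->|ik] := eqVneq i k.
  rewrite /= kk /sgn oppr0 (_ : (if s then _ else _) = 0) ?maxxx; last by case: s.
  by rewrite mul0r /=; ring.
have [->|jk] := eqVneq j k.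
  rewrite /= kk /sgn oppr0 (_ : (if s then 0 else 0) = 0) ?maxxx; last by case: s.
  by rewrite mul0r /=; ring.
rewrite /= !mulr0n mul0rn !subr0; apply: mu_entry.
by case: s; rewrite /sgn /=; [exact: dskew_max|exact: dskew_maxN].
Qed.

Lemma dskewP d B : dskew d B <-> (Om d B)^T = - Om d B.
Proof.
split=> [sk|/matrixP sk i j]; last by have := sk j i; rewrite !mxE.
by apply/matrixP => i j; rewrite !mxE sk.
Qed.

Lemma dskew_mu d B k : (forall i, 0 < d i) -> dskew d B -> dskew d (muB k B).
Proof.
move=> d0 sk; apply/dskewP; rewrite (Om_mu k true d0 sk).
by rewrite !trmx_mul trmxK (proj1 (dskewP _ _) sk) !mulNmx mulmxN mulmxA.
Qed.

Lemma muBK d B k : (forall i, 0 < d i) -> dskew d B -> muB k (muB k B) = B.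
Proof.
move=> d0 sk; apply/matrixP => i j; rewrite !mxE eqxx !orbT /=.
by case: eqP => [->|_]; case: eqP => [->|_] //=; lia.
Qed.

Lemma sg_mu s B k : sg s (muB k B) k = sg (~~ s) B k.
Proof. by apply/rowP => i; rewrite !mxE eqxx orbT; case: s; rewrite /sgn ?opprK. Qed.

Lemma Em_mu s B k : Em s (muB k B) k = Em (~~ s) B k.
Proof. by rewrite /Em sg_mu. Qed.

Lemma pst_mu_k B k : pst (muB k B) k = - pst B k.
Proof. by apply/rowP => i; rewrite !mxE eqxx orbT. Qed.

(** Together with [pst_muk_Em]: in terms of leading exponents, mutation is a triangular base change
    of the vectors p^* e_j, where p^* e_k changes sign and the others move by multiples of p^*
    e_k. *)
Lemma pst_mu_Em d s B k j : (forall i, 0 < d i) -> dskew d B -> j != k ->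
  pst (muB k B) j *m Em s B k
    = pst B j + Num.max (sgn (~~ s) (B k j)) 0 *: pst B k.
Proof.
move=> d0 sk jk; apply/rowP => i; rewrite mulEm !mxE eqxx /= (negbTE jk) orbF.
have := dskew_kk k d0 sk; rewrite /sgn /=.
by case: eqP => [->|_] kk /=; case: s => /=; nia.
Qed.

Lemma pst_muk_Em d s B k : (forall i, 0 < d i) -> dskew d B ->
  pst (muB k B) k *m Em s B k = - pst B k.
Proof.
move=> d0 sk; rewrite pst_mu_k mulEm !mxE (dskew_kk k d0 sk).
by rewrite oppr0 scale0r addr0.
Qed.

(** Pure orthogonality, so that the zero form qualifies and the classical case becomes the case L =
    0. *)
Definition compatible (uf : {set 'I_n}) B L :=
  forall k i, k \in uf -> i != k -> lform L (fvec i) (pst B k) = 0.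

Lemma compatible0 uf B L k g : compatible uf B L -> k \in uf -> g 0 k = 0 ->
  lform L g (pst B k) = 0.
Proof.
move=> cp kuf gk; rewrite lform_wt (rowvec_sum g) /wt mulmx_suml summxE big1 //.
move=> i _; rewrite -scalemxAl mxE -[(_ *m _) 0 0]/(wt _ _) -lform_wt.
have [->|ik] := eqVneq i k; first by rewrite gk mul0r.
by rewrite cp // mulr0.
Qed.

(** The two choices of g_k differ by p^* e_k, which is lambda-orthogonal to every vector with zero
    k-th coordinate. *)
Lemma muL_sg uf B L k s : L^T = - L -> compatible uf B L -> k \in uf ->
  B k k = 0 -> muL k B L = Em s B k *m L *m (Em s B k)^T.
Proof.
move=> sk cp kuf kk; case: s => //.
apply/matrixP => i j.
have E s : (Em s B k *m L *m (Em s B k)^T) i j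
   = lform L (row i (Em s B k)) (row j (Em s B k)).
  by rewrite -lform_fvec -lform_mul !fvec_mul.
rewrite /muL !E !row_Em.
have T : sg true B k = sg false B k + pst B k by rewrite -sg_sub addrC subrK.
have p0 g : g 0 k = 0 -> lform L g (pst B k) = 0 by move=> g0; apply: (compatible0 cp kuf).
have s0 : lform L (sg false B k) (pst B k) = 0 by apply/p0/sg_kk.
case: ifP => [/eqP ik|/eqP ik]; case: ifP => [/eqP jk|/eqP jk] //.
- by rewrite !(lformxx _ sk).
- rewrite T !lformDl [lform L (pst B k) _](lform_skew _ _ sk) p0 ?oppr0 ?addr0 //.
  by rewrite fvecE; case: eqP => // jj; case: jk; rewrite jj.
- rewrite T !lformDr p0 ?oppr0 ?addr0 //.
  by rewrite fvecE; case: eqP => // jj; case: ik; rewrite jj.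
Qed.

Lemma muL_skew B L k : L^T = - L -> (muL k B L)^T = - muL k B L.
Proof.
by move=> sk; rewrite /muL !trmx_mul trmxK sk mulNmx mulmxN mulmxA.
Qed.

Lemma lform_pst uf B L j k : L^T = - L -> compatible uf B L -> j \in uf ->
  lform L (pst B k) (pst B j) = B j k * lform L (fvec j) (pst B j).
Proof.
move=> sk cp juf; rewrite [in LHS](_ : pst B k = B j k *: fvec j +
  (pst B k - B j k *: fvec j)); last by rewrite addrC subrK.
rewrite lformDl lformZl (@compatible0 uf B L j (pst B k - _)) ?addr0 //.
by rewrite !mxE !eqxx mulr1 subrr.
Qed.

Lemma compatible_mu (d : 'I_n -> int) uf B L k : (forall i, 0 < d i) ->
  dskew d B -> L^T = - L ->
  compatible uf B L -> k \in uf -> compatible uf (muB k B) (muL k B L).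
Proof.
move=> d0 dsk sk cp kuf j i juf ij.
have kk := dskew_kk k d0 dsk.
rewrite /muL -lform_mul fvec_Em.
have fe m l : m != l -> (fvec m : 'rV[int]_n) 0 l = 0 by rewrite fvecE eq_sym => /negbTE ->.
have [jk|jk] := eqVneq j k.
  rewrite jk (pst_muk_Em _ _ d0 dsk) lformNr.
  by rewrite jk in ij; rewrite (negbTE ij) (compatible0 cp kuf (fe _ _ ij)) oppr0.
rewrite (pst_mu_Em _ d0 dsk jk) lformDr lformZr.
case: eqP => [ik|/eqP ik]; last first.
  by rewrite (compatible0 cp juf) ?(compatible0 cp kuf) ?mulr0 ?addr0 ?fe.
rewrite !lformDl !lformNl (compatible0 cp juf (fe _ _ _)) 1?eq_sym //.
rewrite (compatible0 cp kuf (sg_kk _ kk)) addr0 oppr0 add0r.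
have H (g : 'rV[int]_n) : lform L g (pst B j) = g 0 j * lform L (fvec j) (pst B j).
  rewrite [in LHS](_ : g = g 0 j *: fvec j + (g - g 0 j *: fvec j)); last first.
    by rewrite addrC subrK.
  rewrite lformDl lformZl (@compatible0 uf B L j (g - _)) ?addr0 //.
  by rewrite !mxE !eqxx mulr1 subrr.
rewrite H sgE /sgn /=.
(* With a_l = lambda(f_l, p^* e_l), computing lambda(p^* e_k, p^* e_j) in both orders gives b_jk a_j
   = - b_kj a_k. As b_jk and b_kj have opposite signs, this passes to positive parts, which is the
   remaining claim. *)
have e1 := lform_pst k sk cp juf; have e2 := lform_pst j sk cp kuf.
have e3 : lform L (pst B k) (pst B j) = - lform L (pst B j) (pst B k).
  exact: lform_skew.
rewrite e3 e2 in e1; have := dsk j k; have := d0 j; have := d0 k.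
move: (lform L (fvec j) (pst B j)) (lform L (fvec k) (pst B k)) e1 => a b.
by nia.
Qed.

Lemma muLK (d : 'I_n -> int) uf B L k : (forall i, 0 < d i) ->
  dskew d B -> L^T = - L ->
  compatible uf B L -> k \in uf -> muL k (muB k B) (muL k B L) = L.
Proof.
move=> d0 dsk sk cp kuf; have kk := dskew_kk k d0 dsk.
rewrite (muL_sg true sk cp kuf kk) /muL Em_mu /= !mulmxA EmK // mul1mx.
by rewrite -mulmxA -trmx_mul EmK // trmx1 mulmx1.
Qed.

(* Linear independence of the vectors p^* e_k, k unfrozen, in dual form. *)
Definition rich (uf : {set 'I_n}) B := forall tau : 'I_n -> int,
  exists W (N : int), 0 < N /\ forall k, k \in uf -> wt W (pst B k) = N * tau k.

Lemma rich_mu (uf : {set 'I_n}) (d : 'I_n -> int) B k : (forall i, 0 < d i) -> dskew d B ->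
  k \in uf -> rich uf B -> rich uf (muB k B).
Proof.
move=> d0 sk kuf fr tau; have kk := dskew_kk k d0 sk.
(* [tau'] lists the values required on the old vectors p^* e_j so that, after the base change, the
   new ones get [tau]. *)
pose tau' j := if j == k then - tau k
  else tau j + Num.max (sgn false (B k j)) 0 * tau k.
have [W [N [N0 HW]]] := fr tau'; exists (Em true B k *m W), N; split=> // j juf.
rewrite -wtM; have [jk|jk] := eqVneq j k.
  by rewrite jk (pst_muk_Em _ _ d0 sk) wtN HW // /tau' eqxx mulrN opprK.
rewrite (pst_mu_Em _ d0 sk jk) wtD wtZ !HW // /tau' (negbTE jk) eqxx /=.
by ring.
Qed.

End ExchangeMatrix.

(** * Twisted monomials in a skew field *)

(* A skew field with central scalars [sa c] and central powers [sa (sv a)]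
   of v (the constant 1 in the classical case). *)
Record scalars := Scalars {
  sk : comNzRingType;
  sK : unitRingType;
  sa : {rmorphism sk -> sK};
  sv : int -> sk;
  saC : forall c x, sa c * x = x * sa c;
  sK_unit : forall x : sK, x != 0 -> x \is a GRing.unit;
  sv0 : sv 0 = 1;
  svD : forall a b, sv (a + b) = sv a * sv b }.

Section Span.
Context (T : scalars) (n : nat).
Local Notation k0 := (sk T).
Local Notation K := (sK T).
Local Notation G := 'rV[int]_n.
Local Notation ka := (@sa T).
Implicit Types (X : G -> K) (L : 'M[int]_n) (P Q R : G -> Prop) (z y : K) (g h : G).

Definition qv (a : int) : K := ka (sv T a).

Lemma qv0 : qv 0 = 1. Proof. by rewrite /qv sv0 rmorph1. Qed.
Lemma qvD a b : qv (a + b) = qv a * qv b.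
Proof. by rewrite /qv svD rmorphM. Qed.
Lemma qvC a z : z * qv a = qv a * z. Proof. by rewrite /qv saC. Qed.
Lemma qvCA a z y : z * (qv a * y) = qv a * (z * y).
Proof. by rewrite !mulrA qvC. Qed.
Lemma qvDA a b z : qv a * (qv b * z) = qv (a + b) * z.
Proof. by rewrite qvD mulrA. Qed.
Lemma qv_neq0 a : qv a != 0.
Proof.
apply/eqP => e; have := qvD a (- a); rewrite subrr qv0 e mul0r => /eqP.
by rewrite oner_eq0.
Qed.
Lemma qvKN a z : qv (- a) * (qv a * z) = z.
Proof. by rewrite qvDA addNr qv0 mul1r. Qed.

Lemma mulK_eq0 z y : z * y = 0 -> z = 0 \/ y = 0.
Proof.
move=> zy; have [->|z0] := eqVneq z 0; [by left|right].
by apply: (mulrI (sK_unit z0)); rewrite mulr0.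
Qed.

Lemma mulK_neq0 z y : z != 0 -> y != 0 -> z * y != 0.
Proof.
by move=> /eqP z0 /eqP y0; apply/eqP => /mulK_eq0 [].
Qed.

Lemma qcomm_expn z y (w : int) (m : nat) :
  z * y = qv w * (y * z) -> z * y ^+ m = qv (m%:Z * w) * (y ^+ m * z).
Proof.
move=> e; elim: m => [|m IH]; first by rewrite mul0r qv0 !mul1r mulr1.
rewrite exprSr mulrA IH -mulrA -[_ * z * y]mulrA e [_ ^+ m * _]qvCA qvDA -!mulrA.
by congr (qv _ * _); lia.
Qed.

Lemma qcomm_expz z y (w a : int) : y != 0 ->
  z * y = qv w * (y * z) -> z * y ^ a = qv (a * w) * (y ^ a * z).
Proof.
move=> y0 e; case: a => m; first exact: qcomm_expn.
have yu : y ^+ m.+1 \is a GRing.unit by rewrite unitrX // sK_unit.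
rewrite NegzE -exprnN; apply: (mulIr yu); rewrite -!mulrA mulVr // mulr1.
rewrite (qcomm_expn _ e) qvCA qvDA mulKr //.
by rewrite (_ : _ + _ = 0) ?qv0 ?mul1r //; ring.
Qed.

Definition ev X (a : {malg k0[G]}) : K := mmap ka X a.

Lemma evD X a b : ev X (a + b) = ev X a + ev X b.
Proof. exact: mmapD. Qed.
Lemma ev0 X : ev X 0 = 0.
Proof. exact: mmap0. Qed.
Lemma evN X a : ev X (- a) = - ev X a.
Proof. exact: mmapN. Qed.
Lemma evU X c g : ev X << c *g g >> = ka c * X g.
Proof. exact: mmapU. Qed.

Lemma ev_sum X (I : Type) (s : seq I) (F : I -> {malg k0[G]}) :
  ev X (\sum_(i <- s) F i) = \sum_(i <- s) ev X (F i).
Proof. by apply: (big_morph (ev X)); [apply: evD|apply: ev0]. Qed.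

(* z is a k-linear combination of the X g with P g *)
Definition lincomb X P z := exists2 a, (forall g, a@_g != 0 -> P g) & z = ev X a.

Lemma lincomb0 X P : lincomb X P 0.
Proof. by exists 0; rewrite ?ev0 // => g; rewrite mcoeff0 eqxx. Qed.

Lemma lincombD X P z y : lincomb X P z -> lincomb X P y -> lincomb X P (z + y).
Proof.
move=> [a Ha ->] [b Hb ->]; exists (a + b); rewrite ?evD // => g.
rewrite mcoeffD; have [->|/Ha //] := eqVneq (a@_g) 0.
by rewrite add0r => /Hb.
Qed.

Lemma lincombN X P z : lincomb X P z -> lincomb X P (- z).
Proof.
move=> [a Ha ->]; exists (- a); rewrite ?evN // => g.
by rewrite mcoeffN oppr_eq0 => /Ha.
Qed.

Lemma lincombB X P z y : lincomb X P z -> lincomb X P y -> lincomb X P (z - y).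
Proof. by move=> Hz Hy; apply/lincombD/lincombN. Qed.

Lemma lincomb_monomial X P c g : P g -> lincomb X P (ka c * X g).
Proof.
move=> Pg; exists << c *g g >>; rewrite ?evU // => h.
rewrite mcoeffU; have [<-//|_] := eqVneq g h.
by rewrite mulr0n eqxx.
Qed.

Lemma lincomb_X X P g : P g -> lincomb X P (X g).
Proof. by move=> Pg; rewrite -[X g]mul1r -(rmorph1 ka); apply: lincomb_monomial. Qed.

Lemma lincomb_sub X P Q z : (forall g, P g -> Q g) -> lincomb X P z -> lincomb X Q z.
Proof. by move=> PQ [a Ha ->]; exists a => // g /Ha /PQ. Qed.

Lemma lincomb_ind X P (A : K -> Prop) :
  A 0 -> (forall z y, A z -> A y -> A (z + y)) ->
  (forall c g, P g -> A (ka c * X g)) -> forall z, lincomb X P z -> A z.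
Proof.
move=> A0 subgroupD Am z [a Ha ->].
rewrite /ev mmapE big_seq; apply: big_ind => // g; rewrite -mcoeff_neq0 => ga.
exact/Am/Ha.
Qed.

Lemma lincomb_scale X P c z : lincomb X P z -> lincomb X P (ka c * z).
Proof.
move: z; apply: lincomb_ind => [|z y Hz Hy|b g Pg].
- by rewrite mulr0; apply: lincomb0.
- by rewrite mulrDr; apply: lincombD.
- by rewrite mulrA -rmorphM; apply: lincomb_monomial.
Qed.

Lemma lincomb_qv X P a z : lincomb X P z -> lincomb X P (qv a * z).
Proof. exact: lincomb_scale. Qed.

Lemma lincomb_qvE X P a z : lincomb X P (qv a * z) <-> lincomb X P z.
Proof.
by split; [move=> H; rewrite -(qvKN a z); apply: lincomb_qv|apply: lincomb_qv].
Qed.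

Definition twistedX L X := forall g h, X g * X h = qv (lform L g h) * X (g + h).
Definition indepX X := forall a, ev X a = 0 -> a = 0.

Lemma lincomb_mul L X P Q R z y : twistedX L X ->
  (forall g h, P g -> Q h -> R (g + h)) -> lincomb X P z -> lincomb X Q y ->
    lincomb X R (z * y).
Proof.
move=> tw PQR Hz; move: y; apply: lincomb_ind => [|y y' Hy Hy'|b h Qh].
- by rewrite mulr0; apply: lincomb0.
- by rewrite mulrDr; apply: lincombD.
move: z Hz; apply: lincomb_ind => [|z z' Hz Hz'|c g Pg].
- by rewrite mul0r; apply: lincomb0.
- by rewrite mulrDl; apply: lincombD.
rewrite -mulrA [X g * _]mulrA -saC -[ka b * X g * X h]mulrA tw.
by do 3!apply: lincomb_scale; apply/lincomb_X/PQR.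
Qed.

Lemma lincomb_split X P Q z : lincomb X P z -> exists z1 z2,
  [/\ z = z1 + z2, lincomb X (fun g => P g /\ Q g) z1
    & lincomb X (fun g => P g /\ ~ Q g) z2].
Proof.
move: z; apply: lincomb_ind => [|z y [z1 [z2 [-> H1 H2]]] [y1 [y2 [-> H3 H4]]]|c g Pg].
- by exists 0, 0; split; rewrite ?addr0 //; apply: lincomb0.
- by exists (z1 + y1), (z2 + y2); split; [rewrite addrACA|exact: lincombD|exact: lincombD].
have [Qg|nQg] := classic (Q g).
  by exists (ka c * X g), 0; rewrite addr0; split=> //;
    [apply: lincomb_monomial|apply: lincomb0].
by exists 0, (ka c * X g); rewrite add0r; split=> //;
  [apply: lincomb0|apply: lincomb_monomial].
Qed.

Lemma ev_inj X : indepX X -> injective (ev X).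
Proof.
by move=> ix a b e; apply/eqP; rewrite -subr_eq0; apply/eqP/ix; rewrite evD evN e subrr.
Qed.

Lemma lincomb_disj X P Q z : indepX X -> (forall g, P g -> Q g -> False) ->
  lincomb X P z -> lincomb X Q z -> z = 0.
Proof.
move=> ix PQ [a Ha ->] [b Hb /(ev_inj ix) ab].
rewrite (_ : a = 0) ?ev0 //; apply/malgP => g; rewrite mcoeff0.
have [//|ag] := eqVneq (a@_g) 0.
by case: (PQ g); [apply: Ha|apply: Hb; rewrite -ab].
Qed.

Lemma X_neq0 X g : indepX X -> X g != 0.
Proof.
move=> ix; apply/eqP => Xg; have := ix << 1 *g g >>; rewrite evU Xg mulr0.
by move=> /(_ erefl) /eqP; rewrite monalgU_eq0 oner_eq0.
Qed.

Lemma X_unit X g : indepX X -> X g \is a GRing.unit.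
Proof. by move=> ix; apply/sK_unit/X_neq0. Qed.

Lemma X_zero L X : twistedX L X -> indepX X -> X 0 = 1.
Proof.
move=> tw ix; apply: (mulrI (X_unit 0 ix)).
by rewrite tw lform0l qv0 addr0 mul1r mulr1.
Qed.

Lemma lincomb1 L X P : twistedX L X -> indepX X -> P 0 -> lincomb X P 1.
Proof. by move=> tw ix P0; rewrite -(X_zero tw ix); apply: lincomb_X. Qed.

Lemma XD_neq0 X g h : indepX X -> g != h -> X g + X h != 0.
Proof.
move=> ix gh; apply/eqP => e; have := ix (<< 1 *g g >> + << 1 *g h >>).
rewrite evD !evU rmorph1 !mul1r e => /(_ erefl) /(congr1 (mcoeff g)).
by rewrite mcoeffD !mcoeffU eqxx eq_sym (negbTE gh) mcoeff0 addr0 => /eqP; rewrite oner_eq0.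
Qed.

Lemma XV L X g : twistedX L X -> indepX X -> L^T = - L -> X g * X (- g) = 1.
Proof.
move=> tw ix sk; rewrite tw subrr (X_zero tw ix) lformNr lformxx // oppr0 qv0.
by rewrite mulr1.
Qed.

Lemma VX L X g : twistedX L X -> indepX X -> L^T = - L -> X (- g) * X g = 1.
Proof. by move=> tw ix sk; rewrite -[in X g](opprK g) (XV _ tw ix sk). Qed.

Lemma X_comm L X g h : twistedX L X -> L^T = - L ->
  X g * X h = qv (lform L g h *+ 2) * (X h * X g).
Proof.
move=> tw sk; rewrite !tw addrC qvDA (lform_skew h g sk).
by congr (qv _ * _); lia.
Qed.

Lemma X_exp L X g (m : nat) : twistedX L X -> indepX X -> L^T = - L ->
  X g ^+ m = X (m%:Z *: g).
Proof.
move=> tw ix sk; elim: m => [|m IH]; first by rewrite scale0r (X_zero tw ix).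
rewrite exprS IH tw lformZr lformxx // mulr0 qv0 mul1r; congr X.
by rewrite -[in LHS](scale1r g) scalerA mulr1 -scalerDl.
Qed.

Lemma X_expz L X g (m : int) : twistedX L X -> indepX X -> L^T = - L ->
  X g ^ m = X (m *: g).
Proof.
move=> tw ix sk; case: m => m; first exact: X_exp tw ix sk.
rewrite NegzE -exprnN; apply: (mulrI (X_unit (m.+1%:Z *: g) ix)).
by rewrite -(X_exp g _ tw ix sk) divrr ?unitrX ?X_unit // (X_exp g _ tw ix sk) scaleNr
  (XV _ tw ix sk).
Qed.

End Span.

(** * Lowest-weight parts and widths *)

Section Lead.
Context (T : scalars) (n : nat).
Local Notation K := (sK T).
Local Notation G := 'rV[int]_n.
Local Notation ka := (@sa T).
Context (L : 'M[int]_n) (X : G -> K).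
Context (tw : twistedX L X) (ix : indepX X).
Implicit Types (P Q : G -> Prop) (W : 'cV[int]_n) (z y : K) (g h : G) (e : int).

(* y is the part of z of lowest W-weight, that weight being e. *)
Definition lead W e z y :=
  [/\ y != 0, lincomb X (fun h => wt W h = e) y & lincomb X (fun h => e < wt W h) (z - y)].

Lemma lincomb_empty P z : (forall g, ~ P g) -> lincomb X P z -> z = 0.
Proof. by move=> nP Hz; apply: (lincomb_disj ix _ Hz Hz) => g /nP. Qed.

Lemma lead_exists W P z : z != 0 -> lincomb X P z -> exists e y, lead W e z y.
Proof.
move=> z0 Hz.
have [N HN] : exists N : nat, lincomb X (fun h => `|wt W h| < N%:Z) z.
  move: z Hz {z0}; apply: lincomb_ind => [|z y [N HN] [M HM]|c g _].
  - by exists 0%N; apply: lincomb0.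
  - exists (N + M)%N; apply: lincombD;
    [apply: lincomb_sub HN|apply: lincomb_sub HM] => h /=; lia.
  - by exists (`|wt W g|).+1; apply: lincomb_monomial; lia.
(* The weights lie in a window of length 2N. The induction is on the length: the bottom weight [lo]
   either carries the lowest part or is dropped. *)
have {HN} : lincomb X (fun h => - N%:Z <= wt W h < - N%:Z + (N.*2)%:Z) z.
  by apply: lincomb_sub HN => h; lia.
move: (- N%:Z) (N.*2) => lo m; elim: m lo z z0 {Hz} => [|m IH] lo z z0 Hz.
  by case/eqP: z0; apply: lincomb_empty Hz => g; lia.
have [z1 [z2 [zE H1 H2]]] := lincomb_split (fun h => wt W h = lo) Hz.
have [z10|z10] := eqVneq z1 0.
  apply: (IH (lo + 1)) => //; rewrite zE z10 add0r.
  by apply: lincomb_sub H2 => h; lia.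
exists lo, z1; split=> //; first by apply: lincomb_sub H1 => h [].
by rewrite zE addrC addKr; apply: lincomb_sub H2 => h; lia.
Qed.

Lemma lead_S W e z y : lead W e z y -> lincomb X (fun h => e <= wt W h) z.
Proof.
move=> [_ H1 H2]; rewrite -(subrK y z).
by apply: lincombD; [apply: lincomb_sub H2|apply: lincomb_sub H1] => h; lia.
Qed.

Lemma lead_ge W e z y lo :
  lead W e z y -> lincomb X (fun h => lo <= wt W h) z -> lo <= e.
Proof.
move=> [y0 H1 H2] Hz; rewrite leNgt; apply/negP => elo; case/eqP: y0.
apply: (lincomb_disj ix _ H1 (_ : lincomb X (fun h => e < wt W h) y)) => [h|]; first by lia.
rewrite -[y](subKr z); apply: lincombB => //.
by apply: lincomb_sub Hz => h; lia.
Qed.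

Lemma lead_neq0 W e z y : lead W e z y -> z != 0.
Proof.
move=> H; apply/eqP => z0; have := lead_ge (lo := e + 1) H.
by rewrite z0 => /(_ (lincomb0 _ _)); lia.
Qed.

Lemma lead_uniq W e e' z y y' : lead W e z y -> lead W e' z y' -> e = e' /\ y = y'.
Proof.
move=> H H'; have ee : e = e'.
  have := lead_ge H (lead_S H'); have := lead_ge H' (lead_S H); lia.
split=> //; move: H H' => [_ H1 H2] [_ H3 H4]; rewrite -ee in H3 H4.
apply/eqP; rewrite -subr_eq0; apply/eqP.
apply: (lincomb_disj ix _ (lincombB H1 H3) (_ : lincomb X (fun h => e < wt W h) _)) =>
  [h|]; first lia.
rewrite (_ : y - y' = (z - y') - (z - y)); last by rewrite opprB [RHS]addrC addrA subrK.
exact: lincombB.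
Qed.

Lemma lead_mul W e e' z y z' y' :
  lead W e z y -> lead W e' z' y' -> lead W (e + e') (z * z') (y * y').
Proof.
move=> H H'; have Hz := lead_S H; move: H H' => [y0 H1 H2] [y0' H3 H4].
split; first exact: mulK_neq0.
  by apply: (lincomb_mul tw _ H1 H3) => g h gE hE; rewrite wtD gE hE.
rewrite (_ : _ - _ = z * (z' - y') + (z - y) * y'); last first.
  by rewrite mulrBr mulrBl addrA subrK.
apply: lincombD; first by apply: (lincomb_mul tw _ Hz H4) => g h; rewrite wtD; lia.
by apply: (lincomb_mul tw _ H2 H3) => g h; rewrite wtD; lia.
Qed.

Lemma lead_homog W e z : z != 0 -> lincomb X (fun h => wt W h = e) z -> lead W e z z.
Proof. by move=> z0 Hz; split=> //; rewrite subrr; apply: lincomb0. Qed.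

Lemma lead_X W g : lead W (wt W g) (X g) (X g).
Proof. by apply: lead_homog; [apply: X_neq0|apply: lincomb_X]. Qed.

Lemma lead_qv W e z y a : lead W e z y -> lead W e (qv T a * z) (qv T a * y).
Proof.
move=> [y0 H1 H2]; split; first by rewrite mulK_neq0 ?qv_neq0.
  exact: lincomb_qv.
by rewrite -mulrBr; apply: lincomb_qv.
Qed.

Lemma lead_addl W e e' z y z' y' : e < e' -> lead W e z y -> lead W e' z' y' ->
  lead W e (z + z') y.
Proof.
move=> ee [y0 H1 H2] /lead_S H'; split=> //.
by rewrite addrAC; apply: lincombD => //; apply: lincomb_sub H' => h; lia.
Qed.

Lemma lead_add W e z y z' y' : y + y' != 0 -> lead W e z y -> lead W e z' y' ->
  lead W e (z + z') (y + y').
Proof.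
move=> yy [y0 H1 H2] [y0' H3 H4]; split=> //; first exact: lincombD.
by rewrite opprD addrACA; apply: lincombD.
Qed.

(** The quotient [x] has a lowest part only because it is Laurent in the chart; this is where the
    Laurent phenomenon enters the computation of leading parts. *)
Lemma lead_div W e e' z y x t : lincomb X (fun=> True) x -> lead W e z y ->
  lead W e' (x * z) t -> exists2 u, lead W (e' - e) x u & t = u * y.
Proof.
move=> Sx H H'; have x0 : x != 0.
  by apply/eqP => x0; have := lead_neq0 H'; rewrite x0 mul0r eqxx.
have [f [u Hu]] := lead_exists W x0 Sx.
have [-> ->] := lead_uniq H' (lead_mul Hu H).
by exists u; rewrite ?addrK.
Qed.

(** The leading weight for - W is minus the highest W-weight, so this compares lowest and highest
    weight. *)
Lemma lead_le_lead W e f z y y' : lead W e z y -> lead (- W) f z y' -> e <= - f.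
Proof.
move=> H H'; rewrite leNgt; apply/negP => ef.
have /eqP := lead_neq0 H; apply; apply: (lincomb_disj ix _ (lead_S H) (lead_S H')) => h.
by rewrite wtNW; lia.
Qed.

(** Lowest parts and highest parts both multiply, so the width of [z] is the width of the binomial
    plus that of [e], and the latter is nonnegative. *)
Lemma width_mul W (a b : G) (e z : K) (lo hi : int) : e != 0 -> lincomb X (fun=> True) e ->
  z = (X a + X b) * e -> lincomb X (fun h => lo <= wt W h <= hi) z -> wt W b < wt W a ->
  wt W a - wt W b <= hi - lo.
Proof.
move=> e0 Se zE Hz ab.
have Hlo : lincomb X (fun h => lo <= wt W h) z by apply: lincomb_sub Hz => h /andP[].
have Hhi : lincomb X (fun h => - hi <= wt (- W) h) z.
  by apply: lincomb_sub Hz => h /andP[_]; rewrite wtNW; lia.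
have [d0 [y0 H0]] := lead_exists W e0 Se.
have [d1 [y1 H1]] := lead_exists (- W) e0 Se.
have pb : lead W (wt W b) (X a + X b) (X b).
  by rewrite addrC; apply: lead_addl (lead_X W b) (lead_X W a); lia.
have pa : lead (- W) (wt (- W) a) (X a + X b) (X a).
  by apply: lead_addl (lead_X _ a) (lead_X _ b); rewrite !wtNW; lia.
have := lead_mul pb H0; have := lead_mul pa H1; rewrite -zE => K1 K0.
have := lead_ge K0 Hlo; have := lead_ge K1 Hhi; have := lead_le_lead H0 H1.
by rewrite wtNW; lia.
Qed.

End Lead.

(** * Charts and their mutations *)

Section Chart.
Context (T : scalars) (n : nat) (uf : {set 'I_n}) (d : 'I_n -> int).
Local Notation K := (sK T).
Local Notation G := 'rV[int]_n.
Local Notation ka := (@sa T).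
Implicit Types (B L : 'M[int]_n) (X : G -> K) (P Q : G -> Prop)
  (z y : K) (g h r : G) (i j k l : 'I_n).

(* [cX c m] is the cluster monomial x^m, and [cL c] the form lambda (zero in
   the classical case). *)
Record chart := Chart { cB : 'M[int]_n; cL : 'M[int]_n; cX : G -> K }.
Implicit Types c : chart.

Record valid c : Prop := Valid {
  v_d : forall i, 0 < d i;
  v_B : dskew d (cB c);
  v_L : (cL c)^T = - cL c;
  v_cp : compatible uf (cB c) (cL c);
  v_rich : rich uf (cB c);
  v_tw : twistedX (cL c) (cX c);
  v_ix : indepX (cX c) }.

(* The two exponents of the exchange relation for the new variable at k. *)
Definition yexp s c k : G := - fvec k + sg s (cB c) k.

Definition exch k c : K := cX c (yexp true c k) + cX c (yexp false c k).

Definition off k g : G := g - g 0 k *: fvec k.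

(** x'^g is cut into x^(g - g_k f_k) and the g_k-th power of the new variable, taken in K so that
    g_k may be negative; the power of v undoes the twist of this product. *)
Definition muX k c : G -> K := fun g =>
  qv T (- (g 0 k * lform (muL k (cB c) (cL c)) (off k g) (fvec k)))
  * (cX c (off k g) * exch k c ^ (g 0 k)).

Definition mu k c : chart :=
  Chart (muB k (cB c)) (muL k (cB c) (cL c)) (muX k c).

Lemma off_k k g : off k g 0 k = 0.
Proof. by rewrite !mxE !eqxx mulr1 subrr. Qed.

Lemma off_i k g i : i != k -> off k g 0 i = g 0 i.
Proof. by move=> ik; rewrite !mxE (negbTE ik) mulr0 subr0. Qed.

Lemma off0 k g : g 0 k = 0 -> off k g = g.
Proof. by move=> g0; rewrite /off g0 scale0r subr0. Qed.

Lemma offE k g : g = off k g + g 0 k *: fvec k.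
Proof. by rewrite subrK. Qed.

Lemma fv_k k : (fvec k : G) 0 k = 1.
Proof. by rewrite fvecE eqxx. Qed.

Lemma fv_i i k : i != k -> (fvec i : G) 0 k = 0.
Proof. by rewrite fvecE eq_sym => /negbTE ->. Qed.

Lemma offD k g h : off k (g + h) = off k g + off k h.
Proof. by rewrite /off mxE scalerDl opprD addrACA. Qed.

Section Valid.
Context (c : chart) (vc : valid c).
Local Notation B := (cB c).
Local Notation L := (cL c).
Local Notation X := (cX c).

Lemma v_kk k : B k k = 0.
Proof. exact: dskew_kk (v_d vc) (v_B vc). Qed.

Lemma yexp_k s k : yexp s c k 0 k = -1.
Proof. by rewrite !mxE !eqxx v_kk /sgn; case: s; lia. Qed.

Lemma yexp_i s k i : i != k -> yexp s c k 0 i = Num.max (sgn s (B i k)) 0.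
Proof. by move=> ik; rewrite !mxE (negbTE ik) /=; lia. Qed.

Lemma yexp_sub k : yexp true c k = yexp false c k + pst B k.
Proof. by rewrite /yexp -sg_sub; apply/rowP => i; rewrite !mxE; lia. Qed.

Lemma pst_k k : pst B k 0 k = 0.
Proof. by rewrite mxE v_kk. Qed.

Lemma pst_neq0 k : k \in uf -> pst B k != 0.
Proof.
move=> kuf; apply/eqP => p0; have [W [N [N0 HW]]] := v_rich vc (fun=> 1).
by have := HW k kuf; rewrite p0 wt0; lia.
Qed.

Lemma exch_neq0 k : k \in uf -> exch k c != 0.
Proof.
move=> kuf; apply: XD_neq0; first exact: v_ix vc.
by rewrite yexp_sub -subr_eq0 addrC addKr pst_neq0.
Qed.

Section Mutation.
Context (k : 'I_n) (kuf : k \in uf).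
Local Notation L' := (muL k B L).

Lemma Em_off s g : g 0 k = 0 -> g *m Em s B k = g.
Proof. by move=> g0; rewrite mulEm g0 scale0r addr0. Qed.

Lemma lform_mu s g h : lform L' g h = lform L (g *m Em s B k) (h *m Em s B k).
Proof.
by rewrite lform_mul (muL_sg s (v_L vc) (v_cp vc) kuf (v_kk k)).
Qed.

Lemma lform_mu0 g h : g 0 k = 0 -> h 0 k = 0 -> lform L' g h = lform L g h.
Proof. by move=> g0 h0; rewrite (lform_mu true) !Em_off. Qed.

Lemma lform_muk s g : g 0 k = 0 -> lform L' g (fvec k) = lform L g (yexp s c k).
Proof. by move=> g0; rewrite (lform_mu s) Em_off // fvec_Em eqxx. Qed.

Lemma L'_skew : L'^T = - L'.
Proof. exact/muL_skew/(v_L vc). Qed.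

(** Both terms of the exchange binomial commute with x^r up to the same power of v, because the new
    form can be computed with either sign. *)
Lemma exch_comm r : r 0 k = 0 ->
  X r * exch k c = qv T (lform L' r (fvec k) *+ 2) * (exch k c * X r).
Proof.
move=> r0; rewrite /exch mulrDr mulrDl mulrDr; congr (_ + _).
  by rewrite (X_comm _ _ (v_tw vc) (v_L vc)) (lform_muk true r0).
by rewrite (X_comm _ _ (v_tw vc) (v_L vc)) (lform_muk false r0).
Qed.

Lemma exch_commz r (a : int) : r 0 k = 0 -> X r * exch k c ^ a
  = qv T (a * (lform L' r (fvec k) *+ 2)) * (exch k c ^ a * X r).
Proof. by move=> r0; apply: qcomm_expz; [apply: exch_neq0|apply: exch_comm]. Qed.

Lemma muX_off g : g 0 k = 0 -> muX k c g = X g.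
Proof.
by move=> g0; rewrite /muX off0 // g0 mul0r oppr0 qv0 mul1r expr0z mulr1.
Qed.

Lemma muX_k : muX k c (fvec k) = exch k c.
Proof.
rewrite /muX fv_k /off fv_k scale1r subrr lform0l mulr0 oppr0 qv0 mul1r.
by rewrite (X_zero (v_tw vc) (v_ix vc)) mul1r expr1z.
Qed.

Lemma lform_mu_split (r s : G) (a b : int) : r 0 k = 0 -> s 0 k = 0 ->
  lform L' (r + a *: fvec k) (s + b *: fvec k)
  = lform L r s + b * lform L' r (fvec k) - a * lform L' s (fvec k).
Proof.
move=> r0 s0; rewrite !lformDl !lformDr !lformZl !lformZr (lformxx _ L'_skew).
by rewrite (lform_skew (fvec k) s L'_skew) (lform_mu0 r0 s0); ring.
Qed.

Lemma muX_tw : twistedX L' (muX k c).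
Proof.
move=> g h; rewrite /muX.
have Yu : exch k c \is a GRing.unit by apply/sK_unit/exch_neq0.
have -> : lform L' g h = lform L (off k g) (off k h)
    + h 0 k * lform L' (off k g) (fvec k) - g 0 k * lform L' (off k h) (fvec k).
  rewrite [in LHS](offE k g) [in LHS](offE k h).
  by rewrite lform_mu_split ?off_k.
rewrite offD [(g + h) 0 k]mxE (lformDl L' (off k g)).
move: (off k g) (off k h) (off_k k g) (off_k k h) => r s ru su.
move: (g 0 k) (h 0 k) => a b.
have := exch_commz a su.
move: (lform L' r (fvec k)) (lform L' s (fvec k)) => x y e.
have E : X r * exch k c ^ a * (X s * exch k c ^ b)
  = qv T (- (a * (y *+ 2)) + lform L r s) * (X (r + s) * exch k c ^ (a + b)).
  rewrite exprzDr // mulrA -[X r * _ * _]mulrA.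
  have -> : exch k c ^ a * X s = qv T (- (a * (y *+ 2))) * (X s * exch k c ^ a).
    by rewrite e qvKN.
  by rewrite qvCA !mulrA -[qv T _ * X r * X s]mulrA (v_tw vc) !mulrA -qvD.
rewrite -mulrA qvCA E !qvDA; congr (qv T _ * _).
by ring.
Qed.

End Mutation.
End Valid.
End Chart.

(** * Laurent polynomials in the mutated chart *)

Section Mutated.
Context (T : scalars) (n : nat) (uf : {set 'I_n}) (d : 'I_n -> int).
Local Notation K := (sK T).
Local Notation G := 'rV[int]_n.
Local Notation ka := (@sa T).
Implicit Types (W : 'cV[int]_n) (z y : K) (g h r : G) (i j l : 'I_n).
Context (c : chart T n) (vc : valid uf d c).
Local Notation B := (cB c).
Local Notation L := (cL c).
Local Notation X := (cX c).
Context (k : 'I_n) (kuf : k \in uf).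
Local Notation L' := (muL k B L).
Local Notation X' := (muX k c).
Local Notation Y := (exch k c).

Let tw := v_tw vc.
Let ix := v_ix vc.
Let Yu : Y \is a GRing.unit := sK_unit (exch_neq0 vc kuf).

Lemma yexp_ge0 s l : l != k -> 0 <= yexp s c k 0 l.
Proof. by move=> lk; rewrite (yexp_i _ _ lk); lia. Qed.

Lemma exch_expn (m : nat) :
  lincomb X (fun h => h 0 k = - m%:Z /\ forall l, l != k -> 0 <= h 0 l) (Y ^+ m).
Proof.
elim: m => [|m IH].
  by apply: (lincomb1 tw ix); split=> [|l _]; rewrite mxE.
rewrite exprS; apply: (lincomb_mul tw (P := fun h => h 0 k = -1 /\
    forall l, l != k -> 0 <= h 0 l) _ _ IH).
  move=> g h [gk gl] [hk hl]; split=> [|l lk]; rewrite mxE; first by rewrite gk hk; lia.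
  by rewrite addr_ge0 ?gl ?hl.
by apply: lincombD; apply: lincomb_X; split; rewrite ?(yexp_k vc) // => l; apply: yexp_ge0.
Qed.

Lemma muX_mulY g (m : nat) : X' g * Y ^+ m
  = qv T (- (g 0 k * lform L' (off k g) (fvec k))) * (X (off k g) * Y ^ (g 0 k + m%:Z)).
Proof. by rewrite /muX -!mulrA exprzDr. Qed.

Lemma lincomb_off_exch g (a : int) : 0 <= a -> lincomb X (fun h => h 0 k = - a /\
  forall l, l != k -> g 0 l <= h 0 l) (X (off k g) * Y ^ a).
Proof.
case: a => // m _; apply: (lincomb_mul tw _ _ (exch_expn m)); last first.
  exact: (@lincomb_X _ _ X (fun h => h = off k g)).
move=> _ h -> [hk hl]; split=> [|l lk]; rewrite mxE; first by rewrite off_k add0r.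
by rewrite (off_i _ lk) lerDl hl.
Qed.

(** Both terms of Y have k-th exponent -1. Once Y^m has cleared the negative powers, x'^g Y^m is
    therefore homogeneous of k-th exponent - (g_k + m), so conditions on g_k can be tested in the
    old chart. *)
Lemma lincomb_mu_shift (A : int -> Prop) z : lincomb X' (fun g => A (g 0 k)) z ->
  exists m0 : nat, forall m, (m0 <= m)%N ->
    lincomb X (fun h => A (- h 0 k - m%:Z)) (z * Y ^+ m).
Proof.
move: z; apply: lincomb_ind => [|z y [a Ha] [b Hb]|e g Ag].
- by exists 0%N => m _; rewrite mul0r; apply: lincomb0.
- by exists (a + b)%N => m ab; rewrite mulrDl; apply: lincombD; [apply: Ha|apply: Hb]; lia.
exists (absz (g 0 k)) => m gm; rewrite -mulrA muX_mulY.
apply/lincomb_scale/lincomb_qv; apply: lincomb_sub (lincomb_off_exch g _); last by lia.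
by move=> h [hk _]; rewrite (_ : - _ - _ = g 0 k) //; lia.
Qed.

Lemma lincomb_mu (P Q : G -> Prop) z :
  (forall g, P g -> 0 <= g 0 k) ->
  (forall g h, P g -> h 0 k = - g 0 k -> (forall l, l != k -> g 0 l <= h 0 l) -> Q h) ->
  lincomb X' P z -> lincomb X Q z.
Proof.
move=> P0 PQ; move: z; apply: lincomb_ind => [|z y|e g Pg];
  [exact: lincomb0|exact: lincombD|].
apply/lincomb_scale/lincomb_qv;
  apply: lincomb_sub (lincomb_off_exch g (P0 g Pg)) => h [hk hl].
exact: PQ Pg hk hl.
Qed.

(** Exponents with a fixed g_k = j reduce to the old chart, since Y^j factors out. Different values
    of g_k are separated by the k-th exponent after multiplication with a high power of Y. *)
Lemma muX_ix : indepX X'.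
Proof.
have hom (j : int) (a : {malg sk T[G]}) :
    (forall g, a@_g != 0 -> g 0 k = j) -> ev X' a = 0 -> a = 0.
  move=> aj ea; pose u g := sv T (- (g 0 k * lform L' (off k g) (fvec k))).
  pose b : {malg sk T[G]} := \sum_(g <- msupp a) << a@_g * u g *g off k g >>.
  have b0 : b = 0.
    apply: ix; apply: (mulIr (_ : Y ^ j \is a GRing.unit)); first exact: unitrXz.
    rewrite mul0r -ea /b ev_sum mulr_suml [in RHS]/ev mmapE.
    rewrite big_seq [RHS]big_seq; apply: eq_bigr => g; rewrite -mcoeff_neq0 => ag.
    rewrite evU rmorphM -!mulrA; congr (_ * _).
    by rewrite /muX /qv /u (aj g ag).
  apply/malgP => g; rewrite mcoeff0; have [//|ag] := eqVneq (a@_g) 0.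
  have : b@_(off k g) = 0 by rewrite b0 mcoeff0.
  rewrite /b raddf_sum /= (big_fsetD1 g) /=; last by rewrite -mcoeff_neq0.
  rewrite mcoeffUU big1_fset ?addr0 => [au0|h].
    have uK : u g * sv T (g 0 k * lform L' (off k g) (fvec k)) = 1.
      by rewrite /u -svD addNr sv0.
    by rewrite -[LHS]mulr1 -uK mulrA au0 mul0r.
  rewrite in_fsetD1 => /andP[hg hs] _; rewrite mcoeffU; case: eqP => // e.
  case/eqP: hg; rewrite (offE k h) (offE k g) e (aj g ag) (aj h) //.
  by rewrite mcoeff_neq0.
move=> a ea; apply/malgP => g; rewrite mcoeff0.
pose j := g 0 k.
pose a1 : {malg sk T[G]} := \sum_(h <- msupp a | h 0 k == j) << a@_h *g h >>.
pose a2 : {malg sk T[G]} := \sum_(h <- msupp a | h 0 k != j) << a@_h *g h >>.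
have aE : a = a1 + a2 by rewrite [LHS]monalgE (bigID (fun h : G => h 0 k == j)).
have supp (p : pred G) h : (\sum_(f <- msupp a | p f) << a@_f *g f >>)@_h != 0 -> p h.
  apply: contraR => ph; rewrite raddf_sum /= big1_seq // => f /andP[pf _].
  by rewrite mcoeffU; case: eqP => // fh; rewrite fh (negbTE ph) in pf.
have S1 : lincomb X' (fun h => h 0 k = j) (ev X' a1).
  by exists a1 => // h /supp /eqP.
have S2 : lincomb X' (fun h => h 0 k <> j) (ev X' a2).
  by exists a2 => // h /supp /eqP.
have [m1 H1] := lincomb_mu_shift (A := eq^~ j) S1.
have [m2 H2] := lincomb_mu_shift (A := fun x => x <> j) S2.
have e12 : ev X' a1 = - ev X' a2.
  by apply/eqP; rewrite -subr_eq0 opprK -evD -aE ea.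
have /mulK_eq0[z1|] : ev X' a1 * Y ^+ (m1 + m2) = 0.
- have T1 := H1 _ (leq_addr m2 m1); have T2 := lincombN (H2 _ (leq_addl m1 m2)).
  rewrite -mulNr -e12 in T2.
  by apply: (lincomb_disj ix _ T1 T2) => h /= ->.
- have a10 : a1 = 0 by apply: (hom j) z1 => h /supp /eqP.
  rewrite aE a10 add0r; have [//|ne] := eqVneq (a2@_g) 0.
  by have /eqP := supp _ _ ne; rewrite /j.
by move=> Y0; have := unitrX (m1 + m2) Yu; rewrite Y0 unitr0.
Qed.

Lemma mu_valid : valid uf d (mu k c).
Proof.
split=> /=; first exact: v_d vc.
- exact: dskew_mu (v_d vc) (v_B vc).
- exact: (L'_skew vc k).
- exact: compatible_mu (v_d vc) (v_B vc) (v_L vc) (v_cp vc) kuf.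
- exact: rich_mu (v_d vc) (v_B vc) kuf (v_rich vc).
- exact: (muX_tw vc kuf).
- exact: muX_ix.
Qed.

Lemma exch_yexp s : exch k c = X (yexp s c k) + X (yexp (~~ s) c k).
Proof. by case: s => //; rewrite addrC. Qed.

Lemma muX_add r : r 0 k = 0 -> X' (fvec k + r)
  = X (yexp true c k + r) + X (yexp false c k + r).
Proof.
move=> r0; have tw' := muX_tw vc kuf.
have E s : qv T (- lform L' (fvec k) r) * (X (yexp s c k) * X r) = X (yexp s c k + r).
  rewrite tw qvDA (lform_skew _ _ (L'_skew vc k)) (lform_muk vc kuf s r0).
  by rewrite (lform_skew r _ (v_L vc)) opprK addNr qv0 mul1r.
rewrite -!E -mulrDr -mulrDl -/(exch k c) -(muX_k vc) -(muX_off c r0) tw'.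
by rewrite qvKN.
Qed.

Lemma muX_muX : muX k (mu k c) = X.
Proof.
have vm := mu_valid; have Xu := X_unit (fvec k) ix.
have ybm s : yexp s (mu k c) k = yexp (~~ s) c k by rewrite /yexp sg_mu.
have sg0 s : sg s B k 0 k = 0 by apply/sg_kk/v_kk/vc.
(* Multiplied by Y, the second exchange binomial becomes Y x_k term by term. *)
have ym : exch k (mu k c) = X (fvec k).
  apply: (mulrI Yu).
  have -> : exch k (mu k c) = X' (yexp true c k) + X' (yexp false c k).
    by rewrite /exch /= !ybm addrC.
  rewrite mulrDr [RHS](_ : _ = (X (yexp true c k) + X (yexp false c k)) * X (fvec k))
    // [RHS]mulrDl.
  have E s : Y * X' (yexp s c k) = X (yexp s c k) * X (fvec k).
    rewrite -(muX_k vc) (muX_tw vc kuf) tw /yexp addrA subrr add0r addrAC addNr add0r.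
    rewrite (muX_off c (sg0 s)); congr (qv T _ * _).
    rewrite (lform_mu vc kuf s) mulmxDl mulNmx !fvec_Em eqxx (Em_off c s (sg0 s)).
    rewrite opprD opprK !lformDl !lformDr !lformNl !lformNr.
    rewrite !(lformxx _ (v_L vc)) (lform_skew (fvec k) _ (v_L vc)); lia.
  by rewrite !E.
apply: functional_extensionality => g; rewrite [LHS]/muX ym /=.
rewrite (muLK (v_d vc) (v_B vc) (v_L vc) (v_cp vc) kuf).
rewrite (muX_off c (off_k k g)) (X_expz _ _ tw ix (v_L vc)) tw -offE.
by rewrite lformZr qvDA addNr qv0 mul1r.
Qed.

Lemma mu_mu : mu k (mu k c) = c.
Proof.
rewrite {1}/mu muX_muX /= (muBK _ (v_d vc) (v_B vc)).
by rewrite (muLK (v_d vc) (v_B vc) (v_L vc) (v_cp vc) kuf); case: (c).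
Qed.

End Mutated.

(** * Division by a binomial *)

Section Division.
Context (T : scalars) (n : nat).
Local Notation K := (sK T).
Local Notation G := 'rV[int]_n.
Local Notation ka := (@sa T).
Context (L : 'M[int]_n) (X : G -> K).
Context (tw : twistedX L X) (ix : indepX X).
Context (W : 'cV[int]_n) (a1 a2 : G) (a12 : wt W a2 < wt W a1).
Local Notation p := (X a1 + X a2).
Local Notation D := (wt W a1 - wt W a2).
Local Notation A := (lincomb X (fun=> True)).

(** Euclidean division for the weight W: both terms of the binomial are invertible, so a monomial of
    weight at least D is lowered by D using [X a1], and one of negative weight is raised by D using
    [X a2]. *)
Lemma binomial_division u : A u -> exists e r,
  [/\ u = p * e + r, A e & lincomb X (fun h => 0 <= wt W h < D) r].
Proof.
pose Q u := exists e r, [/\ u = p * e + r, A e & lincomb X (fun h => 0 <= wt W h < D) r].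
have Q0 : Q 0 by exists 0, 0; rewrite mulr0 addr0; split=> //; apply: lincomb0.
have QD z y : Q z -> Q y -> Q (z + y).
  move=> [e [r [-> He Hr]]] [f [s [-> Hf Hs]]]; exists (e + f), (r + s).
  by split; [rewrite mulrDr addrACA|apply: lincombD|apply: lincombD].
have Qm b z : Q z -> Q (ka b * z).
  move=> [e [r [-> He Hr]]]; exists (ka b * e), (ka b * r); split.
  - by rewrite mulrDr !mulrA saC.
  - exact: lincomb_scale.
  - exact: lincomb_scale.
have Qp e : A e -> Q (p * e).
  by move=> He; exists e, 0; rewrite addr0; split=> //; apply: lincomb0.
have Qs g : 0 <= wt W g < D -> Q (X g).
  by move=> Hg; exists 0, (X g); rewrite mulr0 add0r; split=> //;
    [apply: lincomb0|apply: lincomb_X].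
(* One statement for both moves: for [h = a1] the new exponent is g - a1 + a2, for [h = a2] it is g
   - a2 + a1. *)
have Qstep g h b : X g = qv T b * (p * X (g - h)) - qv T (b + lform L (a1 + a2 - h) (g
  - h)) * X (g + a1 + a2 - h *+ 2)
    -> Q (X (g + a1 + a2 - h *+ 2)) -> Q (X g).
  move=> -> Hq; apply: QD; first by apply/Qm/Qp/lincomb_X.
  by rewrite -mulN1r -(rmorphN1 ka); apply/Qm/Qm.
have E1 g : X g = qv T (- lform L a1 (g - a1)) * (p * X (g - a1))
    - qv T (- lform L a1 (g - a1) + lform L a2 (g - a1)) * X (g + a1 + a2 - a1 *+ 2).
  rewrite mulrDl mulrDr !tw qvDA addNr qv0 mul1r qvDA.
  have -> : a1 + (g - a1) = g by rewrite addrC subrK.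
  have -> : a2 + (g - a1) = g + a1 + a2 - a1 *+ 2.
    by apply/rowP => i; rewrite !mxE; ring.
  by rewrite addrK.
have E2 g : X g = qv T (- lform L a2 (g - a2)) * (p * X (g - a2))
    - qv T (- lform L a2 (g - a2) + lform L a1 (g - a2)) * X (g + a1 + a2 - a2 *+ 2).
  rewrite mulrDl mulrDr !tw !qvDA addNr qv0 mul1r.
  have -> : a2 + (g - a2) = g by rewrite addrC subrK.
  have -> : a1 + (g - a2) = g + a1 + a2 - a2 *+ 2.
    by apply/rowP => i; rewrite !mxE; ring.
  by rewrite [RHS]addrC addKr.
have QX (N : nat) g : `|wt W g| <= N%:Z -> Q (X g).
  elim: N g => [|N IH] g gN; first by apply: Qs; lia.
  have [Hg|nHg] := boolP (0 <= wt W g < D); first exact: Qs.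
  have [g0|g0] := leP 0 (wt W g).
    apply: (Qstep g a1 (- lform L a1 (g - a1))).
      by rewrite (addrC a1) addrK E1.
    apply: IH; rewrite mulr2n !(wtD, wtN); lia.
  have wE : wt W (g + a1 + a2 - a2 *+ 2) = wt W g + D.
    by rewrite mulr2n !(wtD, wtN); lia.
  apply: (Qstep g a2 (- lform L a2 (g - a2))); first by rewrite addrK E2.
  have [Hg|nHg'] := boolP (0 <= wt W g + D < D); first by apply: Qs; rewrite wE.
  by apply: IH; rewrite wE; lia.
move: u; apply: lincomb_ind => // b g _; apply: Qm.
by apply: (QX (absz (wt W g))); lia.
Qed.

(* With p y = p e + r and r of W-width less than that of p, the element q r is
   a multiple of p that is too narrow to be nonzero. *)
Lemma coprime_binomials b1 b2 (w : int) y : b1 != b2 -> wt W b1 = wt W b2 ->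
  p * (X b1 + X b2) = qv T w * ((X b1 + X b2) * p) ->
  A (p * y) -> A ((X b1 + X b2) * y) -> A y.
Proof.
move=> b12 wb pq Apy Aqy; set q := X b1 + X b2 in pq Aqy *.
have AM z z' : A z -> A z' -> A (z * z') by move=> Hz Hz'; apply: (lincomb_mul tw _ Hz Hz').
have Aq : A q by apply: lincombD; apply: lincomb_X.
have [e [r [pyE Ae Hr]]] := binomial_division Apy.
have qp : q * p = qv T (- w) * (p * q) by rewrite pq qvKN.
have p0 : p != 0.
  by apply: XD_neq0 => //; apply/eqP => e12; move: a12; rewrite e12 ltxx.
suff r0 : r = 0.
  rewrite r0 addr0 in pyE; have -> // : y = e.
  exact: (mulrI (sK_unit p0)).
have qr : q * r = p * (qv T (- w) * (q * y - q * e)).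
  have -> : r = p * y - p * e by rewrite pyE addrC addKr.
  by rewrite qvCA !mulrBr !mulrA qp -!mulrA.
have [//|r0] := eqVneq r 0.
have qr0 : q * r != 0 by apply: mulK_neq0 => //; apply: XD_neq0.
have := width_mul tw ix (W := W) (lo := wt W b1) (hi := wt W b1 + D - 1) _ _ qr.
move=> H; suff : D <= wt W b1 + D - 1 - wt W b1 by lia.
apply: H => //.
- by apply/eqP => e0; move: qr0; rewrite qr e0 mulr0 eqxx.
- by apply/lincomb_qv/lincombB => //; apply: AM.
apply: (lincomb_mul tw (P := fun h => wt W h = wt W b1) _ _ Hr).
  by move=> g h ge; rewrite wtD ge; lia.
by apply: lincombD; apply: lincomb_X.
Qed.

End Division.

(** * Elements that are Laurent in two adjacent charts *)

Section Exchange.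
Context (T : scalars) (n : nat) (uf : {set 'I_n}) (d : 'I_n -> int).
Local Notation K := (sK T).
Local Notation G := 'rV[int]_n.
Local Notation ka := (@sa T).
Implicit Types (W : 'cV[int]_n) (z y : K) (g h r : G) (i j l : 'I_n).
Context (c : chart T n) (vc : valid uf d c).
Local Notation B := (cB c).
Local Notation L := (cL c).
Local Notation X := (cX c).
Context (k : 'I_n) (kuf : k \in uf).
Local Notation L' := (muL k B L).
Local Notation X' := (muX k c).
Local Notation Y := (exch k c).

Let tw := v_tw vc.
Let ix := v_ix vc.
Let Y0 := exch_neq0 vc kuf.

(** The k-degree, [g 0 k] in the new chart and [- h 0 k] in the old one, is a common grading: after
    multiplication by a power of Y, the components taken in the two charts are components of one
    Laurent polynomial in the old chart. *)
Lemma lincomb_common (A : int -> Prop) z : lincomb X (fun=> True) z ->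
  lincomb X' (fun=> True) z ->
  exists z1 z2, [/\ z = z1 + z2, lincomb X (fun h => A (- h 0 k)) z1,
    lincomb X' (fun h => A (h 0 k)) z1 & lincomb X (fun h => ~ A (- h 0 k)) z2].
Proof.
move=> Sz Sz'.
have [y1 [y2 [zy Hy1 Hy2]]] := lincomb_split (fun h => A (- h 0 k)) Sz.
have [z1 [z2 [zE Hz1 Hz2]]] := lincomb_split (fun h => A (h 0 k)) Sz'.
have {}Hy1 : lincomb X (fun h => A (- h 0 k)) y1 by apply: lincomb_sub Hy1 => h [].
have {}Hy2 : lincomb X (fun h => ~ A (- h 0 k)) y2 by apply: lincomb_sub Hy2 => h [].
have {}Hz1 : lincomb X' (fun h => A (h 0 k)) z1 by apply: lincomb_sub Hz1 => h [].
have {}Hz2 : lincomb X' (fun h => ~ A (h 0 k)) z2 by apply: lincomb_sub Hz2 => h [].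
suff e : y1 = z1 by exists y1, y2; split=> //; rewrite e.
have [m1 H1] := lincomb_mu_shift vc kuf Hz1.
have [m2 H2] := lincomb_mu_shift (A := fun x => ~ A x) vc kuf Hz2.
pose m := (m1 + m2)%N.
have {}H1 := H1 _ (leq_addr m2 m1); have {}H2 := H2 _ (leq_addl m1 m2).
have Ym : lincomb X (fun h => h 0 k = - m%:Z) (Y ^+ m).
  by apply: lincomb_sub (exch_expn vc kuf m) => h [].
have F1 : lincomb X (fun h => A (- h 0 k - m%:Z)) (y1 * Y ^+ m).
  apply: (lincomb_mul tw _ Hy1 Ym) => g h Ag hk; rewrite mxE hk.
  by rewrite (_ : _ - _ = - g 0 k) //; ring.
have F2 : lincomb X (fun h => ~ A (- h 0 k - m%:Z)) (y2 * Y ^+ m).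
  apply: (lincomb_mul tw _ Hy2 Ym) => g h Ag hk; rewrite mxE hk.
  by rewrite (_ : _ - _ = - g 0 k) //; ring.
have e : (y1 - z1) * Y ^+ m = (z2 - y2) * Y ^+ m.
  congr (_ * _); apply/eqP; rewrite subr_eq addrAC eq_sym subr_eq -zy zE.
  by rewrite addrC.
have /mulK_eq0[/eqP|] : (y1 - z1) * Y ^+ m = 0.
- have E1 := lincombB F1 H1; have E2 := lincombB H2 F2.
  rewrite -!mulrBl in E1 E2; rewrite -e in E2.
  exact: (lincomb_disj ix _ E1 E2).
- by rewrite subr_eq0 => /eqP.
- by move=> Ym0; have := unitrX m (sK_unit Y0); rewrite Ym0 unitr0.
Qed.

(** By the common grading, only positive powers of the new variable occur in the mutated chart, so
    one factor Y can be split off. *)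
Lemma exch_div z : lincomb X (fun h => h 0 k < 0) z -> lincomb X' (fun=> True) z ->
  exists2 e, lincomb X (fun=> True) e & z = Y * e.
Proof.
move=> Hz Hz'.
have [z1 [z2 [zE H1 H1' H2]]] :=
  lincomb_common (fun a => 0 < a) (lincomb_sub (fun _ _ => I) Hz) Hz'.
have z20 : z2 = 0.
  apply: (lincomb_disj ix _ H2 (_ : lincomb X (fun h => 0 < - h 0 k) z2)) => //.
  have -> : z2 = z - z1 by rewrite zE addrC addKr.
  by apply: lincombB => //; apply: lincomb_sub Hz => h; rewrite oppr_gt0.
rewrite zE z20 addr0; move: z1 H1' {zE H1}; apply: lincomb_ind.
- by exists 0; rewrite ?mulr0 //; apply: lincomb0.
- move=> z1 z1' [e He ->] [f Hf ->]; exists (e + f); first exact: lincombD.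
  by rewrite mulrDr.
move=> b g gk.
have Yu := sK_unit Y0.
have eY (a : int) : Y ^ a = Y * Y ^ (a - 1).
  have e1 : Y ^ 1 = Y := expr1z Y.
  by rewrite -[Y in RHS]e1 -exprzDr ?e1 // addrC subrK.
have := @exch_comm _ _ _ _ _ vc _ kuf (off k g) (off_k k g).
set w := _ *+ 2 => ew.
exists (ka b * (qv T (- (g 0 k * lform L' (off k g) (fvec k)))
  * (qv T w * (X (off k g) * Y ^ (g 0 k - 1))))).
  apply/lincomb_scale/lincomb_qv/lincomb_qv; apply: (lincomb_sub (P :=
    fun h => h 0 k = - (g 0 k - 1) /\
    forall l, l != k -> g 0 l <= h 0 l)) => //.
  by apply: (lincomb_off_exch vc kuf); rewrite subr_ge0 -gtz0_ge1.
rewrite mulrA -saC -mulrA; congr (_ * _).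
rewrite /muX qvCA; congr (_ * _).
by rewrite [in LHS]eY mulrA ew !mulrA [Y * qv _ _]qvC.
Qed.

(** Otherwise x^g would be a multiple of Y; but a monomial has width 0, while Y has positive width
    for a weight that is positive on p^* e_k. *)
Lemma exponent_ge0 g : lincomb X' (fun=> True) (X g) -> 0 <= g 0 k.
Proof.
move=> Hg; rewrite leNgt; apply/negP => gk.
have Hg' : lincomb X (fun h => h 0 k < 0) (X g) by apply: lincomb_X.
have [e He zE] := exch_div Hg' Hg.
have e0 : e != 0.
  by apply/eqP => e0; have := X_neq0 g ix; rewrite zE e0 mulr0 eqxx.
have [W [N [N0 HW]]] := v_rich vc (fun=> 1).
have := width_mul tw ix (W := W) (lo := wt W g) (hi := wt W g) e0 He zE.
have := HW k kuf; rewrite (yexp_sub c k) wtD => -> H.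
suff : wt W (yexp false c k) + N * 1 - wt W (yexp false c k) <= wt W g - wt W g by lia.
apply: H; last by lia.
by apply: lincomb_X; rewrite lexx.
Qed.

(** The binomial is a multiple of Y, and the width of Y is the absolute weight of p^* e_k. *)
Lemma exponent_width (g de : G) W : g 0 k = -1 -> de 0 k = 0 -> de != 0 ->
  lincomb X' (fun=> True) (X g + X (g + de)) -> `|wt W (pst B k)| <= `|wt W de|.
Proof.
move=> gk dk de0 Hz.
have Hz' : lincomb X (fun h => h 0 k < 0) (X g + X (g + de)).
  by apply: lincombD; apply: lincomb_X; rewrite ?mxE ?dk gk.
have [e He zE] := exch_div Hz' Hz.
have z0 : X g + X (g + de) != 0.
  by apply: XD_neq0 => //; rewrite -subr_eq0 opprD addNKr oppr_eq0.
have e0 : e != 0 by apply/eqP => e0; move: z0; rewrite zE e0 mulr0 eqxx.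
have Hw lo hi : lo <= wt W g <= hi -> lo <= wt W g + wt W de <= hi ->
    lincomb X (fun h => lo <= wt W h <= hi) (X g + X (g + de)).
  by move=> ? ?; apply: lincombD; apply: lincomb_X; rewrite ?wtD.
have key s : wt W (yexp (~~ s) c k) < wt W (yexp s c k) ->
    wt W (yexp s c k) - wt W (yexp (~~ s) c k) <= `|wt W de|.
  move=> lt; rewrite (exch_yexp c k s) in zE.
  have [de_ge|de_lt] := leP 0 (wt W de).
    have := width_mul tw ix e0 He zE (Hw (wt W g) (wt W g + wt W de) _ _) lt.
    by lia.
  have := width_mul tw ix e0 He zE (Hw (wt W g + wt W de) (wt W g) _ _) lt.
  by lia.
have := key true; have := key false; rewrite /= (yexp_sub c k) wtD; lia.
Qed.

Lemma lincomb_mu_inv (P Q : G -> Prop) z :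
  (forall g, P g -> 0 <= g 0 k) ->
  (forall g h, P g -> h 0 k = - g 0 k -> (forall l, l != k -> g 0 l <= h 0 l) -> Q h) ->
  lincomb X P z -> lincomb X' Q z.
Proof.
move=> P0 PQ Hz; apply: (lincomb_mu (mu_valid vc kuf) kuf P0 PQ).
by rewrite (muX_muX vc kuf).
Qed.

Lemma X_mu_ge0 g : 0 <= g 0 k -> lincomb X' (fun=> True) (X g).
Proof.
by move=> gk; apply: (lincomb_mu_inv (P := fun h => h = g)) => // [_ ->//|];
  apply: lincomb_X.
Qed.

(** The exponents lie on a segment. Its end j = 0 is isolated with coefficient 1; of the other terms
    only the position matters. *)
Lemma muX_expansion s r (m : nat) : r 0 k = 0 ->
  lincomb X (fun h => exists2 j : nat, (0 < j <= m)%N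
      & h = r + m%:Z *: yexp s c k + j%:Z *: (yexp (~~ s) c k - yexp s c k))
    (X' (r + m%:Z *: fvec k) - X (r + m%:Z *: yexp s c k)).
Proof.
move=> r0; set y := yexp s c k; set y' := yexp (~~ s) c k.
elim: m => [|m IH].
  by rewrite !scale0r addr0 (muX_off c r0) subrr; apply: lincomb0.
have fS (v : G) : r + m.+1%:Z *: v = r + m%:Z *: v + v.
  by apply/rowP => i; rewrite !mxE intS; ring.
have lE : lform L' (r + m%:Z *: fvec k) (fvec k) = lform L (r + m%:Z *: y) y.
  rewrite !lformDl !lformZl (lformxx _ (L'_skew vc k)) (lformxx _ (v_L vc)).
  by rewrite (lform_muk vc kuf s r0).
set w := lform _ _ _ in lE.
have -> : X' (r + m.+1%:Z *: fvec k) = qv T (- w) * (X' (r + m%:Z *: fvec k) * Y).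
  by rewrite -(muX_k vc) (muX_tw vc kuf) qvKN fS.
have -> : X (r + m.+1%:Z *: y) = qv T (- w) * (X (r + m%:Z *: y) * X y).
  by rewrite tw -lE qvKN fS.
rewrite -mulrBr; apply: lincomb_qv.
set z := X' _ in IH *; rewrite (exch_yexp c k s) -/y -/y'.
have -> : z * (X y + X y') - X (r + m%:Z *: y) * X y
  = (z - X (r + m%:Z *: y)) * X y + z * X y'.
  by rewrite mulrDr mulrBl addrAC.
apply: lincombD.
  apply: (lincomb_mul tw (Q := fun h => h = y) _ IH); last exact: lincomb_X.
  move=> _ _ [j /andP[j0 jm] ->] ->; exists j; first by rewrite j0 ltnW.
  by rewrite fS addrAC.
rewrite -[z](subrK (X (r + m%:Z *: y))) mulrDl; apply: lincombD.
  apply: (lincomb_mul tw (Q := fun h => h = y') _ IH); last exact: lincomb_X.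
  move=> _ _ [j /andP[j0 jm] ->] ->; exists j.+1; first by rewrite /= ltnS.
  by rewrite fS; apply/rowP => i; rewrite !mxE intS; ring.
rewrite tw; apply/lincomb_qv/lincomb_X; exists 1%N => //.
by rewrite fS scale1r; apply/rowP => i; rewrite !mxE; ring.
Qed.

End Exchange.

(** * The Laurent phenomenon *)

Section Laurent.
Context (T : scalars) (n : nat) (uf : {set 'I_n}) (d : 'I_n -> int).
Local Notation K := (sK T).
Local Notation G := 'rV[int]_n.
Local Notation ka := (@sa T).
Implicit Types (W : 'cV[int]_n) (z y u : K) (g h r : G) (i j k l : 'I_n)
  (c : chart T n).

Section TwoDirections.
Context (c : chart T n) (vc : valid uf d c) (k l : 'I_n).
Context (kuf : k \in uf) (luf : l \in uf) (kl : k != l).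
Local Notation B := (cB c).
Local Notation X := (cX c).
Local Notation ck := (mu k c).
Local Notation ckl := (mu l ck).
Local Notation Xk := (muX k c).
Local Notation Xl := (muX l c).
Local Notation Xkl := (muX l ck).
Local Notation A := (lincomb Xkl (fun=> True)).

Let lk : l != k. Proof. by rewrite eq_sym. Qed.
Let vk : valid uf d ck. Proof. exact: mu_valid. Qed.
Let vkl : valid uf d ckl. Proof. exact: mu_valid. Qed.
Let twkl := v_tw vkl.
Let ixkl := v_ix vkl.

Let AM z y : A z -> A y -> A (z * y).
Proof. by move=> Hz Hy; apply: (lincomb_mul twkl _ Hz Hy). Qed.

Let AX (m : nat) z : A z -> A (z ^+ m).
Proof.
move=> Hz; elim: m => [|m IH]; first exact: (lincomb1 twkl ixkl).
by rewrite exprS; apply: AM.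
Qed.

Let A_k g : 0 <= g 0 l -> A (Xk g).
Proof. exact: (X_mu_ge0 vk luf). Qed.

Let A_c g : 0 <= g 0 k -> 0 <= g 0 l -> A (X g).
Proof.
move=> gk gl; apply: (lincomb_mu_inv vk luf (P := fun h => 0 <= h 0 l)) => //.
apply: (lincomb_mu_inv vc kuf (P := fun h => h = g)) => [_ -> //|_ h -> _ H|];
  last exact: lincomb_X.
exact: le_trans gl (H l lk).
Qed.

Let muXkE : muX k ck = X. Proof. exact: (muX_muX vc kuf). Qed.

Let ybkE s i : i != k -> yexp s ck k 0 i = Num.max (sgn s (- B i k)) 0.
Proof. by move=> ik; rewrite yexp_i //= mxE eqxx orbT. Qed.

Let skl : 0 <= B k l -> B l k <= 0.
Proof. by have := v_B vc k l; have := v_d vc k; have := v_d vc l; nia. Qed.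

Let skl' : B k l < 0 -> 0 < B l k.
Proof. by have := v_B vc k l; have := v_d vc k; have := v_d vc l; nia. Qed.

Let skl0 : B k l <> 0 -> B l k <> 0.
Proof. by have := v_B vc k l; have := v_d vc k; have := v_d vc l; nia. Qed.

(** With [s] the sign of b_kl, only the term [yexp s c l] can involve x_k. Expanding its power of
    x_k in mu_k c gives one monomial [Xk m] with x_l-exponent -1 and terms with nonnegative
    x_l-exponent. That monomial and the second term of the exchange relation at l combine to x^r'
    times the new variable of mu_l mu_k c. *)
Lemma new_var_Laurent : A (exch l c).
Proof.
pose s := 0 <= B k l; pose b := absz (B k l).
have bE : b%:Z = sgn s (B k l) by rewrite /b /sgn /s; case: leP; lia.
pose r : G := yexp s c l - b%:Z *: fvec k.
have r0 : r 0 k = 0.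
  by rewrite rvD (yexp_i _ _ kl) !rvE -bE eqxx; lia.
have := muX_expansion vk kuf (~~ s) b r0.
rewrite muXkE (_ : r + b%:Z *: fvec k = yexp s c l); last by rewrite subrK.
set m := r + _ => Ht; rewrite negbK in Ht.
have rl : r 0 l = -1 by rewrite rvD (yexp_k vc) !rvE (negbTE lk) mulr0 oppr0 addr0.
have ysl : yexp (~~ s) ck k 0 l = 0.
  rewrite ybkE // /s; case: (leP 0 (B k l)) => [/skl|/skl'] /=; lia.
have m_i i : m 0 i = r 0 i + b%:Z * yexp (~~ s) ck k 0 i by rewrite /m rvD rvZ.
have r_i i : r 0 i = yexp s c l 0 i - b%:Z * (i == k)%:R.
  by rewrite /r rvD rvN rvZ fvecE.
have ml : m 0 l = -1 by rewrite m_i rl ysl mulr0 addr0.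
have At : A (X (yexp s c l) - Xk m).
  apply: (lincomb_mu_inv vk luf (P := fun h => 0 <= h 0 l)) => //.
  apply: lincomb_sub Ht => h [j /andP[j0 jb] ->].
  have seedB : B k l <> 0 by move=> e; move: j0 jb; rewrite /b e; case: (j).
  have := skl0 seedB; have := skl; have := skl'.
  rewrite -/m rvD ml rvZ rvD rvN ysl ybkE // /s.
  by case: (leP 0 (B k l)) => /=; nia.
rewrite (exch_yexp c l s) -[X (yexp s c l)](subrK (Xk m)) -addrA; apply: lincombD => //.
have y0 : yexp (~~ s) c l 0 k = 0.
  by rewrite yexp_i // /s; case: leP => /= ?; lia.
rewrite -(muX_off c y0).
pose r' : G := yexp (~~ s) c l - yexp (~~ s) ck l.
have r'0 : r' 0 l = 0 by rewrite rvD rvN (yexp_k vc) (yexp_k vk) subrr.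
suff mE : m = yexp s ck l + r'.
  suff -> : Xk m + Xk (yexp (~~ s) c l) = Xkl (fvec l + r') by apply: lincomb_X.
  rewrite (muX_add vk luf r'0) mE.
  have -> : yexp (~~ s) c l = yexp (~~ s) ck l + r' by rewrite addrC subrK.
  by move: (s) => [] //=; exact: addrC.
have r'_i i : r' 0 i = yexp (~~ s) c l 0 i - yexp (~~ s) ck l 0 i by rewrite /r' rvD rvN.
apply/rowP => i; rewrite [RHS]rvD; have [->|il] := eqVneq i l.
  by rewrite ml (yexp_k vk) r'0 addr0.
have [->|ik] := eqVneq i k.
  rewrite m_i r0 (yexp_k vk) r'_i y0 !(yexp_i _ _ kl) /= mxE eqxx /= bE.
  by rewrite /s; case: leP => /=; lia.
rewrite m_i r_i r'_i (negbTE ik) mulr0 subr0 ybkE //.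
rewrite !(yexp_i _ _ il) /= mxE (negbTE ik) (negbTE lk) /= bE.
rewrite /s; case: leP => /= Bkl; have := Bkl; move: (B k l) (B i l) (B i k) => x y z x0.
  have -> : Num.max (- x) 0 = 0 by lia.
  by rewrite opprK mulr0 subr0; move: (Num.max z 0) => w; nia.
have -> : Num.max (- x) 0 = - x by lia.
by move: (Num.max (- z) 0) => w; nia.
Qed.

(* If b_lk <> 0, the exchange relation at k shows that x_k and x_l generate the
   unit ideal of LP(mu_l mu_k t); if b_lk = 0, both are binomials in that chart
   with independent exponents. *)
Lemma new_var_coprime y : A (X (fvec k) * y) -> A (X (fvec l) * y) -> A y.
Proof.
move=> Hk Hl.
have Xlk : Xk (fvec l) = X (fvec l) by rewrite (muX_off c) // fv_i.
have XkE : X (fvec k) = exch k ck by rewrite -muXkE (muX_k vk).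
have [Blk|/eqP Blk] := eqVneq (B l k) 0; last first.
  (* In the exchange relation of mu_k c at k, the term of sign [~~ s] is free of x_l, hence
     invertible in mu_l mu_k c, and the other term is a multiple of x_l. *)
  pose s := 0 <= B k l.
  have ysl : yexp (~~ s) ck k 0 l = 0.
    by rewrite ybkE // /s; case: (leP 0 (B k l)) => [/skl|/skl'] /=; lia.
  have ysl' : 0 < yexp s ck k 0 l.
    by rewrite ybkE // /s; case: (leP 0 (B k l)) => [/skl|/skl'] /=; lia.
  have H : A (Xk (yexp (~~ s) ck k) * y).
    have -> : Xk (yexp (~~ s) ck k) = X (fvec k) - Xk (yexp s ck k).
      by rewrite XkE (exch_yexp ck k s) addrC addKr.
    rewrite mulrBl; apply: lincombB => //.
    have : A (Xk (yexp s ck k - fvec l) * (Xk (fvec l) * y)).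
      apply: AM; last by rewrite Xlk.
      by apply: A_k; rewrite rvD rvN fv_k; lia.
    by rewrite mulrA (v_tw vk) subrK -mulrA => /lincomb_qvE.
  have := AM (A_k (_ : 0 <= (- yexp (~~ s) ck k) 0 l)) H.
  rewrite mulrA (VX _ (v_tw vk) (v_ix vk) (v_L vk)) mul1r; apply.
  by rewrite rvN ysl.
have Bkl : B k l = 0.
  by have := v_B vc k l; rewrite Blk mul0r oppr0; have := v_d vc l; nia.
(* This weight separates the two terms of the binomial for x_k and gives equal weight to the two
   terms of the binomial for x_l. *)
have [W [N [N0 HW]]] := v_rich vc (fun i => (i == k)%:R).
have yl s : yexp s ck k 0 l = 0 by rewrite ybkE // Blk; case: s.
have XfkE : X (fvec k) = Xkl (yexp false ck k) + Xkl (yexp true ck k).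
  by rewrite XkE (exch_yexp ck k false) !(muX_off ck (yl _)).
have XflE : X (fvec l) = Xkl (yexp true ckl l) + Xkl (yexp false ckl l).
  by rewrite -Xlk -[Xk]/(cX ck) -(muX_muX vk luf) (muX_k vkl).
have pl : pst (muB k B) l = pst B l.
  apply/rowP => i; rewrite !mxE (negbTE lk) orbF Bkl oppr0 maxxx !mulr0 addr0 subr0.
  by case: eqP => // ->; rewrite Bkl oppr0.
have wk := HW k kuf; have wl := HW l luf; rewrite eqxx in wk; rewrite (negbTE lk) in wl.
rewrite XfkE XflE in Hk Hl *.
apply: (coprime_binomials twkl ixkl (W := W) _ _ _ _ Hk Hl).
- rewrite (yexp_sub ck k) wtD /= pst_mu_k wtN wk; lia.
- by rewrite (yexp_sub ckl l) -subr_eq0 addrC addKr (pst_neq0 vkl).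
- by rewrite (yexp_sub ckl l) wtD /= pst_mu_k wtN pl wl mulr0 oppr0 addr0.
- rewrite -XfkE -XflE; exact: (X_comm _ _ (v_tw vc) (v_L vc)).
Qed.

Let var_power (i : 'I_n) (m : nat) : X (fvec i) ^+ m = X (m%:Z *: fvec i).
Proof. exact: (X_exp _ _ (v_tw vc) (v_ix vc) (v_L vc)). Qed.

Lemma powers_coprime (a b : nat) u :
  A (X (fvec k) ^+ a * u) -> A (X (fvec l) ^+ b * u) -> A u.
Proof.
have Ax : A (X (fvec k)).
  by apply: A_c; rewrite fvecE; case: (_ == _).
have Ay : A (X (fvec l)).
  by apply: A_c; rewrite fvecE; case: (_ == _).
have inner m v : A (X (fvec k) * v) -> A (X (fvec l) ^+ m * v) -> A v.
  elim: m v => [|m IH] v Hx; first by rewrite mul1r.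
  rewrite exprS -mulrA => Hy; apply: IH => //; apply: new_var_coprime => //.
  rewrite mulrA var_power (X_comm _ _ (v_tw vc) (v_L vc)) -mulrA -mulrA; apply: lincomb_qv.
  by apply: AM => //; rewrite -var_power; apply: AX.
elim: a u => [|a IH] u; first by rewrite mul1r.
rewrite exprS -mulrA => Hx Hy; apply: (IH) => //; apply: (inner b) => //.
rewrite mulrA !var_power (X_comm _ _ (v_tw vc) (v_L vc)) -mulrA -mulrA; apply: lincomb_qv.
by apply: AM; rewrite -var_power //; apply: AX.
Qed.

(** By [powers_coprime] it suffices to treat x_k^m z and x_l^m z for large m. For x_l^m z the
    expansion of z in mu_k c is enough, since only x_l changes from there to mu_l mu_k c. *)
Lemma upper_bound_mu z : lincomb X (fun=> True) z -> lincomb Xk (fun=> True) z ->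
  lincomb Xl (fun=> True) z -> A z.
Proof.
move=> Hz Hk Hl.
suff [a Ha] : exists a, forall m, (a <= m)%N -> A (X (fvec k) ^+ m * z).
  suff [b Hb] : exists b, forall m, (b <= m)%N -> A (X (fvec l) ^+ m * z).
    by apply: (powers_coprime (a := a) (b := b)); [apply: Ha|apply: Hb].
  move: z Hk {Hz Hl Ha}; apply: lincomb_ind => [|z y [b Hb] [b' Hb']|e g _].
  - by exists 0%N => m _; rewrite mulr0; apply: lincomb0.
  - by exists (b + b')%N => m bm; rewrite mulrDr; apply: lincombD;
    [apply: Hb|apply: Hb']; lia.
  exists (absz (g 0 l)) => m gm; rewrite mulrA -saC -mulrA; apply: lincomb_scale.
  have m0 : (m%:Z *: fvec l : G) 0 k = 0 by rewrite rvZ fv_i // mulr0.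
  rewrite var_power -(muX_off c m0) (muX_tw vc kuf); apply/lincomb_qv/A_k.
  by rewrite rvD rvZ fv_k; lia.
(* For x_k^m z the l-degree splits z into a part with positive powers of the new variable at l,
   settled by [new_var_Laurent], and a part with nonnegative powers of x_l in c. *)
have [z1 [z2 [-> _ H1 H2]]] := lincomb_common vc luf (fun a => 0 < a) Hz Hl.
suff [a Ha] : exists a, forall m, (a <= m)%N -> A (X (fvec k) ^+ m * z1).
  suff [b Hb] : exists b, forall m, (b <= m)%N -> A (X (fvec k) ^+ m * z2).
    by exists (a + b)%N => m abm; rewrite mulrDr; apply: lincombD;
      [apply: Ha|apply: Hb]; lia.
  move: z2 H2; apply: lincomb_ind => [|z2 y [b Hb] [b' Hb']|e g gl].
  - by exists 0%N => m _; rewrite mulr0; apply: lincomb0.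
  - by exists (b + b')%N => m bm; rewrite mulrDr; apply: lincombD;
    [apply: Hb|apply: Hb']; lia.
  exists (absz (g 0 k)) => m gm; rewrite mulrA -saC -mulrA; apply: lincomb_scale.
  rewrite var_power (v_tw vc); apply/lincomb_qv/A_c; rewrite rvD rvZ ?fv_k ?fv_i //; lia.
move: z1 H1; apply: lincomb_ind => [|z1 y [b Hb] [b' Hb']|e g gl].
- by exists 0%N => m _; rewrite mulr0; apply: lincomb0.
- by exists (b + b')%N => m bm; rewrite mulrDr; apply: lincombD;
  [apply: Hb|apply: Hb']; lia.
exists (absz (g 0 k)) => m gm; rewrite mulrA -saC -mulrA; apply: lincomb_scale.
rewrite /muX qvCA; apply: lincomb_qv; rewrite mulrA var_power (v_tw vc) -mulrA.
apply/lincomb_qv/AM.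
  by apply: A_c; rewrite rvD rvZ ?fv_k ?fv_i ?off_k ?off_i //; lia.
case: (g 0 l) gl => // j _; apply/AX/new_var_Laurent.
Qed.

End TwoDirections.
End Laurent.

(** * Mutation sequences, invariance of upper bounds, and gradings *)

Section Patterns.
Context (T : scalars) (n : nat) (uf : {set 'I_n}) (d : 'I_n -> int).
Local Notation K := (sK T).
Local Notation G := 'rV[int]_n.
Local Notation ka := (@sa T).
Implicit Types (W : 'cV[int]_n) (z y u : K) (g h r : G) (i j k l : 'I_n)
  (c : chart T n) (V : {set 'I_n}).

(** The allowed directions V are kept apart from [uf], so that the same charts serve t_0 and the
    seed frozen along F. *)
Inductive reach V c0 : chart T n -> Prop :=
  | reach0 : reach V c0 c0
  | reachS c k : reach V c0 c -> k \in V -> reach V c0 (mu k c).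

Lemma reach_sub V V' c0 c : V \subset V' -> reach V c0 c -> reach V' c0 c.
Proof.
move=> /subsetP VV'; elim=> [|c1 k _ IH kV]; first exact: reach0.
by apply: reachS => //; apply: VV'.
Qed.

Lemma reach_valid c0 c : valid uf d c0 -> reach uf c0 c -> valid uf d c.
Proof. by move=> v0; elim=> // c1 k _ v1 kuf; apply: mu_valid. Qed.

(* The upper bound at a chart: Laurent there and in all adjacent charts. *)
Definition upper c z :=
  lincomb (cX c) (fun=> True) z /\ forall k, k \in uf -> lincomb (muX k c) (fun=> True) z.

Lemma upper_mu c k z : valid uf d c -> k \in uf -> upper c z -> upper (mu k c) z.
Proof.
move=> vc kuf [Hz Hm]; split=> [|l luf]; first exact: Hm.
have [->|lk] := eqVneq l k; first by rewrite (muX_muX vc kuf).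
by apply: (upper_bound_mu vc kuf luf) => //; [rewrite eq_sym|apply: Hm|apply: Hm].
Qed.

Lemma upper_reach c0 c z : valid uf d c0 -> reach uf c0 c -> upper c0 z <-> upper c z.
Proof.
move=> v0; elim=> // c1 k r1 IH kuf; have v1 := reach_valid v0 r1.
rewrite IH; split; first exact: upper_mu.
by move/(upper_mu (mu_valid v1 kuf) kuf); rewrite (mu_mu v1 kuf).
Qed.

Lemma upper_X c g : valid uf d c -> (forall k, k \in uf -> 0 <= g 0 k) ->
  upper c (cX c g).
Proof.
move=> vc g0; split=> [|k kuf]; first exact: lincomb_X.
by apply: (X_mu_ge0 vc kuf); apply: g0.
Qed.

Lemma Laurent c0 c1 c2 g : valid uf d c0 -> reach uf c0 c1 -> reach uf c0 c2 ->
  (forall k, k \in uf -> 0 <= g 0 k) -> lincomb (cX c2) (fun=> True) (cX c1 g).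
Proof.
move=> v0 r1 r2 g0; have := upper_X (reach_valid v0 r1) g0.
by move/(upper_reach _ v0 r1)/(upper_reach _ v0 r2) => [].
Qed.

Lemma fvec_ge0 i k : 0 <= (fvec i : G) 0 k.
Proof. by rewrite fvecE; case: (_ == _). Qed.

Lemma sum_fvec i : \sum_j (fvec i : G) 0 j = 1.
Proof.
rewrite (bigD1 i) //= fv_k big1 ?addr0 // => j ji.
by rewrite fvecE (negbTE ji).
Qed.

Lemma nonneg_ind (Q : G -> Prop) : Q 0 ->
  (forall i g, (forall j, 0 <= g 0 j) -> Q g -> Q (fvec i + g)) ->
  forall g, (forall j, 0 <= g 0 j) -> Q g.
Proof.
move=> Q0 QS g g0; have [m] : exists m : nat, \sum_j g 0 j <= m%:Z.
  by exists (absz (\sum_j g 0 j)); lia.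
elim: m g g0 => [|m IH] g g0 gm.
  have e0 : \sum_j g 0 j = 0.
    by apply/eqP; rewrite eq_le gm sumr_ge0.
  rewrite (_ : g = 0) //; apply/rowP => j; rewrite mxE.
  by apply/eqP; move/eqP: e0; rewrite psumr_eq0 // => /allP/(_ j);
    rewrite mem_index_enum; apply.
have [/existsP[i gi]|/existsPn H] := boolP [exists i, 0 < g 0 i]; last first.
  rewrite (_ : g = 0) //; apply/rowP => j; rewrite mxE.
  by apply/eqP; rewrite eq_le g0 leNgt H.
rewrite -(subrK (fvec i) g) addrC; apply: QS => [j|].
  rewrite rvD rvN fvecE; have := g0 j; case: eqP => [->|_] /=; move: gi; lia.
apply: IH => [j|].
  rewrite rvD rvN fvecE; have := g0 j; case: eqP => [->|_] /=; move: gi; lia.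
under eq_bigr do rewrite rvD rvN.
by rewrite big_split /= sumrN sum_fvec lerBlDr (le_trans gm) // -addn1 PoszD.
Qed.

Section Homogeneity.
Context (A : G -> Prop) (A0 : A 0) (AB : forall g h, A g -> A h -> A (g - h)).

Lemma subgroupN g : A g -> A (- g).
Proof. by move=> Ag; rewrite -sub0r; apply: AB. Qed.
Lemma subgroupD g h : A g -> A h -> A (g + h).
Proof. by move=> Ag Ah; rewrite -[h]opprK; apply/AB/subgroupN. Qed.
Lemma subgroupZ (a : int) g : A g -> A (a *: g).
Proof.
move=> Ag; case: a => m.
  elim: m => [|m IH]; first by rewrite scale0r.
  by rewrite intS scalerDl scale1r; apply: subgroupD.
rewrite NegzE scaleNr; apply: subgroupN; elim: m => [|m IH]; first by rewrite scale1r.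
by rewrite intS scalerDl scale1r; apply: subgroupD.
Qed.

(** Homogeneity for the grading of the initial Laurent ring by Z^I / A, the degree being the class
    of [g]. *)
Definition hom c0 z g := lincomb (cX c0) (fun h => A (h - g)) z.

Lemma hom_mul c0 z y g h : valid uf d c0 ->
  hom c0 z g -> hom c0 y h -> hom c0 (z * y) (g + h).
Proof.
move=> v0 Hz Hy; apply: (lincomb_mul (v_tw v0) _ Hz Hy) => e f Ae Af.
by rewrite opprD addrACA; apply: subgroupD.
Qed.

(** The part of [y] outside the class of [h] would give a product both inside and outside the class
    of g + h, so it is zero. *)
Lemma hom_div c0 z y g h : valid uf d c0 -> z != 0 -> lincomb (cX c0) (fun=> True) y ->
  hom c0 z g -> hom c0 (z * y) (g + h) -> hom c0 y h.
Proof.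
move=> v0 z0 Sy Hz Hzy.
have [y1 [y2 [yE H1 H2]]] := lincomb_split (fun e => A (e - h)) Sy.
have {}H1 : hom c0 y1 h by apply: lincomb_sub H1 => e [].
suff y20 : y2 = 0 by rewrite yE y20 addr0.
have zy2 : hom c0 (z * y2) (g + h).
  have -> : z * y2 = z * y - z * y1 by rewrite yE mulrDr addrC addKr.
  by apply: lincombB => //; apply: hom_mul.
have zy2' : lincomb (cX c0) (fun e => ~ A (e - (g + h))) (z * y2).
  apply: (lincomb_mul (v_tw v0) _ Hz H2) => e f Ae [_ nAf] H; apply: nAf.
  have -> : f - h = (e + f - (g + h)) - (e - g).
    by apply/rowP => i; rewrite !mxE; ring.
  exact: AB.
have /mulK_eq0[z00|//] : z * y2 = 0 by apply: (lincomb_disj (v_ix v0) _ zy2 zy2').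
by rewrite z00 eqxx in z0.
Qed.

(** The second clause carries the induction: it puts the difference of the two exponents of the next
    exchange relation into A, so the relation is homogeneous and x_k can be divided out. *)
Lemma homogeneous V c0 c : V \subset uf -> valid uf d c0 ->
  (forall k, k \in V -> A (pst (cB c0) k)) -> reach V c0 c ->
  exists M : 'M[int]_n, (forall i, hom c0 (cX c (fvec i)) (row i M)) /\
    forall l, l \in uf -> A (pst (cB c) l *m M - pst (cB c0) l).
Proof.
move=> Vuf v0 AV; elim=> [|c1 k r1 [M [HM HA]] kV].
  exists 1%:M; split=> [i|l _]; last by rewrite mulmx1 subrr.
  by apply: lincomb_X; rewrite row1 subrr.
have r1' : reach uf c0 c1 by apply: reach_sub r1.
have kuf : k \in uf by apply: (subsetP Vuf).
have v1 := reach_valid v0 r1'.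
have Ak : A (pst (cB c1) k *m M).
  by rewrite -(subrK (pst (cB c0) k) (_ *m M)); apply: subgroupD; [apply: HA|apply: AV].
exists (Em true (cB c1) k *m M); split=> [i|l luf] /=; last first.
  rewrite mulmxA; have [->|lk] := eqVneq l k.
    rewrite (pst_muk_Em _ _ (v_d v1) (v_B v1)) mulNmx; apply: AB; last exact: AV.
    exact: subgroupN.
  rewrite (pst_mu_Em _ (v_d v1) (v_B v1) lk) mulmxDl -scalemxAl addrAC.
  by apply: subgroupD; [apply: HA|apply: subgroupZ].
rewrite row_mul row_Em; have [->|ik] := eqVneq i k; last first.
  by rewrite (muX_off c1) ?fv_i // fvec_mul.
have mono g : (forall j, 0 <= g 0 j) -> hom c0 (cX c1 g) (g *m M).
  move: g; apply: nonneg_ind => [|j g _ IH].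
    by rewrite mul0mx (X_zero (v_tw v1) (v_ix v1));
      apply: (lincomb1 (v_tw v0) (v_ix v0)); rewrite subrr.
  have := hom_mul v0 (HM j) IH; rewrite (v_tw v1) -fvec_mul -mulmxDl.
  by move/lincomb_qvE.
rewrite (muX_k v1); apply: (hom_div v0 (X_neq0 (fvec k) (v_ix v1)) _ (HM k)).
  by rewrite -(muX_k v1); apply: (Laurent (c1 :=
    mu k c1) v0 (reachS r1' kuf) (reach0 _ _)) => *; apply: fvec_ge0.
rewrite /exch mulrDr !(v_tw v1) /yexp !addrA subrr !add0r.
rewrite mulmxDl mulNmx -fvec_mul addrA subrr add0r.
apply: lincombD; apply: lincomb_qv; first by apply: mono => j; apply: sg_ge0.
apply: lincomb_sub (mono _ (sg_ge0 false (cB c1) k)) => h /= Ah.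
have -> : h - sg true (cB c1) k *m M
   = h - sg false (cB c1) k *m M - pst (cB c1) k *m M.
  by rewrite -sg_sub mulmxBl opprB addrA subrK.
exact: AB.
Qed.

End Homogeneity.
End Patterns.

(** * Leading seeds *)

Section ChartLead.
Context (T : scalars) (n : nat).
Local Notation K := (sK T).
Local Notation G := 'rV[int]_n.
Local Notation ka := (@sa T).
Implicit Types (z y u : K) (g h r : G) (i j k l : 'I_n).
Context (L0 L : 'M[int]_n) (X0 X Xs : G -> K) (W D : 'cV[int]_n).
Context (tw0 : twistedX L0 X0) (ix0 : indepX X0).
Context (tw : twistedX L X) (ix : indepX X).
Context (tws : twistedX L Xs) (ixs : indepX Xs).
Context (HD : forall i, lead X0 W (D i 0) (X (fvec i)) (Xs (fvec i))).

Local Notation nonneg := (fun g : G => forall j, 0 <= g 0 j).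

(** Exponents are nonnegative here because an inverse of a variable of X need not be Laurent in
    X0. *)
Lemma lead_cluster_monomial g : nonneg g -> lead X0 W (wt D g) (X g) (Xs g).
Proof.
move: g; apply: nonneg_ind => [|i g _ IH].
  rewrite (X_zero tw ix) (X_zero tws ixs) -(X_zero tw0 ix0) wt0 -(wt0 W).
  exact: lead_X.
have := lead_mul tw0 (HD i) IH; rewrite tw tws => H.
have wi : wt D (fvec i + g) = D i 0 + wt D g.
  by rewrite wtD wt_fvec.
rewrite wi; move/(lead_qv (- lform L (fvec i) g)): H.
by rewrite !qvKN.
Qed.

(** Terms of lowest D-weight cannot cancel when replaced by their leading parts, since the monomials
    Xs are independent. *)
Lemma lead_nonneg z : z != 0 -> lincomb X nonneg z ->
  exists e y, lead X0 W e z y /\ lincomb Xs (fun=> True) y.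
Proof.
move=> z0 Hz.
have [N HN] : exists N : nat, lincomb X (fun h => nonneg h /\ `|wt D h| < N%:Z) z.
  move: z Hz {z0}; apply: lincomb_ind => [|z y [N HN] [M HM]|c g g0].
  - by exists 0%N; apply: lincomb0.
  - by exists (N + M)%N; apply: lincombD;
    [apply: lincomb_sub HN|apply: lincomb_sub HM] => h [? ?];
      split=> //; lia.
  - by exists (`|wt D g|).+1; apply: lincomb_monomial; split=> //; lia.
have {HN} : lincomb X (fun h => nonneg h /\ - N%:Z <= wt D h < - N%:Z + (N.*2)%:Z) z.
  by apply: lincomb_sub HN => h [h0 hN]; split=> //; lia.
move: (- N%:Z) (N.*2) => lo m; elim: m lo z z0 {Hz} => [|m IH] lo z z0 Hz.
  by case/eqP: z0; apply: (lincomb_empty ix _ Hz) => g [_]; lia.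
have [z1 [z2 [zE H1 H2]]] := lincomb_split (fun h => wt D h = lo) Hz.
have Hz2 : lincomb X0 (fun h => lo < wt W h) z2.
  move: z2 {zE} H2; apply: lincomb_ind => [|z2 y|c g [[g0 gm] gl]];
    [exact: lincomb0|exact: lincombD|].
  apply: lincomb_scale; have := lead_S (lead_cluster_monomial g0).
  by apply: lincomb_sub => h /=; lia.
have [a Ha z1E] := H1; pose y1 := ev Xs a.
have sumS (Q : G -> Prop) (F : G -> K) : (forall g, a@_g != 0 -> lincomb X0 Q (F g)) ->
    lincomb X0 Q (\sum_(g <- msupp a) ka a@_g * F g).
  move=> HF; rewrite big_seq; apply: big_ind => [|u v|g];
    [exact: lincomb0|exact: lincombD|].
  by rewrite -mcoeff_neq0 => ag; apply/lincomb_scale/HF.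
have Hy1 : lincomb X0 (fun h => wt W h = lo) y1.
  apply: sumS => g /Ha [[g0 _] gl].
  by have [_ + _] := lead_cluster_monomial g0; rewrite gl.
have Hzy1 : lincomb X0 (fun h => lo < wt W h) (z1 - y1).
  rewrite z1E /y1 /ev !mmapE -sumrB.
  under eq_bigr do rewrite -mulrBr.
  apply: sumS => g /Ha [[g0 _] gl].
  by have [_ _] := lead_cluster_monomial g0; rewrite gl.
have [y10|y10] := eqVneq y1 0.
  have a0 : a = 0 by apply: ixs.
  have z10 : z1 = 0 by rewrite z1E a0 ev0.
  rewrite z10 add0r in zE; rewrite zE in z0 *.
  apply: (IH (lo + 1) _ z0); apply: lincomb_sub H2 => h [[h0 hm] hl]; split=> //; lia.
exists lo, y1; split; last by exists a.
split=> //; rewrite zE addrAC; exact: lincombD.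
Qed.

(** A monomial of X clears the denominators of [z]; its leading part is a monomial of Xs, which is
    inverted at the end. *)
Lemma lead_in_chart e z y : lincomb X (fun=> True) z -> lead X0 W e z y ->
  lincomb Xs (fun=> True) y.
Proof.
move=> Hz Hl.
have [g [g0 Hg]] : exists g, nonneg g /\ lincomb X nonneg (z * X g).
  move: z Hz {Hl}; apply: lincomb_ind => [|z z' [g [g0 Hg]] [g' [g0' Hg']]|c g _].
  - by exists 0; split=> [j|]; rewrite ?mxE // mul0r; apply: lincomb0.
  - exists (g + g'); split=> [j|]; first by rewrite mxE addr_ge0.
    have E : X (g + g') = qv T (- lform L g g') * (X g * X g') by rewrite tw qvKN.
    have E' : X (g + g') = qv T (- lform L g' g) * (X g' * X g).
      by rewrite tw qvKN addrC.
    rewrite mulrDl {1}E E' !qvCA; apply: lincombD; apply: lincomb_qv; rewrite mulrA.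
      apply: (lincomb_mul tw _ Hg (@lincomb_X _ _ X nonneg _ g0')) => a b a0 b0 j.
      by rewrite mxE addr_ge0.
    apply: (lincomb_mul tw _ Hg' (@lincomb_X _ _ X nonneg _ g0)) => a b a0 b0 j.
    by rewrite mxE addr_ge0.
  - exists (\row_j `|g 0 j|); split=> [j|]; first by rewrite mxE.
    rewrite -mulrA tw; apply/lincomb_scale/lincomb_qv/lincomb_X => j;
      rewrite mxE [(\row__ _) 0 j]mxE.
    by move: (g 0 j) => a; lia.
have z0 : z * X g != 0.
  by apply: mulK_neq0; [apply: lead_neq0 Hl|apply: X_neq0].
have [f [t [Ht St]]] := lead_nonneg z0 Hg.
have [_ tE] := lead_uniq ix0 Ht (lead_mul tw0 Hl (lead_cluster_monomial g0)).
have tXg : t * Xs (- g) = qv T (lform L g (- g)) * y.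
  by rewrite tE -mulrA tws subrr (X_zero tws ixs) mulr1 qvC.
apply/(lincomb_qvE _ _ (lform L g (- g))); rewrite -tXg.
by apply: (lincomb_mul tws _ St (@lincomb_X _ _ Xs (fun=> True) _ I)).
Qed.

End ChartLead.

Section LeadingSeed.
Context (T : scalars) (n : nat) (uf : {set 'I_n}) (d : 'I_n -> int).
Local Notation K := (sK T).
Local Notation G := 'rV[int]_n.
Local Notation ka := (@sa T).
Implicit Types (z y u : K) (g h r : G) (i j k l : 'I_n) (c s : chart T n)
  (M H : 'M[int]_n) (D : 'cV[int]_n).
Context (c0 : chart T n) (v0 : valid uf d c0) (V : {set 'I_n}) (Vuf : V \subset uf).
Context (W : 'cV[int]_n) (WV : forall k, k \in V -> wt W (pst (cB c0) k) = 0).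
Context (WF : forall k, k \in uf -> k \notin V -> 0 < wt W (pst (cB c0) k)).
Local Notation X0 := (cX c0).
Let tw0 := v_tw v0.
Let ix0 := v_ix v0.

(* The data of c with the leading parts X_(c')^(mM) as cluster monomials. *)
Definition sub_chart c c' M : chart T n :=
  Chart (cB c) (cL c) (fun g => cX c' (g *m M)).

Lemma sub_valid c c' M H : valid uf d c -> valid uf d c' -> M *m H = 1%:M ->
  M *m cL c' *m M^T = cL c -> valid uf d (sub_chart c c' M).
Proof.
move=> vc vc' MH ML; split=> /=; try by case: vc.
  by move=> g h; rewrite (v_tw vc') lform_mul ML mulmxDl.
move=> a ea; pose b : {malg sk T[G]} := \sum_(g <- msupp a) << a@_g *g (g *m M) >>.
have b0 : b = 0.
  apply: (v_ix vc'); rewrite /b ev_sum -[RHS]ea [in RHS]/ev mmapE.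
  by apply: eq_bigr => g _; rewrite evU.
apply/malgP => h; rewrite mcoeff0; have [//|ah] := eqVneq (a@_h) 0.
have : b@_(h *m M) = 0 by rewrite b0 mcoeff0.
rewrite /b raddf_sum /= (big_fsetD1 h) /=; last by rewrite -mcoeff_neq0.
rewrite mcoeffUU big1_fset ?addr0 // => g.
rewrite in_fsetD1 => /andP[gh _] _; rewrite mcoeffU; case: eqP => // e.
by case/eqP: gh; rewrite -[g]mulmx1 -MH mulmxA e -mulmxA MH mulmx1.
Qed.

Section Step.
Context (c s : chart T n) (vc : valid uf d c) (vs : valid uf d s).
Context (sB : cB s = cB c) (sL : cL s = cL c) (D : 'cV[int]_n).
Context (HD : forall i, lead X0 W (D i 0) (cX c (fvec i)) (cX s (fvec i))).
Context (k : 'I_n) (kuf : k \in uf) (Sk : lincomb X0 (fun=> True) (exch k c)).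

Let tws : twistedX (cL c) (cX s). Proof. by rewrite -sL; apply: v_tw vs. Qed.

Let monoD g : (forall j, 0 <= g 0 j) -> lead X0 W (wt D g) (cX c g) (cX s g).
Proof.
exact: (lead_cluster_monomial tw0 ix0 (v_tw vc) (v_ix vc) tws (v_ix vs) HD).
Qed.

Let yb_f t : yexp t c k + fvec k = sg t (cB c) k.
Proof. by rewrite /yexp addrAC addNr add0r. Qed.

Let exch_mul : exch k c * cX c (fvec k) =
  qv T (lform (cL c) (yexp true c k) (fvec k)) * cX c (sg true (cB c) k)
  + qv T (lform (cL c) (yexp false c k) (fvec k)) * cX c (sg false (cB c) k).
Proof. by rewrite /exch mulrDl !(v_tw vc) !yb_f. Qed.

Let Xs_mul t : cX s (yexp t c k) * cX s (fvec k)
  = qv T (lform (cL c) (yexp t c k) (fvec k)) * cX s (sg t (cB c) k).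
Proof. by rewrite tws yb_f. Qed.

Let wt_yb t : wt D (yexp t c k) = wt D (sg t (cB c) k) - D k 0.
Proof. by rewrite -yb_f wtD wt_fvec addrK. Qed.

(** The relation is multiplied by x_k, which leaves nonnegative exponents only; the dominant term is
    read off and x_k divided out again. *)
Lemma lead_exch_neq t :
  wt D (sg t (cB c) k) < wt D (sg (~~ t) (cB c) k) ->
  lead X0 W (wt D (yexp t c k)) (exch k c) (cX s (yexp t c k)).
Proof.
move=> lt.
have H : lead X0 W (wt D (sg t (cB c) k)) (exch k c * cX c (fvec k))
    (cX s (yexp t c k) * cX s (fvec k)).
  rewrite exch_mul Xs_mul.
  have K1 t' := lead_qv (lform (cL c) (yexp t' c k) (fvec k)) (monoD (sg_ge0 t' (cB c) k)).
  by case: (t) lt => lt; [|rewrite addrC]; apply: (lead_addl lt).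
have [u Hu uE] := lead_div tw0 ix0 Sk (HD k) H.
rewrite wt_yb; suff -> : cX s (yexp t c k) = u by [].
by apply: (mulIr (X_unit (fvec k) (v_ix vs))).
Qed.

(** The two leading parts cannot cancel: their sum is the exchange binomial of [s] times a monomial,
    which is nonzero. *)
Lemma lead_exch_eq :
  wt D (pst (cB c) k) = 0 -> lead X0 W (wt D (yexp true c k)) (exch k c) (exch k s).
Proof.
rewrite -sg_sub wtD wtN => eq.
have sE : exch k s * cX s (fvec k)
  = cX s (yexp true c k) * cX s (fvec k) + cX s (yexp false c k) * cX s (fvec k).
  by rewrite /exch /yexp sB mulrDl.
have H : lead X0 W (wt D (sg true (cB c) k)) (exch k c * cX c (fvec k))
    (exch k s * cX s (fvec k)).
  have sn0 : exch k s * cX s (fvec k) != 0.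
    by apply: mulK_neq0; [apply: (exch_neq0 vs)|apply/X_neq0/(v_ix vs)].
  move: sn0; rewrite sE exch_mul !Xs_mul => sn0.
  apply: lead_add => //; apply: lead_qv; first by apply/monoD/sg_ge0.
  have -> : wt D (sg true (cB c) k) = wt D (sg false (cB c) k) by lia.
  by apply/monoD/sg_ge0.
have [u Hu uE] := lead_div tw0 ix0 Sk (HD k) H.
rewrite wt_yb; suff -> : exch k s = u by [].
by apply: (mulIr (X_unit (fvec k) (v_ix vs))).
Qed.

Lemma lead_mu : wt D (pst (cB c) k) = 0 -> forall i,
  lead X0 W ((Em true (cB c) k *m D) i 0) (cX (mu k c) (fvec i)) (cX (mu k s) (fvec i)).
Proof.
move=> eq i; rewrite -wt_fvec -wtM fvec_Em.
have [->|ik] := eqVneq i k; first by rewrite /= (muX_k vc) (muX_k vs); apply: lead_exch_eq.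
by rewrite /= !muX_off ?fv_i // wt_fvec; apply: HD.
Qed.

Lemma lead_in_mu z e y : wt D (pst (cB c) k) = 0 ->
  lincomb (cX (mu k c)) (fun=> True) z -> lead X0 W e z y ->
    lincomb (cX (mu k s)) (fun=> True) y.
Proof.
move=> eq; have vmc := mu_valid vc kuf; have vms := mu_valid vs kuf.
have tws' : twistedX (cL (mu k c)) (cX (mu k s)).
  by rewrite /= -sB -sL; exact: (v_tw vms).
exact: (lead_in_chart tw0 ix0 (v_tw vmc) (v_ix vmc) tws' (v_ix vms) (lead_mu eq)).
Qed.

End Step.

(* The leading part of X_c^m is X_(c')^(mM), and D lists the weights of the
   cluster variables of c'. *)
Record leading c c' D M H : Prop := Leading {
  ld_c : reach uf c0 c;
  ld_c' : reach V c0 c';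
  ld_D : forall i, lead X0 W (D i 0) (cX c' (fvec i)) (cX c' (fvec i));
  ld_pst : forall l, l \in uf -> wt D (pst (cB c') l) = wt W (pst (cB c0) l);
  ld_MH : M *m H = 1%:M;
  ld_HM : H *m M = 1%:M;
  ld_lead : forall i,
    lead X0 W (wt D (row i M)) (cX c (fvec i)) (cX c' (row i M));
  ld_Om : M^T *m Om d (cB c) *m M = Om d (cB c');
  ld_L : M *m cL c' *m M^T = cL c;
  ld_frozen : forall i, i \notin uf -> row i M = fvec i }.

Lemma leading0 : leading c0 c0 W 1%:M 1%:M.
Proof.
split; rewrite ?mulmx1 ?trmx1 ?mulmx1 ?mul1mx //; try exact: reach0.
- by move=> i; rewrite -wt_fvec; apply: lead_X.
- by move=> i; rewrite row1; apply: lead_X.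
- by move=> i _; rewrite row1.
Qed.

Section LeadingStep.
Context (c c' : chart T n) (D : 'cV[int]_n) (M H : 'M[int]_n).
Context (I : leading c c' D M H).
Local Notation s := (sub_chart c c' M).

Let c'uf : reach uf c0 c'. Proof. exact: reach_sub Vuf (ld_c' I). Qed.
Let vc : valid uf d c. Proof. exact: (reach_valid v0 (ld_c I)). Qed.
Let vc' : valid uf d c'. Proof. exact: (reach_valid v0 c'uf). Qed.
Let vs : valid uf d s. Proof. exact: sub_valid vc vc' (ld_MH I) (ld_L I). Qed.

Let HD i : lead X0 W ((M *m D) i 0) (cX c (fvec i)) (cX s (fvec i)).
Proof. by rewrite -wt_fvec -wtM /= fvec_mul; apply: (ld_lead I). Qed.

Let Laurent_exch c1 k : reach uf c0 c1 -> k \in uf -> lincomb X0 (fun=> True) (exch k c1).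
Proof.
move=> r1 kuf; rewrite -(muX_k (reach_valid v0 r1)) -[muX k c1]/(cX (mu k c1)).
by apply: (Laurent v0 (reachS r1 kuf) (reach0 _ _)) => j _; apply: fvec_ge0.
Qed.

Let D0 i : i \in V -> wt D (pst (cB c') i) = 0.
Proof. by move=> iV; rewrite (ld_pst I) ?WV ?(subsetP Vuf). Qed.

(** The variables of c' are W-homogeneous, so c' is its own chart of leading parts. As z is Laurent
    in mu_l c', its leading monomial is Laurent there too, and [exponent_ge0] applies. *)
Lemma leading_exponent_ge0 z e g l : l \in V -> upper uf c0 z ->
  lead X0 W e z (cX c' g) -> 0 <= g 0 l.
Proof.
move=> lV uz Hl; have luf := subsetP Vuf _ lV.
have [_ /(_ l luf) Sz] := proj1 (upper_reach z v0 c'uf) uz.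
apply: (exponent_ge0 vc' luf).
apply: (lead_in_mu vc' vc' erefl erefl (ld_D I) luf _ (D0 lV) Sz Hl).
exact: Laurent_exch.
Qed.

Lemma upper_fvec c1 i : reach uf c0 c1 -> upper uf c0 (cX c1 (fvec i)).
Proof.
move=> r1; apply/(upper_reach _ v0 r1)/(upper_X (reach_valid v0 r1)) => k _.
exact: fvec_ge0.
Qed.

Lemma leading_M_ge0 i l : l \in V -> 0 <= M i l.
Proof.
move=> lV; have := leading_exponent_ge0 lV (upper_fvec i (ld_c I)) (ld_lead I i).
by rewrite mxE.
Qed.

Lemma leading_monomial g : (forall k, k \in uf -> 0 <= g 0 k) ->
  (exists e, lead X0 W e (cX c g) (cX c' (g *m M))) /\
  forall l, l \in V -> 0 <= (g *m M) 0 l.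
Proof.
move=> g0; have ug : upper uf c0 (cX c g).
  exact/(upper_reach _ v0 (ld_c I))/(upper_X vc).
have tws : twistedX (cL c) (cX s) by exact: (v_tw vs).
have mono h : (forall j, 0 <= h 0 j) -> lead X0 W (wt (M *m D) h) (cX c h) (cX s h).
  exact: (lead_cluster_monomial tw0 ix0 (v_tw vc) (v_ix vc) tws (v_ix vs) HD).
have [e He] : exists e, lead X0 W e (cX c g) (cX c' (g *m M)).
  have [e [y Hy]] := lead_exists ix0 W (X_neq0 g (v_ix vc)) (proj1 ug).
  (* Frozen coordinates of [g] may be negative; multiplying by x^h brings the exponents into the
     range of [mono]. *)
  exists e; pose h : G := \row_j `|g 0 j|.
  have h0 j : 0 <= h 0 j by rewrite mxE.
  have gh0 j : 0 <= (g + h) 0 j by rewrite rvD [h 0 j]mxE; move: (g 0 j) => a; lia.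
  have E1 := lead_mul tw0 Hy (mono h h0).
  have E2 := lead_qv (lform (cL c) g h) (mono _ gh0).
  rewrite (v_tw vc) in E1; have [_ yE] := lead_uniq ix0 E1 E2.
  rewrite -[cX c' _]/(cX s g); suff -> : cX s g = y by [].
  by apply: (mulIr (X_unit h (v_ix vs))); rewrite yE tws.
by split; [exists e|move=> l lV; apply: leading_exponent_ge0 lV ug He].
Qed.

Section Direction.
Context (k : 'I_n) (kuf : k \in uf).
Local Notation de := (pst (cB c) k *m M).

(** [t] is the sign of the term of lower weight, and M follows this term; the bivector and lambda
    transform correctly because their mutation rules hold for both signs. *)
Lemma leading_step_neq : wt D de != 0 -> exists c1 D1 M1 H1, leading (mu k c) c1 D1 M1 H1.
Proof.
move=> ne; have kk := v_kk vc k.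
have [t lt] : exists t, wt (M *m D) (sg t (cB c) k) < wt (M *m D) (sg (~~ t) (cB c) k).
  move: ne; rewrite wtM -sg_sub wtD wtN => ne.
  by case: (ltgtP (wt (M *m D) (sg true (cB c) k)) (wt (M *m D) (sg false (cB c) k)))
    => [h|h|h]; [exists true|exists false|move: ne; rewrite h subrr eqxx].
exists c', D, (Em t (cB c) k *m M), (H *m Em t (cB c) k); split.
- exact: reachS (ld_c I) kuf.
- exact: ld_c' I.
- exact: ld_D I.
- exact: ld_pst I.
- by rewrite mulmxA -[_ *m M *m H]mulmxA (ld_MH I) mulmx1 EmK.
- by rewrite mulmxA -[H *m _ *m _]mulmxA EmK // mulmx1 (ld_HM I).
- move=> i; rewrite row_mul row_Em /=; have [->|ik] := eqVneq i k; last first.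
    by rewrite muX_off ?fv_i // fvec_mul; apply: (ld_lead I).
  rewrite wtM (muX_k vc).
  exact: (lead_exch_neq vc vs erefl HD (Laurent_exch (ld_c I) kuf) lt).
- rewrite /= (Om_mu k t (v_d vc) (v_B vc)) trmx_mul -(ld_Om I).
  rewrite !mulmxA -[_ *m (Em t _ k)^T *m (Em t _ k)^T]mulmxA -trmx_mul EmK //.
  by rewrite trmx1 mulmx1 -[_ *m Em t _ k *m Em t _ k]mulmxA EmK // mulmx1.
- rewrite /= (muL_sg t (v_L vc) (v_cp vc) kuf kk) trmx_mul -(ld_L I).
  by rewrite !mulmxA.
- move=> i iuf; rewrite row_mul row_Em; case: eqP iuf => [->|_ iuf].
    by rewrite kuf.
  by rewrite fvec_mul (ld_frozen I).
Qed.

Section Homogeneous.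
Context (de0 : wt D de = 0).

(* The variable x_i(c') is Laurent in mu_k c, so its leading part, which is itself,
   is Laurent in the k-th mutation of the chart of leading parts. *)
Lemma inverse_col_ge0 i : 0 <= H i k.
Proof.
have Sz : lincomb (cX (mu k c)) (fun=> True) (cX c' (fvec i)).
  by apply: (Laurent v0 c'uf (reachS (ld_c I) kuf)) => j _; apply: fvec_ge0.
have eq : wt (M *m D) (pst (cB c) k) = 0 by rewrite -wtM.
have := lead_in_mu vc vs erefl erefl HD kuf (Laurent_exch (ld_c I) kuf) eq Sz (ld_D I i).
have -> : cX c' (fvec i) = cX s (fvec i *m H) by rewrite /= -mulmxA (ld_HM I) mulmx1.
by move/(exponent_ge0 vs kuf); rewrite fvec_mul mxE.
Qed.

Lemma inverse_col_frozen i : i \notin uf -> H i k = 0.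
Proof.
move=> iuf; have : fvec i *m H = fvec i.
  by rewrite -{1}(ld_frozen I iuf) -row_mul (ld_MH I) row1.
rewrite fvec_mul => /rowP /(_ k); rewrite mxE => ->; rewrite fv_i //.
by apply: contraNneq iuf => ->.
Qed.

(** The k-th row of the transposed invariance [ld_Om], after cancelling M^T. *)
Lemma pst_leading_sum : d k *: de = \sum_i (H i k * d i) *: pst (cB c') i.
Proof.
have e : (Om d (cB c))^T *m M = H^T *m (Om d (cB c'))^T.
  rewrite -(ld_Om I) !trmx_mul trmxK !mulmxA -trmx_mul (ld_MH I) trmx1 mul1mx.
  by [].
have pstE B j : d j *: pst B j = row j (Om d B)^T.
  by apply/rowP => i; rewrite !mxE mulrC.
rewrite scalemxAl pstE -row_mul e row_mul [row k H^T]rowvec_sum mulmx_suml.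
by apply: eq_bigr => i _; rewrite -scalemxAl !mxE fvec_mul -pstE scalerA.
Qed.

(** Taking D-weights in [pst_leading_sum] gives a vanishing sum of nonnegative terms, in which p^*
    e_i(c') has positive weight for every unfrozen i outside V. *)
Lemma inverse_col_support i : i \notin V -> H i k = 0.
Proof.
move=> iV; have [iuf|iuf] := boolP (i \in uf); last exact: inverse_col_frozen.
have tge0 j : 0 <= H j k * d j * wt D (pst (cB c') j).
  have [juf|juf] := boolP (j \in uf); last by rewrite inverse_col_frozen // !mul0r.
  rewrite mulr_ge0 ?mulr_ge0 ?inverse_col_ge0 ?(ltW (v_d vc _)) // (ld_pst I) //.
  by have [jV|jV] := boolP (j \in V); [rewrite WV|rewrite ltW ?WF].
have : \sum_j H j k * d j * wt D (pst (cB c') j) = 0.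
  transitivity (wt D (d k *: de)); last by rewrite wtZ de0 mulr0.
  rewrite pst_leading_sum /wt mulmx_suml summxE; apply: eq_bigr => j _.
  by rewrite -[RHS]/(wt D _) wtZ.
move/eqP; rewrite psumr_eq0 // => /allP /(_ i); rewrite mem_index_enum => /(_ isT).
rewrite (ld_pst I) // !mulf_eq0 => /orP[/orP[/eqP//|/eqP d0]|/eqP w0].
  by have := v_d vc i; rewrite d0.
by have := WF iuf iV; rewrite w0.
Qed.

Lemma leading_facet : exists2 i0, i0 \in V &
  (forall l, M l i0 = (l == k)%:R) /\ (forall i, H i k = (i == i0)%:R).
Proof.
have e1 l : \sum_i M l i * H i k = (l == k)%:R.
  by have /matrixP/(_ l k) := ld_MH I; rewrite !mxE.
have [i0 Hi0] : exists i, H i k != 0.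
  apply/existsP; apply: contraT => /existsPn H0.
  have := e1 k; rewrite eqxx big1 // => i _.
  by have := H0 i; rewrite negbK => /eqP ->; rewrite mulr0.
have i0V : i0 \in V by apply: contraNT Hi0 => /inverse_col_support ->.
(* Row l of M H = 1, column k: a vanishing sum of nonnegative terms. *)
have M0 l : l != k -> M l i0 = 0.
  move=> lk; have := e1 l; rewrite (negbTE lk) => /eqP; rewrite psumr_eq0 => [|i _].
    move=> /allP/(_ i0); rewrite mem_index_enum => /(_ isT).
    by rewrite mulf_eq0 (negbTE Hi0) orbF => /eqP.
  have [iV|/inverse_col_support ->] := boolP (i \in V); last by rewrite mulr0.
  by rewrite mulr_ge0 ?leading_M_ge0 ?inverse_col_ge0.
have e2 i : H i k * M k i0 = (i == i0)%:R.
  have /matrixP/(_ i i0) := ld_HM I; rewrite !mxE (bigD1 k) //= big1 ?addr0 //.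
  by move=> l lk; rewrite M0 ?mulr0.
have := e2 i0; rewrite eqxx => e3.
have := inverse_col_ge0 i0; have := leading_M_ge0 k i0V => Mge Hge.
have M1 : M k i0 = 1 by nia.
exists i0 => //; split=> [l|i]; last by rewrite -e2 M1 mulr1.
by case: eqP => [->//|/eqP /M0].
Qed.

(* Comparing widths in mu_(i0) c' and in mu_k of the chart of leading parts shows
   that (p^* e_k) M, a priori a multiple of p^* e_(i0), is equal to it. *)
Lemma leading_step_eq : exists c1 D1 M1 H1, leading (mu k c) c1 D1 M1 H1.
Proof.
have [i0 i0V [Mi0 Hk]] := leading_facet; have i0uf := subsetP Vuf _ i0V.
have coM g : (g *m M) 0 i0 = g 0 k.
  rewrite mxE (bigD1 k) //= Mi0 eqxx mulr1 big1 ?addr0 // => l lk.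
  by rewrite Mi0 (negbTE lk) mulr0.
have coH g : (g *m H) 0 k = g 0 i0.
  rewrite mxE (bigD1 i0) //= Hk eqxx mulr1 big1 ?addr0 // => l lk.
  by rewrite Hk (negbTE lk) mulr0.
have dek : d k *: de = d i0 *: pst (cB c') i0.
  rewrite pst_leading_sum (bigD1 i0) //= Hk eqxx mul1r big1 ?addr0 // => i ii.
  by rewrite Hk (negbTE ii) mul0r scale0r.
have de_i0 : de 0 i0 = 0 by rewrite coM (pst_k vc).
have de_neq0 : de != 0.
  apply/eqP => e; have := pst_neq0 vc kuf.
  by rewrite -[pst _ _]mulmx1 -(ld_MH I) mulmxA e mul0mx eqxx.
have eqc : wt (M *m D) (pst (cB c) k) = 0 by rewrite -wtM.
have HY := lead_exch_eq vc vs erefl erefl HD kuf (Laurent_exch (ld_c I) kuf) eqc.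
have sE : exch k s = cX c' (yexp false c k *m M) + cX c' (yexp false c k *m M + de).
  by rewrite /exch /= [yexp true s k](yexp_sub s k) mulmxDl addrC.
have HY' :=
  lead_exch_eq vc' vc' erefl erefl (ld_D I) i0uf (Laurent_exch c'uf i0uf) (D0 i0V).
have w1 W1 : `|wt W1 (pst (cB c') i0)| <= `|wt W1 de|.
  apply: (exponent_width vc' i0uf (g := yexp false c k *m M)) => //.
    by rewrite coM (yexp_k vc).
  rewrite -sE; apply: (lead_in_mu vc' vc' erefl erefl (ld_D I) i0uf _ (D0 i0V) _ HY).
    exact: Laurent_exch.
  rewrite -(muX_k vc) -[muX k c]/(cX (mu k c)).
  by apply: (Laurent v0 (reachS (ld_c I) kuf) (reachS c'uf i0uf)) => j _; apply: fvec_ge0.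
have w2 W1 : `|wt W1 (pst (cB c) k)| <= `|wt W1 (pst (cB c') i0 *m H)|.
  apply: (exponent_width vs kuf (g := yexp false c' i0 *m H)).
  - by rewrite coH (yexp_k vc').
  - by rewrite coH (pst_k vc').
  - apply/eqP => e; have := pst_neq0 vc' i0uf.
    by rewrite -[pst _ _]mulmx1 -(ld_HM I) mulmxA e mul0mx eqxx.
  rewrite -mulmxDl -yexp_sub /= -!mulmxA (ld_HM I) !mulmx1 addrC -/(exch i0 c').
  apply: (lead_in_mu vc vs erefl erefl HD kuf (Laurent_exch (ld_c I) kuf) eqc _ HY').
  rewrite -(muX_k vc') -[muX i0 c']/(cX (mu i0 c')).
  by apply: (Laurent v0 (reachS c'uf i0uf) (reachS (ld_c I) kuf)) => j _; apply: fvec_ge0.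
(* For a weight equal to N on p^* e_(i0), the two width bounds force weight N on (p^* e_k) M as
   well, so d_k = d_(i0) in [dek]. *)
have deE : de = pst (cB c') i0.
  have [W1 [N [N0 HW1]]] := v_rich vc' (fun=> 1).
  have a1 := w1 W1; have a2 := w2 (M *m W1).
  rewrite -!wtM -mulmxA (ld_HM I) mulmx1 in a2.
  have a3 := congr1 (wt W1) dek; rewrite !wtZ in a3; rewrite HW1 // in a1 a2 a3.
  have dki : d k = d i0.
    have := v_d vc k; have := v_d vc i0; move: a1 a2 a3; move: (wt W1 de) => x.
    rewrite mulr1 => b1 b2 b3 di dk; have x0 : 0 < x.
      by rewrite -(pmulr_rgt0 _ dk) b3 mulr_gt0.
    have xN : x = N by lia.
    by apply: (mulIf (_ : N != 0)); [rewrite gt_eqF|rewrite -{1}xN].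
  apply/rowP => j; have := congr1 (fun g : G => g 0 j) dek; rewrite /= !rvZ -dki.
  by apply: mulfI; rewrite gt_eqF // (v_d vc).
pose E := Em false (cB c) k; pose E' := Em false (cB c') i0.
have EE : E *m E = 1%:M by apply/EmK/(v_kk vc).
have EE' : E' *m E' = 1%:M by apply/EmK/(v_kk vc').
have EEt : E^T *m E^T = 1%:M by rewrite -trmx_mul EE trmx1.
have EEt' : E'^T *m E'^T = 1%:M by rewrite -trmx_mul EE' trmx1.
exists (mu i0 c'), (Em true (cB c') i0 *m D), (E *m M *m E'), (E' *m H *m E); split.
- exact: reachS (ld_c I) kuf.
- exact: reachS (ld_c' I) i0V.
- exact: (lead_mu vc' vc' erefl erefl (ld_D I) i0uf (Laurent_exch c'uf i0uf) (D0 i0V)).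
- move=> l luf; rewrite /= -wtM; have [->|li] := eqVneq l i0.
    rewrite (pst_muk_Em _ _ (v_d vc') (v_B vc')) wtN -(ld_pst I i0uf).
    by rewrite (D0 i0V) oppr0.
  rewrite (pst_mu_Em _ (v_d vc') (v_B vc') li) wtD wtZ (D0 i0V) mulr0 addr0.
  exact: (ld_pst I).
- by rewrite -!mulmxA [E' *m (E' *m _)]mulmxA EE' mul1mx [M *m _]mulmxA (ld_MH I) mul1mx.
- by rewrite -!mulmxA [E *m (E *m _)]mulmxA EE mul1mx [H *m _]mulmxA (ld_HM I) mul1mx.
- move=> i; rewrite !row_mul row_Em /= wtM.
  have [->|ik] := eqVneq i k; last first.
    have r0 : row i M 0 i0 = 0 by rewrite mxE Mi0 (negbTE ik).
    rewrite muX_off ?fv_i // fvec_mul (Em_off c' _ r0) (muX_off c' r0).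
    by rewrite -!wtM (Em_off c' _ r0) (Em_off c' _ r0); apply: (ld_lead I).
  rewrite (muX_k vc) -/(yexp false c k).
  (* The two exponents of the leading part of the new variable are those of the exchange relation of
     c' at i0, shifted by [r]; so this leading part is a single monomial of mu_(i0) c'. *)
  pose g := yexp false c k *m M; rewrite -/g.
  have gi : g 0 i0 = -1 by rewrite coM (yexp_k vc).
  pose r : G := g - yexp false c' i0.
  have r0 : r 0 i0 = 0 by rewrite rvD rvN gi (yexp_k vc') subrr.
  have gE : g *m E' = fvec i0 + r.
    by rewrite mulEm gi /r /yexp; apply/rowP => j; rewrite !mxE; ring.
  rewrite gE (muX_add vc' i0uf r0).
  have -> : yexp false c' i0 + r = g by rewrite addrC subrK.
  have -> : yexp true c' i0 + r = g + de.
    by rewrite yexp_sub addrAC [yexp false c' i0 + _]addrC subrK deE.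
  rewrite addrC -sE -!wtM gE mulmxDl fvec_Em eqxx (Em_off c' _ r0).
  have -> : - fvec i0 + sg true (cB c') i0 + r = yexp true c k *m M.
    by rewrite -/(yexp true c' i0) !yexp_sub addrAC [yexp false c' i0 + _]addrC subrK
      mulmxDl deE.
  by rewrite wtM.
- rewrite /= (Om_mu k false (v_d vc) (v_B vc)) (Om_mu i0 false (v_d vc') (v_B vc')).
  rewrite -(ld_Om I) -/E -/E' !trmx_mul !mulmxA.
  rewrite -[_ *m E^T *m E^T]mulmxA EEt mulmx1.
  by rewrite -[_ *m E *m E]mulmxA EE mulmx1.
- rewrite /= /muL -/E -/E' !trmx_mul !mulmxA.
  rewrite -[_ *m E' *m E']mulmxA EE' mulmx1.
  rewrite -[_ *m E'^T *m E'^T]mulmxA EEt' mulmx1.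
  by rewrite -(ld_L I) !mulmxA.
move=> i iuf; have ni j : j \in uf -> (i == j) = false.
  by move=> juf; apply/negbTE; apply: contraNneq iuf => ->.
by rewrite !row_mul row_Em ni // fvec_mul (ld_frozen I iuf) fvec_mul row_Em ni.
Qed.

End Homogeneous.
End Direction.
End LeadingStep.

Lemma leading_exists c : reach uf c0 c -> exists c' D M H, leading c c' D M H.
Proof.
elim=> [|c1 k _ [c' [D [M [H I]]]] kuf].
  by exists c0, W, 1%:M, 1%:M; apply: leading0.
have [e|ne] := eqVneq (wt D (pst (cB c1) k *m M)) 0.
  exact: (leading_step_eq I kuf e).
exact: (leading_step_neq I kuf ne).
Qed.

Lemma leading_cluster_monomial c g : reach uf c0 c ->
  (forall k, k \in uf -> 0 <= g 0 k) ->
  exists c' h, [/\ reach V c0 c', forall l, l \in V -> 0 <= h 0 l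
    & exists e, lead X0 W e (cX c g) (cX c' h)].
Proof.
move=> r1 g0; have [c' [D [M [H I]]]] := leading_exists r1.
have [He Hp] := leading_monomial I g0.
by exists c', (g *m M); split=> //; apply: ld_c' I.
Qed.

End LeadingSeed.

(** * Pointed expansions *)

(** A minimizer of p / q, written without division. *)
Lemma min_ratio (U : eqType) (s : seq U) (P : pred U) (p q : U -> int) :
  (forall x, P x -> 0 < p x /\ 0 < q x) -> has P s ->
  exists x, [/\ x \in s, P x & forall y, y \in s -> P y -> p x * q y <= p y * q x].
Proof.
move=> pq; elim: s => //= x s IH.
have [hs _|ns] := boolP (has P s); last first.
  rewrite orbF => Px; exists x; split; rewrite ?mem_head // => y.
  rewrite inE => /predU1P[-> //|ys] Py.
  by case/hasP: ns; exists y.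
have [y [ys Py Hy]] := IH hs.
have [nPx|Px] := boolP (~~ P x).
  exists y; split; rewrite // ?inE ?ys ?orbT // => z; rewrite inE => /predU1P[->|].
    by rewrite (negbTE nPx).
  exact: Hy.
rewrite negbK in Px; have [px qx] := pq x Px; have [py qy] := pq y Py.
have [le|/ltW le] := leP (p x * q y) (p y * q x).
  exists x; split; rewrite ?mem_head // => z; rewrite inE => /predU1P[-> //|zs] Pz.
  have := Hy z zs Pz; have [pz qz] := pq z Pz => le'.
  rewrite -(ler_pM2r qy); apply: le_trans (_ : p y * q z * q x <= _).
    by rewrite mulrAC -[p y * _ * _]mulrAC ler_pM2r.
  by rewrite -[leRHS]mulrAC ler_pM2r.
exists y; split; rewrite // ?inE ?ys ?orbT // => z; rewrite inE => /predU1P[-> //|].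
exact: Hy.
Qed.

Section Pointed.
Context (T : scalars) (n : nat) (uf : {set 'I_n}) (d : 'I_n -> int).
Local Notation K := (sK T).
Local Notation G := 'rV[int]_n.
Local Notation ka := (@sa T).
Implicit Types (z y u : K) (g h r : G) (i j k l : 'I_n) (c s : chart T n).
Context (c0 : chart T n) (v0 : valid uf d c0).
Local Notation X0 := (cX c0).
Let ix0 := v_ix v0.
Let tw0 := v_tw v0.

Definition lattice g := exists u : 'I_n -> int,
  g = \sum_(k in uf) u k *: pst (cB c0) k.

Lemma homogeneous_cluster_monomial c g : reach uf c0 c ->
  (forall k, k \in uf -> 0 <= g 0 k) -> exists e, hom lattice c0 (cX c g) e.
Proof.
move=> r1 g0; have v1 := reach_valid v0 r1.
have L0 : lattice 0 by exists (fun=> 0); rewrite big1 // => k _; rewrite scale0r.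
have LB g1 g2 : lattice g1 -> lattice g2 -> lattice (g1 - g2).
  move=> [u ->] [w ->]; exists (fun k => u k - w k).
  by rewrite -sumrB; apply: eq_bigr => k _; rewrite scalerBl.
have Lp k : k \in uf -> lattice (pst (cB c0) k).
  move=> kuf; exists (fun j => (j == k)%:R); rewrite (bigD1 k) //= eqxx scale1r.
  by rewrite big1 ?addr0 // => j /andP[_ /negbTE ->]; rewrite scale0r.
have [M [HM _]] := homogeneous L0 LB (subxx _) v0 Lp r1.
have mono h : (forall j, 0 <= h 0 j) -> exists e, hom lattice c0 (cX c h) e.
  move: h; apply: nonneg_ind => [|i h _ [e IH]].
    by exists 0; rewrite (X_zero (v_tw v1) (v_ix v1)); apply: (lincomb1 tw0 ix0);
      rewrite subrr.
  exists (row i M + e); have := hom_mul L0 LB v0 (HM i) IH.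
  by rewrite (v_tw v1) => /lincomb_qvE.
(* Negative frozen exponents are handled by multiplying with x^h and dividing in the graded ring. *)
pose h : G := \row_j `|g 0 j|.
have [e He] : exists e, hom lattice c0 (cX c h) e by apply: mono => j; rewrite mxE.
have [f Hf] : exists f, hom lattice c0 (cX c (h + g)) f.
  by apply: mono => j; rewrite rvD mxE; move: (g 0 j) => b; lia.
exists (f - e).
apply: (hom_div L0 LB v0 (X_neq0 h (v_ix v1)) _ He).
  by apply: (Laurent v0 r1 (reach0 _ _)).
by rewrite addrC subrK (v_tw v1); apply: lincomb_qv.
Qed.

Lemma unique_minimizer c g (a : {malg sk T[G]}) W : reach uf c0 c ->
  (forall k, k \in uf -> 0 <= g 0 k) -> ev X0 a = cX c g ->
  (forall k, k \in uf -> 0 < wt W (pst (cB c0) k)) ->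
  exists h, a@_h = 1 /\ forall h', a@_h' != 0 -> h' != h -> wt W h < wt W h'.
Proof.
move=> r1 g0 aE W0.
have sub0 : set0 \subset uf by apply: sub0set.
have W0' k : k \in set0 -> wt W (pst (cB c0) k) = 0 by rewrite inE.
have [c' [h [rc' _ [e Hl]]]] :=
  leading_cluster_monomial v0 sub0 W0' (fun k kuf _ => W0 k kuf) r1 g0.
have c'E : c' = c0 by case: rc' => // c1 k _; rewrite inE.
rewrite c'E in Hl; exists h; case: Hl => h0 He.
have he : wt W h = e.
  apply/eqP; apply: contraT => /eqP ne; case/eqP: h0.
  apply: (lincomb_disj ix0 _ He (lincomb_X X0 (erefl h) : lincomb X0 (eq h) _)) => f fe fh.
  by rewrite -fh in fe.
rewrite -aE -[cX c0 h]mul1r -(rmorph1 ka) -evU -evN -evD => -[b Hb /(ev_inj ix0) bE].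
have cE h' : b@_h' = a@_h' - (h == h')%:R.
  by rewrite -bE mcoeffD mcoeffN mcoeffU.
split=> [|h' ah' hh'].
  have := Hb h; rewrite cE eqxx he; have [/eqP|_] := eqVneq (a@_h - 1) 0.
    by rewrite subr_eq0 => /eqP ->.
  by move=> /(_ isT); rewrite ltxx.
by have := Hb h'; rewrite cE (eq_sym h) (negbTE hh') subr0 he; apply.
Qed.

(* If some exponent violated positivity at k, tilting the weight W1 towards Wk
   would make two exponents minimal at once. *)
Lemma pointed_expansion c g (a : {malg sk T[G]}) : reach uf c0 c ->
  (forall k, k \in uf -> 0 <= g 0 k) -> ev X0 a = cX c g ->
  exists g0, a@_g0 = 1 /\ forall h, a@_h != 0 -> exists u : 'I_n -> nat,
    h = g0 + \sum_(k in uf) (u k)%:Z *: pst (cB c0) k.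
Proof.
move=> r1 g0 aE.
have [W1 [N1 [N10 HW1]]] := v_rich v0 (fun=> 1).
have W1p k : k \in uf -> 0 < wt W1 (pst (cB c0) k) by move=> kuf; rewrite HW1 // mulr1.
have [h1 [a1 Hh1]] := unique_minimizer r1 g0 aE W1p.
exists h1; split=> // h ah.
have [e He] := homogeneous_cluster_monomial r1 g0.
have supp f : a@_f != 0 -> lattice (f - e).
  by move: He; rewrite -aE => -[b Hb /(ev_inj ix0) ->]; apply: Hb.
have [u uE] : lattice (h - h1).
  have [u uE] := supp h ah; have [w wE] : lattice (h1 - e).
    by apply: supp; rewrite a1 oner_neq0.
  exists (fun k => u k - w k).
  have -> : h - h1 = (h - e) - (h1 - e) by apply/rowP => i; rewrite !mxE; ring.
  by rewrite uE wE -sumrB; apply: eq_bigr => k _; rewrite scalerBl.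
suff u0 k : k \in uf -> 0 <= u k.
  exists (fun k => absz (u k)); rewrite -[LHS](subrK h1) addrC uE; congr (_ + _).
  by apply: eq_bigr => k kuf; rewrite gez0_abs ?u0.
move=> kuf.
have [Wk [Nk [Nk0 HWk]]] := v_rich v0 (fun i => (i == k)%:R).
have wtk : wt Wk (h - h1) = Nk * u k.
  rewrite uE /wt mulmx_suml summxE (bigD1 k) //= -[X in X + _]/(wt _ _) wtZ HWk // eqxx.
  rewrite big1 => [|j /andP[juf /negbTE jk]]; first by rewrite mulr1 addr0 mulrC.
  by rewrite -[LHS]/(wt _ _) wtZ HWk // jk !mulr0.
suff : 0 <= wt Wk (h - h1) by rewrite wtk pmulr_rge0.
rewrite leNgt; apply/negP => bad.
pose v f := wt Wk (f - h1); pose w f := wt W1 (f - h1).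
pose P f := (a@_f != 0) && (v f < 0).
have Pw f : P f -> 0 < w f /\ 0 < - v f.
  move=> /andP[af vf]; split; last by lia.
  rewrite /w wtD wtN subr_gt0; apply: Hh1 => //.
  by apply: contraTneq vf => ->; rewrite /v subrr wt0.
have [f [_ Pf Hf]] : exists f, [/\ f \in (msupp a : seq G), P f
    & forall f', f' \in (msupp a : seq G) -> P f' -> w f * - v f' <= w f' * - v f].
  apply: min_ratio => //; apply/hasP; exists h; first by rewrite -mcoeff_neq0.
  by rewrite /P ah.
have [wf vf] := Pw f Pf.
(* The coefficients make W vanish on f - h1; minimality of the ratio w / (- v) at f makes it
   nonnegative on every other f' - h1. *)
pose W := (- v f) *: W1 + w f *: Wk.
have WE g1 : wt W g1 = - v f * wt W1 g1 + w f * wt Wk g1.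
  by rewrite /wt /W mulmxDr mxE -!scalemxAr !mxE.
have Wp j : j \in uf -> 0 < wt W (pst (cB c0) j).
  move=> juf; rewrite WE HW1 // HWk // mulr1 ltr_wpDr //; last by rewrite mulr_gt0.
  by rewrite mulr_ge0 ?(ltW wf) // mulr_ge0 ?(ltW Nk0).
have [h2 [a2 Hh2]] := unique_minimizer r1 g0 aE Wp.
have Wmin f' : a@_f' != 0 -> wt W h1 <= wt W f'.
  move=> af'; rewrite -subr_ge0 -wtN -wtD WE -/(v f') -/(w f').
  have [f'1|f'1] := eqVneq f' h1; first by rewrite /w /v f'1 subrr !wt0 !mulr0.
  have w0 : 0 < w f' by rewrite /w wtD wtN subr_gt0; apply: Hh1.
  have [v0'|v0'] := leP 0 (v f').
    by rewrite addr_ge0 // mulr_ge0 ?(ltW wf) ?(ltW vf) ?(ltW w0).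
  have : P f' by rewrite /P af' v0'.
  move/(Hf f'); rewrite -mcoeff_neq0 => /(_ af'); lia.
have h21 : h2 = h1.
  apply/eqP; apply: contraT => ne; rewrite eq_sym in ne.
  have a1' : a@_h1 != 0 by rewrite a1 oner_neq0.
  have := Hh2 h1 a1' ne; rewrite ltNge Wmin // a2 oner_neq0 //.
rewrite h21 in Hh2.
have fne : f != h1 by apply: contraTneq vf => ->; rewrite /v subrr wt0 oppr0.
have af : a@_f != 0 by case/andP: Pf.
have := Hh2 f af fne; rewrite -subr_gt0 -wtN -wtD WE -/(v f) -/(w f).
by rewrite mulrC mulrN addNr ltxx.
Qed.

End Pointed.

(** * Monomials as ordered products of cluster variables *)

Section OrderedProduct.
Context (T : scalars) (n : nat) (uf : {set 'I_n}) (d : 'I_n -> int).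
Implicit Types (i j : 'I_n) (m : 'rV[int]_n) (c : chart T n).

Lemma ordered_product_seq c (r : seq 'I_n) m : valid uf d c ->
  pairwise (fun i j => i < j)%N r ->
  \prod_(i <- r) cX c (m 0 i *: fvec i)
  = qv T (\sum_(i <- r) \sum_(j <- r | (i < j)%N) m 0 i * m 0 j * cL c i j)
    * cX c (\sum_(i <- r) m 0 i *: fvec i).
Proof.
move=> vc; elim: r => [|i r IH] /=.
  by rewrite !big_nil qv0 mul1r (X_zero (v_tw vc) (v_ix vc)).
move=> /andP[/allP ir pr]; rewrite big_cons IH // qvCA (v_tw vc) qvDA !big_cons.
congr (qv T _ * _); rewrite ltnn addrC; congr (_ + _).
  rewrite /lform linear_sum mulmx_sumr summxE big_seq [RHS]big_seq_cond.
  rewrite [RHS](eq_bigl (fun j => j \in r)) => [|j]; last first.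
    by have [/ir ->|//] := boolP (j \in r).
  apply: eq_bigr => j _; rewrite -[LHS]/(lform _ _ _) lformZl lformZr lform_fvec.
  by rewrite mulrA.
rewrite big_seq [RHS]big_seq; apply: eq_bigr => j jr; rewrite big_cons.
by rewrite ltnNge ltnW ?ir.
Qed.

Lemma ordered_product c m : valid uf d c ->
  cX c m = qv T (- \sum_(i < n) \sum_(j < n | (i < j)%N) m 0 i * m 0 j * cL c i j)
    * \prod_(i < n) cX c (fvec i) ^ m 0 i.
Proof.
move=> vc.
have -> : \prod_(i < n) cX c (fvec i) ^ m 0 i = \prod_(i < n) cX c (m 0 i *: fvec i).
  by apply: eq_bigr => i _; exact: (X_expz _ _ (v_tw vc) (v_ix vc) (v_L vc)).
rewrite [in LHS](rowvec_sum m) (ordered_product_seq m vc); first by rewrite qvKN.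
rewrite -(pairwise_map (fun i : 'I_n => i : nat) ltn) -sorted_pairwise;
  last exact: ltn_trans.
by rewrite [index_enum _]unlock -enumT val_enum_ord iota_ltn_sorted.
Qed.

End OrderedProduct.

(** * Charts of seeds *)

Section Link.
Context (q : setting) (n : nat) (t0 : seed n) (K : unitRingType).
Context (iota : {rmorphism LP t0 q -> K}).
Context (t0_seed : is_seed_in t0 q) (t0_rank : full_rank t0).
Context (frac : is_fraction_skew_field iota).
Local Notation G := 'rV[int]_n.
Local Notation uf := (unfrozen t0).
Implicit Types (g h m : G) (i j k l : 'I_n).

Lemma lmonM (a b : base_ring q) g h :
  lmon t0 a g * lmon t0 b h = lmon t0 (a * b * vpow q (lform (slam t0) g h)) (g + h).
Proof. exact: (twmulUU (lbichar (slam t0) q)). Qed.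

Definition scal (a : base_ring q) : K := iota (lmon t0 a 0).

Lemma scal_zmod : zmod_morphism scal.
Proof. by move=> a b; rewrite /scal -rmorphB /= /lmon monalgUB. Qed.

Lemma scal_monoid : monoid_morphism scal.
Proof.
split=> [|a b]; rewrite /scal; first exact: (rmorph1 iota).
by rewrite -rmorphM lmonM lform0l vpow0 mulr1 addr0.
Qed.

HB.instance Definition _ := GRing.isZmodMorphism.Build (base_ring q) K scal scal_zmod.
HB.instance Definition _ := GRing.isMonoidMorphism.Build (base_ring q) K scal scal_monoid.

Definition xvar g : K := iota (lmon t0 1 g).

Lemma scal_xvar a g : scal a * xvar g = iota (lmon t0 a g).
Proof. by rewrite /scal /xvar -rmorphM lmonM lform0l vpow0 !mulr1 add0r. Qed.

Lemma iotaE (a : LP t0 q) : iota a = mmap scal xvar a.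
Proof.
rewrite mmapE; under eq_bigr do rewrite scal_xvar.
by rewrite -rmorph_sum; congr (iota _); exact: monalgE.
Qed.

Lemma scalC a y : scal a * y = y * scal a.
Proof.
have comm (b : LP t0 q) : scal a * iota b = iota b * scal a.
  have -> : iota b = \sum_(g <- msupp b) iota (lmon t0 b@_g g).
    by rewrite -rmorph_sum; congr (iota _); exact: monalgE.
  rewrite big_distrr big_distrl /=; apply: eq_bigr => g _.
  rewrite /scal -(rmorphM iota) -[RHS](rmorphM iota) !lmonM lform0l lform0r vpow0
    !mulr1 addr0 add0r.
  by rewrite mulrC.
have [_ Ku /(_ y)[b [e [e0 ->]]]] := frac.
have eu : iota e \is a GRing.unit.
  apply: Ku; rewrite -(rmorph0 iota); apply: contra_neq e0.
  by have [inj _ _] := frac; apply: inj.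
by rewrite mulrA comm -!mulrA; congr (_ * _); apply: commrV; rewrite /GRing.comm comm.
Qed.

Lemma scal_unit (y : K) : y != 0 -> y \is a GRing.unit.
Proof. by have [_ + _] := frac; apply. Qed.

Definition seed_scalars : scalars :=
  @Scalars (base_ring q) K scal (vpow q) scalC scal_unit (vpow0 q) (@vpowD q).

(* Classically the form is replaced by 0, which is compatible and changes nothing
   since v = 1. *)
Definition lamq (L : 'M[int]_n) : 'M[int]_n := if q is Quantum then L else 0.

Lemma lform_zero g h : lform 0 g h = 0.
Proof. by rewrite /lform mulmx0 mul0mx mxE. Qed.

Lemma vpow_lamq L g h : vpow q (lform L g h) = vpow q (lform (lamq L) g h).
Proof. by rewrite /lamq; case: q. Qed.

(* Entries between two frozen vertices may be fractional and never enter an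
   exponent; they are set to 0. *)
Definition seedB : 'M[int]_n :=
  \matrix_(i, j) if (i \in uf) || (j \in uf) then bint t0 i j else 0.

Definition chart0 : chart seed_scalars n := Chart seedB (lamq (slam t0)) (xvar : G ->
  sK seed_scalars).

Definition sdz i : int := (sd t0 i)%:Z.

Lemma is_seed_t0 : is_seed t0.
Proof. by move: t0_seed; rewrite /is_seed_in; case: q => // -[]. Qed.

Lemma sB_int i j : (i \in uf) || (j \in uf) -> sB t0 i j = (seedB i j)%:~R.
Proof.
move=> ij; have [_ _ /(_ i j ij) Z] := is_seed_t0.
by rewrite mxE ij /bint numqK.
Qed.

Lemma sdz_gt0 i : 0 < sdz i.
Proof. by have [/(_ i)] := is_seed_t0. Qed.

Lemma sB_skew i j : sB t0 i j * (sd t0 j)%:R = - (sB t0 j i * (sd t0 i)%:R).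
Proof.
have [sd0 sk _] := is_seed_t0.
pose N := \big[lcmn/1%N]_j sd t0 j.
have dN l : (dvee t0 l * sd t0 l)%N = N by rewrite divnK // (biglcmn_sup l).
have N0 : (0 < N)%N.
  by rewrite /N; elim/big_ind: _ => // x y x0 y0; rewrite lcmn_gt0 x0.
have dv0 l : (dvee t0 l)%:R != 0 :> rat.
  by rewrite pnatr_eq0 -lt0n; have := N0; rewrite -(dN l) muln_gt0 => /andP[].
have dNr l : (dvee t0 l)%:R * (sd t0 l)%:R = N%:R :> rat by rewrite -natrM dN.
apply: (mulfI (mulf_neq0 (dv0 i) (dv0 j))).
rewrite (_ : _ * (sB t0 i j * _) = ((dvee t0 i)%:R * sB t0 i j) * ((dvee t0 j)%:R * (sd
  t0 j)%:R));
  last by ring.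
rewrite (_ : _ * - _ = - ((dvee t0 j)%:R * sB t0 j i) * ((dvee t0 i)%:R * (sd t0 i)%:R));
  last by ring.
by rewrite !dNr sk.
Qed.

Lemma seedB_skew : dskew sdz seedB.
Proof.
move=> i j; have [ij|ij] := boolP ((i \in uf) || (j \in uf)); last first.
  by rewrite !mxE (negbTE ij) orbC (negbTE ij) !mul0r oppr0.
apply: (@intr_inj rat); rewrite intrM rmorphN /= intrM -!sB_int //; last by rewrite orbC.
exact: sB_skew.
Qed.

Lemma clear_denominators (w : 'I_n -> rat) : exists (W : 'cV[int]_n) (N : int),
  0 < N /\ forall i, (W i 0)%:~R = N%:~R * w i.
Proof.
exists (\col_i (numq (w i) * \prod_(j | j != i) denq (w j))), (\prod_j denq (w j)).
split=> [|i]; first by apply: prodr_gt0 => j _; apply: denq_gt0.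
rewrite mxE [in RHS](bigD1 i) //= 2!intrM mulrAC; congr (_ * _).
by rewrite numqE mulrC.
Qed.

Lemma pstar_eE k : k \in uf -> pstar_e t0 k = pst seedB k.
Proof. by move=> kuf; apply/rowP => i; rewrite !mxE kuf orbT. Qed.

(** Full rank gives a rational left inverse C of the exchange matrix; tau C takes the value tau_k on
    p^* e_k, and N clears its denominators. *)
Lemma seedB_rich : rich uf seedB.
Proof.
move=> tau; have /row_fullP[C CB] : row_full (Btilde t0) by rewrite /row_full t0_rank.
pose w i : rat := \sum_k (tau (enum_val k))%:~R * C k i.
have [W [N [N0 HW]]] := clear_denominators w.
exists W, N; split=> // k kuf; apply: (@intr_inj rat).
rewrite wtE rmorph_sum intrM /=.
under eq_bigr => i _ do rewrite intrM mxE -sB_int ?kuf ?orbT // HW mulrCA.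
rewrite -mulr_sumr; congr (_ * _).
under eq_bigr => i _ do rewrite mulr_sumr.
rewrite exchange_big /=; pose k' := enum_rank_in kuf k.
have kE : enum_val k' = k by rewrite enum_rankK_in.
have CBE (l : 'I_#|uf|) : \sum_i C l i * sB t0 i k = (l == k')%:R.
  have /matrixP/(_ l k') := CB; rewrite !mxE => <-; apply: eq_bigr => i _.
  by rewrite !mxE kE.
under eq_bigr => l _.
  under eq_bigr => i _ do rewrite mulrCA [sB _ _ _ * _]mulrC.
  rewrite -mulr_sumr CBE; over.
rewrite (bigD1 k') //= eqxx mulr1 kE big1 ?addr0 // => l /negbTE ->.
by rewrite mulr0.
Qed.

Lemma ev_chart0 (a : {malg (base_ring q)[G]}) : ev (cX chart0) a = iota a.
Proof. by rewrite [RHS]iotaE. Qed.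

Lemma chart0_valid : valid uf sdz chart0.
Proof.
split=> /=.
- exact: sdz_gt0.
- exact: seedB_skew.
- move: t0_seed; rewrite /is_seed_in /lamq; case: q => [_|[_ sk _]] //.
  by rewrite trmx0 oppr0.
- move=> k i kuf ik; move: t0_seed; rewrite /is_seed_in /lamq; case: q => [_|[_ _ [dd]]].
    exact: lform_zero.
  move=> /(_ k kuf)[_ /(_ i)]; rewrite (negbTE ik) pstar_eE //.
- exact: seedB_rich.
- move=> g h; rewrite /qv /= /xvar /scal -!(rmorphM iota) !lmonM lform0l vpow0.
  by rewrite vpow_lamq !mulr1 !mul1r add0r.
- move=> a; rewrite ev_chart0 => ia; have [inj _ _] := frac.
  by apply: inj; rewrite ia rmorph0.
Qed.

End Link.

Section SeedChart.
Context (q : setting) (n : nat) (t0 : seed n) (K : unitRingType).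
Context (iota : {rmorphism LP t0 q -> K}).
Context (t0_seed : is_seed_in t0 q) (t0_rank : full_rank t0).
Context (frac : is_fraction_skew_field iota).
Local Notation G := 'rV[int]_n.
Local Notation uf := (unfrozen t0).
Local Notation T := (seed_scalars frac).
Local Notation d := (sdz t0).
Implicit Types (g h m : G) (i j k l : 'I_n) (t : cseed n K) (c : chart T n).

Record repr (U : {set 'I_n}) t c : Prop := Repr {
  r_uf : unfrozen t = U;
  r_B : forall i j, (i \in uf) || (j \in uf) -> sB t i j = (cB c i j)%:~R;
  r_L : lamq q (slam t) = cL c;
  r_X : forall i, cvar t i = cX c (fvec i) }.

Definition order_twist m (L : 'M[int]_n) : int :=
  - \sum_(i < n) \sum_(j < n | (i < j)%N) m 0 i * m 0 j * L i j.

Lemma vpow_twist m L : vpow q (order_twist m L) = vpow q (order_twist m (lamq q L)).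
Proof. by rewrite /lamq; case: q. Qed.

Lemma vK_twist m L : vK iota (order_twist m L) = qv T (order_twist m (lamq q L)).
Proof. exact: (congr1 (scal iota) (vpow_twist m L)). Qed.

Lemma xmon_repr U t c m : valid uf d c -> repr U t c -> xmon iota t m = cX c m.
Proof.
move=> vc [_ _ rL rX].
have e : \prod_(i < n) cvar t i ^ m 0 i = \prod_(i < n) (cX c (fvec i) : K) ^ m 0 i.
  by apply: eq_bigr => i _; rewrite rX.
rewrite (ordered_product m vc) -/(order_twist m (cL c)) -rL -vK_twist.
by rewrite /xmon e.
Qed.

End SeedChart.

Lemma lamq_mut (q : setting) (n : nat) (t : seed n) (B : 'M[int]_n) (k : 'I_n) :
  negvec t k = sg false B k ->
  lamq q (slam (mut_seed t k)) = muL k B (lamq q (slam t)).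
Proof.
move=> negE; rewrite /lamq /muL; case: q; first by rewrite mulmx0 mul0mx.
apply/matrixP => i j; rewrite mxE -lform_fvec -lform_mul !fvec_mul !row_Em.
by rewrite /mut_g negE.
Qed.

Section ClusterSide.
Context (q : setting) (n : nat) (t0 : seed n) (K : unitRingType).
Context (iota : {rmorphism LP t0 q -> K}).
Context (t0_seed : is_seed_in t0 q) (t0_rank : full_rank t0).
Context (frac : is_fraction_skew_field iota).
Local Notation G := 'rV[int]_n.
Local Notation uf := (unfrozen t0).
Local Notation T := (seed_scalars frac).
Local Notation d := (sdz t0).
Local Notation c0 := (chart0 frac).
Let v0 : valid uf d c0 := chart0_valid t0_seed t0_rank frac.
Implicit Types (g h m : G) (i j k l : 'I_n) (t : cseed n K) (c : chart T n).

Lemma intr_max0 (a : int) : (Num.max a 0)%:~R = Num.max a%:~R 0 :> rat.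
Proof.
case: (leP 0 a) => a0; first by rewrite max_l // ler0z.
by rewrite max_r // lerz0 ltW.
Qed.

Lemma repr0 : repr uf (init_cseed iota) c0.
Proof. by split=> // i j ij; apply: (sB_int t0_seed). Qed.

Lemma repr_mu U t c k : valid uf d c -> k \in uf -> repr U t c ->
  repr U (mut_cseed iota k t) (mu k c).
Proof.
move=> vc kuf r; have [rU rB rL rX] := r.
have bE i : bint t i k = cB c i k by rewrite /bint rB ?kuf ?orbT // numq_int.
have negE : negvec t k = sg false (cB c) k by apply/rowP => i; rewrite !mxE bE.
have posE : posvec t k = sg true (cB c) k by apply/rowP => i; rewrite !mxE bE.
split=> [//|i j ij||i].
- rewrite /= !mxE; case: ifP => [_|/negbT]; first by rewrite rmorphN /= rB.
  rewrite !rmorphB !rmorphD !rmorphM /= !intr_max0 !rmorphN /=.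
  by rewrite -!rB ?kuf ?orbT.
- by rewrite (lamq_mut _ negE) rL.
rewrite /=; have [->|ik] := eqVneq i k; last by rewrite (muX_off c) ?fv_i.
by rewrite posE negE !(xmon_repr _ vc r) (muX_k vc).
Qed.

Lemma reach_chart t : mut_reachable iota t ->
  exists2 c, reach uf c0 c & repr uf t c.
Proof.
elim=> [|t1 k _ [c rc r] kuf]; first by exists c0; [apply: reach0|apply: repr0].
have k1 : k \in uf by rewrite (r_uf r) in kuf.
exists (mu k c); first exact: reachS.
by apply: repr_mu => //; apply: reach_valid rc.
Qed.

Lemma chart_reach (F : {set 'I_n}) c : reach (uf :\: F) c0 c ->
  exists2 t, @mut_reachable q n (freeze_seed t0 F) K iota t & repr (uf :\: F) t c.
Proof.
elim=> [|c1 k rc [t rt r] kV].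
  exists (@init_cseed q n (freeze_seed t0 F) K iota); first exact: mut_refl.
  by split=> //; have [] := repr0.
have kuf : k \in uf by move: kV; rewrite inE => /andP[].
exists (@mut_cseed q n (freeze_seed t0 F) K iota k t).
  by apply: mut_step => //; rewrite (r_uf r).
apply: (@repr_mu (uf :\: F) t c1 k) => //.
by apply: (reach_valid v0); apply: reach_sub rc; apply: subsetDl.
Qed.

End ClusterSide.

(** * Pointed expansions in the initial cluster and their freezing *)

Section Expansion.
Context (q : setting) (n : nat) (t0 : seed n) (K : unitRingType).
Context (iota : {rmorphism LP t0 q -> K}).
Context (t0_seed : is_seed_in t0 q) (t0_rank : full_rank t0).
Context (frac : is_fraction_skew_field iota).
Local Notation G := 'rV[int]_n.
Local Notation uf := (unfrozen t0).
Local Notation T := (seed_scalars frac).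
Local Notation d := (sdz t0).
Local Notation c0 := (chart0 frac).
Let v0 : valid uf d c0 := chart0_valid t0_seed t0_rank frac.
Implicit Types (g h m : G) (i j k l : 'I_n) (t : cseed n K) (c : chart T n)
  (u : Nuf t0).

Lemma pstarE u : pstar u =
  \sum_(k : {k : 'I_n | k \in uf}) (u k)%:Z *: pst (seedB t0) (val k).
Proof.
apply: eq_bigr => k _; rewrite pstar_eE ?(valP k) //.
by rewrite -scaler_nat; congr (_ *: _); rewrite natz.
Qed.

Lemma wt_pstar (W : 'cV[int]_n) (N : int) (tau : 'I_n -> int) u :
  (forall k, k \in uf -> wt W (pst (seedB t0) k) = N * tau k) ->
  wt W (pstar u)
  = N * \sum_(k : {k : 'I_n | k \in uf}) (u k)%:Z * tau (val k).
Proof.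
move=> HW; rewrite pstarE /wt mulmx_suml summxE mulr_sumr; apply: eq_bigr => k _.
by rewrite -[LHS]/(wt _ _) wtZ HW ?(valP k) // mulrCA.
Qed.

Lemma pstar_eq0 u : pstar u = 0 -> u = [ffun=> 0%N].
Proof.
move=> pu; have [W [N [N0 HW]]] := v_rich v0 (fun=> 1).
have := wt_pstar u HW; rewrite pu wt0 => /esym/eqP.
rewrite mulf_eq0 gt_eqF //= psumr_eq0 => [|k _]; last by rewrite mulr1.
move=> /allP H; apply/ffunP => k; rewrite ffunE.
by have := H k (mem_index_enum _); rewrite mulr1 => /eqP [].
Qed.

Lemma iota_expansion (P : pred (Nuf t0)) g (a : {malg (base_ring q)[Nuf t0]}) :
  iota (expansion P g a)
  = \sum_(u <- msupp a | P u) scal iota a@_u * xvar iota (g + pstar u).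
Proof.
rewrite /expansion rmorph_sum; apply: eq_bigr => u _.
by rewrite scal_xvar.
Qed.

Lemma cluster_monomial_chart (z : K) : localized_cluster_monomial q t0 iota z ->
  exists c m, [/\ reach uf c0 c, forall i, i \in uf -> 0 <= m 0 i & z = cX c m].
Proof.
move=> [t [m [rt m0 ->]]]; have [c rc r] := reach_chart t0_seed t0_rank frac rt.
exists c, m; split=> // [i iuf|]; first by apply: m0; rewrite (r_uf r).
exact: (xmon_repr _ (reach_valid v0 rc) r).
Qed.

Lemma expansion_exists (z : K) : localized_cluster_monomial q t0 iota z ->
  exists gc, has_expansion iota z gc.
Proof.
move=> /cluster_monomial_chart[c [m [rc m0 zE]]].
have [a _ aE] := Laurent v0 rc (reach0 _ _) m0.
have [g [ag Hg]] := pointed_expansion v0 rc m0 (esym aE).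
(* A choice of u with h = g + p^* u; its value is arbitrary for h outside g + p^* N^I_uf. *)
pose ups (h : G) := epsilon (inhabits [ffun=> 0%N]) (fun u => h = g + pstar u).
have upsE h : a@_h != 0 -> h = g + pstar (ups h).
  move=> /Hg[u hE];
    apply: (epsilon_spec (inhabits [ffun=> 0%N]) (fun u => h = g + pstar u)).
  exists [ffun k => u (val k)]; rewrite hE pstarE; congr (_ + _).
  under [RHS]eq_bigr => k _ do rewrite ffunE.
  by rewrite (big_sub (mem uf) (fun k => (u k)%:Z *: pst (seedB t0) k)).
pose b : {malg (base_ring q)[Nuf t0]} := \sum_(h <- msupp a) << a@_h *g ups h >>.
exists (g, b); split=> /=.
  rewrite iota_expansion /= -[RHS]mmapE /b raddf_sum /=.
  rewrite zE aE /ev mmapE big_seq [RHS]big_seq; apply: eq_bigr => h.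
  by rewrite -mcoeff_neq0 => /upsE hE; rewrite mmapU -hE.
have ag0 : a@_g != 0 by rewrite ag oner_neq0.
rewrite /b raddf_sum /= (big_fsetD1 g) /=; last by rewrite -mcoeff_neq0.
have ug : ups g = [ffun=> 0%N].
  apply: pstar_eq0; apply: (addrI g); rewrite addr0; exact/esym/upsE.
rewrite mcoeffU ug eqxx ag big1_fset ?addr0 // => h.
rewrite in_fsetD1 => /andP[hg]; rewrite -mcoeff_neq0 => /upsE hE _.
rewrite mcoeffU; case: eqP => // uh; case/eqP: hg; rewrite hE uh.
rewrite (_ : pstar _ = 0) ?addr0 // pstarE big1 // => k _.
by rewrite ffunE scale0r.
Qed.

(** Stated for an arbitrary pointed expansion, so that it covers the pair selected by
    [expansion_of]. The weight of p^* u is N times the sum of the u_k with k in F. *)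
Lemma lead_expansion (F : {set 'I_n}) (W : 'cV[int]_n) (N : int) (z : K) g
    (a : {malg (base_ring q)[Nuf t0]}) :
  0 < N -> (forall k, k \in uf -> wt W (pst (seedB t0) k) = N * (k \in F)%:R) ->
  has_expansion iota z (g, a) ->
  lead (T := T) (cX c0) W (wt W g) z (iota (expansion (supp_disjoint F) g a)).
Proof.
move=> N0 HW [/= zE a0]; have wp u := wt_pstar u HW.
have dis u : supp_disjoint F u -> wt W (pstar u) = 0.
  move=> /forallP H; rewrite wp big1 ?mulr0 // => k _.
  have := H k; have [->|_ /=] := eqVneq (u k) 0%N; first by rewrite mul0r.
  by move/negbTE ->; rewrite mulr0.
have ndis u : ~~ supp_disjoint F u -> 0 < wt W (pstar u).
  rewrite negb_forall => /existsP[k]; rewrite negb_imply negbK => /andP[uk kF].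
  rewrite wp mulr_gt0 // (bigD1 k) //= kF mulr1; apply: ltr_wpDr.
    by apply: sumr_ge0 => l _; rewrite mulr_ge0 // ler0n.
  by rewrite ltz_nat lt0n.
have Ssum (P : pred (Nuf t0)) (Q : G -> Prop) : (forall u, P u -> Q (g + pstar u)) ->
    lincomb (T :=
      T) (cX c0) Q (\sum_(u <- msupp a | P u) scal iota a@_u * xvar iota (g + pstar u)).
  move=> PQ; apply: (big_ind (lincomb (T := T) (cX c0) Q)).
  - exact: (@lincomb0 T).
  - exact: (@lincombD T).
  - by move=> u Pu; apply: (@lincomb_monomial T n (cX c0) Q); apply: PQ.
split.
- have [inj _ _] := frac; apply/eqP => e0.
  have {}e0 : expansion (supp_disjoint F) g a = 0 by apply: inj; rewrite e0 rmorph0.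
  have := congr1 (mcoeff g) e0; rewrite mcoeff0 /expansion raddf_sum /=.
  have z0 : supp_disjoint F ([ffun=> 0%N] : Nuf t0).
    by apply/forallP => k; rewrite ffunE eqxx.
  have p0 : pstar ([ffun=> 0%N] : Nuf t0) = 0.
    by rewrite pstarE big1 // => k _; rewrite ffunE scale0r.
  rewrite big_mkcond (big_fsetD1 [ffun=> 0%N]) /=; last first.
    by rewrite -mcoeff_neq0 a0 oner_neq0.
  rewrite z0 a0 p0 addr0 /lmon mcoeffUU big1_fset => [|u]; last first.
    rewrite in_fsetD1 => /andP[u0 _] _; case: ifP => // _.
    rewrite mcoeffU; case: eqP => // e; case/eqP: u0; apply: pstar_eq0.
    by apply: (addrI g); rewrite addr0.
  by rewrite addr0 => /eqP; rewrite oner_eq0.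
- rewrite iota_expansion; apply: Ssum => u /dis wu.
  by rewrite wtD wu addr0.
rewrite zE !iota_expansion.
rewrite [X in X - _](bigID (supp_disjoint F)) /= [X in X - _]addrC addrK.
by apply: Ssum => u /ndis; rewrite wtD ltrDl.
Qed.

End Expansion.

Theorem theorem1p1 (q : setting) (n : nat) (t0 : seed n) (F : {set 'I_n})
    (K : unitRingType) (iota : {rmorphism LP t0 q -> K}) (z : K) :
  is_seed_in t0 q -> full_rank t0 -> F \subset unfrozen t0 ->
  is_fraction_skew_field iota ->
  localized_cluster_monomial q t0 iota z ->
  localized_cluster_monomial q (freeze_seed t0 F) iota
    (iota (freezing iota F z)).
Proof.
move=> t0_seed t0_rank Fuf frac Hz.
have v0 := chart0_valid t0_seed t0_rank frac.
have [W [N [N0 HW]]] := v_rich v0 (fun k => (k \in F)%:R).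
have Hexp : has_expansion iota z (expansion_of iota z).
  exact: (epsilon_spec (inhabits (0, 0)) _ (expansion_exists t0_seed t0_rank frac Hz)).
have [c [m [rc m0 zE]]] := cluster_monomial_chart t0_seed t0_rank frac Hz.
have WV k : k \in unfrozen t0 :\: F -> wt W (pst (seedB t0) k) = 0.
  by rewrite inE => /andP[/negbTE kF kuf]; rewrite HW // kF mulr0.
have WF k : k \in unfrozen t0 -> k \notin unfrozen t0 :\: F -> 0 < wt W (pst (seedB t0) k).
  by rewrite inE => kuf; rewrite kuf andbT negbK => kF; rewrite HW // kF mulr1.
have [c' [h [rc' h0 [e He]]]] :=
  leading_cluster_monomial v0 (subsetDl _ F) WV WF rc m0.
have := lead_expansion t0_seed t0_rank frac N0 HW.
move=> /(_ z (expansion_of iota z).1 (expansion_of iota z).2).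
rewrite -surjective_pairing => /(_ Hexp) He'.
(* The freezing and the monomial of c' are both the lowest part of z, hence equal. *)
rewrite -zE in He; have [_ fE] := lead_uniq (v_ix v0) He' He.
have [t rt r] := chart_reach t0_seed t0_rank rc'.
exists t, h; split=> //.
  by move=> i; rewrite (r_uf r); apply: h0.
rewrite /freezing fE.
have vc' : valid (unfrozen t0) (sdz t0) c'.
  by apply: (reach_valid v0); apply: reach_sub rc'; apply: subsetDl.
exact: (esym (xmon_repr h vc' r)).
Qed.
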